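(* Let $I\subset\mathbb{R}$ be a closed interval and let $\Phi:I\to\mathbb{R}$ be a smooth convex function such that the function $$\Psi(u,v):=\Phi(u+v)-\Phi(u)-\Phi'(u)\,v$$ is non-negative and convex on $\{(u,v)\in\mathbb{R}^2:\ u\in I,\ u+v\in I\}$. Let $(X_t)_{t\ge0}$ be a pure jump Lévy process on $\mathbb{R}^d$ with infinitesimal generator of the form $$(Lf)(x)=\lambda\int_{\mathbb{R}^d}\Big[D_yf(x)-\sum_{k=1}^d\theta_k\,\frac{y_k}{1+|y|^2}\,\partial_kf(x)\Big]\,d\nu(y),$$ where $\lambda>0$, $\theta\in\mathbb{R}^d$, $\nu$ is a Lévy measure on $\mathbb{R}^d$, and $D_yf(x):=f(x+y)-f(x)$. Let $P_tf(x):=\mathbb{E}(f(X_t)\mid X_0=x)$. Then for every $t>0$ and every smooth $f:\mathbb{R}^d\to I$, $$\mathrm{Ent}^\Phi_{P_t}(f)\le\lambda\,t\,P_t\Big(\int_{\mathbb{R}^d}\Psi(f,D_yf)\,d\nu(y)\Big)$$ pointwise on $\mathbb{R}^d$.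
   Context: For each $x$, $\mathrm{Ent}^\Phi_{P_t}(f)(x):=P_t(\Phi(f))(x)-\Phi(P_tf(x))\in[0,+\infty]$, i.e. the $\Phi$-entropy of $f$ with respect to the probability measure $P_t(\cdot)(x)$; it is only considered when $f$ is integrable for this measure. A Lévy measure is a positive Borel measure $\nu$ on $\mathbb{R}^d$ with $\nu(\{0\})=0$ and $\int\min(1,|y|^2)\,d\nu(y)<\infty$; it is implicit that $\nu$ and $\theta$ are such that the integral defining $Lf$ converges for smooth compactly supported $f$. *)

(* Defs.v *)
From HB Require Import structures.
From mathcomp Require Import all_boot all_order all_algebra.
From mathcomp Require Import all_classical all_reals all_analysis.

Set Implicit Arguments.
Unset Strict Implicit.
Unset Printing Implicit Defensive.

Import Order.TTheory GRing.Theory Num.Theory.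
Import numFieldNormedType.Exports.

Local Open Scope classical_set_scope.
Local Open Scope ring_scope.

(* The measurable structure put on matrices, hence on R^d = 'rV[R]_d, is the
   Borel sigma-algebra. *)
Definition borel_mx_display : measure_display.
Proof. exact. Qed.

Section borel_matrix.
Context (R : realType) (m n : nat).

Definition borel_mx : set (set 'M[R]_(m, n)) := <<s [set A | open A] >>.

Let borel_mx0 : borel_mx set0.
Proof. exact: sigma_algebra0. Qed.

Let borel_mxC A : borel_mx A -> borel_mx (~` A).
Proof. exact: sigma_algebraC. Qed.

Let borel_mx_bigcup (F : (set 'M[R]_(m, n))^nat) :
  (forall i, borel_mx (F i)) -> borel_mx (\bigcup_i F i).
Proof. exact: sigma_algebra_bigcup. Qed.

HB.instance Definition _ := @isMeasurable.Build borel_mx_display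
  'M[R]_(m, n) borel_mx borel_mx0 borel_mxC borel_mx_bigcup.

End borel_matrix.

Section functions_on_an_interval.
Context (R : realType).
Implicit Types (I : set R) (g : R -> R).

(* Calculus inside I: increments are restricted to h with u + h in I, so that
   derivatives are one-sided at an endpoint of I belonging to I. *)
Definition diff_quot_in I g (u : R) : set_system R :=
  (fun h : R => h^-1 * (g (u + h) - g u)) @ within [set h | I (u + h)] 0^'.

Definition derivable_in I g u : Prop := cvg (diff_quot_in I g u).

Definition deriv_in I g : R -> R := fun u => lim (diff_quot_in I g u).

Definition smooth_in I g : Prop :=
  forall n u, I u -> derivable_in I (iter n (deriv_in I) g) u.

Definition Psi I g (u v : R) : R := g (u + v) - g u - deriv_in I g u * v.

Definition Psi_domain I : set (R^o * R^o)%type :=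
  [set p | I p.1 /\ I (p.1 + p.2)].

End functions_on_an_interval.

Section functions_on_Rd.
Context (R : realType) (d : nat).
Implicit Types (f : 'rV[R]_d -> R) (x y : 'rV[R]_d).

Definition partial (k : 'I_d) f : 'rV[R]_d -> R := 'D_(delta_mx 0 k) f.

Definition iter_partial (s : seq 'I_d) f : 'rV[R]_d -> R := foldr partial f s.

Definition smooth f : Prop :=
  forall s, continuous (iter_partial s f) /\
    forall k x, derivable (iter_partial s f) x (delta_mx 0 k).

Definition smooth_compactly_supported f : Prop :=
  smooth f /\ compact (closure [set x | f x != 0]).

Definition D_ y f x : R := f (x + y) - f x.

(* Squared Euclidean norm; the library norm on matrices is the sup norm. *)
Definition sqnorm y : R := \sum_(k < d) y 0 k ^+ 2.

End functions_on_Rd.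

Section levy.
Context (R : realType) (d : nat).
Implicit Types (nu : {measure set 'rV[R]_d -> \bar R}) (theta x y : 'rV[R]_d)
  (f : 'rV[R]_d -> R).

Definition levy_measure nu : Prop :=
  nu [set 0] = 0%E /\ (\int[nu]_y (Num.min 1 (sqnorm y))%:E < +oo)%E.

Definition levy_integrand theta f x y : R :=
  D_ y f x -
  \sum_(k < d) theta 0 k * (y 0 k / (1 + sqnorm y)) * partial k f x.

Definition levy_integrable theta nu : Prop :=
  forall f, smooth_compactly_supported f ->
  forall x, nu.-integrable setT (EFin \o levy_integrand theta f x).

Definition levy_operator (lambda : R) theta nu f x : R :=
  lambda * \int[nu]_y levy_integrand theta f x y.

Context (dO : measure_display) (Omega : measurableType dO)
  (P : probability Omega R).

Definition increment (X : R -> {RV P >-> 'rV[R]_d}) (s t : R) :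
  Omega -> 'rV[R]_d := fun w => X t w - X s w.

(* Taking some of the A i equal to setT gives the product rule for all the
   subfamilies. *)
Definition independent n (Y : 'I_n -> Omega -> 'rV[R]_d) : Prop :=
  forall A : 'I_n -> set 'rV[R]_d, (forall i, measurable (A i)) ->
  P (\bigcap_(i in setT) (Y i @^-1` A i)) = (\prod_(i < n) P (Y i @^-1` A i))%E.

Definition cadlag (p : R -> 'rV[R]_d) : Prop :=
  (forall t : R, 0 <= t -> p s @[s --> t^'+] --> p t) /\
  (forall t : R, 0 < t -> cvg (p s @[s --> t^'-])).

(* Time is [0, +oo[; the values of X at negative times are irrelevant. *)
Record levy_process (X : R -> {RV P >-> 'rV[R]_d}) : Prop := LevyProcess {
  levy_start : {ae P, forall w, X 0 w = 0};
  levy_independent_increments : forall n (t : nat -> R), 0 <= t 0%N ->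
    (forall i, (i < n)%N -> t i <= t i.+1) ->
    independent (fun i : 'I_n => increment X (t i) (t i.+1));
  levy_stationary_increments : forall s h : R, 0 <= s -> 0 <= h ->
    forall A : set 'rV[R]_d, measurable A ->
    P (increment X s (s + h) @^-1` A) = P (increment X 0 h @^-1` A);
  levy_cadlag : {ae P, forall w, cadlag (fun t => X t w)}
}.

(* P_t g (x) = E (g (X_t) | X_0 = x): the process issued from x is x + X. It is
   defined for extended-real valued functions, since the integrated
   term Psi (f, D f) may have an infinite nu-integral. *)
Definition semigroup (X : R -> {RV P >-> 'rV[R]_d}) (t : R)
    (g : 'rV[R]_d -> \bar R) (x : 'rV[R]_d) : \bar R :=
  (\int[P]_w g (x + X t w)%R)%E.

(* The law of x + X_t integrates f. *)
Definition semigroup_integrable (X : R -> {RV P >-> 'rV[R]_d}) (t : R) f x :=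
  P.-integrable setT (fun w => (f (x + X t w))%:E).

Definition rsemigroup (X : R -> {RV P >-> 'rV[R]_d}) (t : R) f x : R :=
  fine (semigroup X t (EFin \o f) x).

(* Smooth compactly supported functions lie in the domain of the (sup norm)
   infinitesimal generator of the semigroup, which acts on them as L. *)
Definition has_generator (X : R -> {RV P >-> 'rV[R]_d})
    (L : ('rV[R]_d -> R) -> 'rV[R]_d -> R) : Prop :=
  forall f, smooth_compactly_supported f ->
  {uniform, (fun h x => h^-1 * (rsemigroup X h f x - f x)) @ 0^'+ --> L f}.

(* Ent^Phi_{P_t} (f) (x); the first term is +oo when Phi o f is not
   integrable. *)
Definition Phi_entropy (X : R -> {RV P >-> 'rV[R]_d}) (t : R) (Phi : R -> R)
    f x : \bar R :=
  (semigroup X t (fun z => (Phi (f z))%:E) x - (Phi (rsemigroup X t f x))%:E)%E.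

End levy.

(* Main.v *)
(* Write A(a, b) = Phi(b) - Phi(a) - Phi'(a) (b - a), so that A(a, b) = Psi(a, b - a)
   and convexity of Psi is joint convexity of A.

   Suppose first that f is continuous with values in a compact subinterval of I.
   Let mu be the law of X_(t/n), so that P_t is the n-th power of the
   convolution operator T by mu. Localize the jumps by a smooth partition of
   unity, indexed by labels: finitely many small cells covering the jumps y with
   delta < |y| < r, and one label None for all the others. Conditioning on the
   label writes T = sum_i p_i T_i, where the T_i are commuting Markov operators.
   Revealing the n labels one at a time and using Jensen's inequality for A, the
   entropy of f is at most n T^(n-1) (sum_i p_i A(T_None f, T_i f)), up to the
   entropy left inside the label classes, which is small because it involves
   squared increments of a Lipschitz approximation of f. When n tends to
   infinity, n p_i tends to lambda t nu(w_i), because the generator is known on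
   smooth compactly supported functions vanishing near the origin, T_i f gets
   close to f(. + y_i) with y_i in the cell i, and T_None f gets close to f.
   Refining the partition yields the integral of A(f, f(. + y)) against nu.

   For a general f, project f onto compact subintervals exhausting I: the projection
   decreases A. Passing to the limit in E A(c, f_k) <= bound + A(c, E f_k), whose
   left-hand side is nonnegative, by Fatou's lemma avoids any integrability
   assumption on Phi(f). *)

Require Import Defs.
From mathcomp Require Import all_boot all_order all_algebra.
From mathcomp Require Import all_classical all_reals all_analysis.
From mathcomp Require Import measurable_realfun ring lra.

Set Implicit Arguments.
Unset Strict Implicit.
Unset Printing Implicit Defensive.

Import Order.TTheory GRing.Theory Num.Theory.
Import numFieldNormedType.Exports.

Local Open Scope classical_set_scope.
Local Open Scope ring_scope.

(** * Markov operators on bounded functions *)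

(** Differentiating [s |-> P_s(Phi(P_(t-s) f))] is not an option: the generator is given on smooth
    compactly supported functions, and [P_s f] is in general not one. The generator is therefore
    read at the origin, on test functions [F] with [F - F(0) = O(min(1, |y|^2))]; there the drift
    drops out and [n (E F(X_(t/n)) - F(0))] has a limit. Every error of the n-step bound has to be
    expressed through such functions: cutoffs, truncated squares of coordinates, cell weights. The
    entropy left inside the label classes is of order 1/n per step, so the n steps together are made
    small by the fineness of the partition and not by n; this is why the Lipschitz constant of the
    approximation is fixed before the partition. As [f] is only continuous, moduli of continuity
    exist on balls only, and a tail has to be carried along. Finally [T_i f] is compared with
    [T_None] of the translate of [f], not with the translate: Jensen's inequality then pulls
    [T_None] out of the divergence, and that operator is absorbed into one more convolution step. *)

Section bounded_measurable.
Context {R : realType} {disp : measure_display} {T : measurableType disp}.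
Implicit Types (f g : T -> R) (Q : (T -> R) -> T -> R).

Definition bdmeas f : Prop :=
  measurable_fun setT f /\ exists M, forall x, `|f x| <= M.

Lemma bdmeas_cst (c : R) : bdmeas (fun=> c).
Proof. by split; [exact: measurable_cst | exists `|c|]. Qed.

Lemma bdmeasD f g : bdmeas f -> bdmeas g -> bdmeas (fun x => f x + g x).
Proof.
move=> [mf [M fM]] [mg [N gN]]; split; first exact: measurable_funD.
by exists (M + N) => x; rewrite (le_trans (ler_normD _ _))// lerD.
Qed.

Lemma bdmeasM f g : bdmeas f -> bdmeas g -> bdmeas (fun x => f x * g x).
Proof.
move=> [mf [M fM]] [mg [N gN]]; split; first exact: measurable_funM.
by exists (M * N) => x; rewrite normrM ler_pM.
Qed.

Lemma bdmeasZ (c : R) f : bdmeas f -> bdmeas (fun x => c * f x).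
Proof. exact/bdmeasM/bdmeas_cst. Qed.

Lemma bdmeasN f : bdmeas f -> bdmeas (fun x => - f x).
Proof. by move=> /(bdmeasZ (-1)); under eq_fun do rewrite mulN1r. Qed.

Lemma bdmeasB f g : bdmeas f -> bdmeas g -> bdmeas (fun x => f x - g x).
Proof. by move=> bf /bdmeasN; exact: bdmeasD. Qed.

Lemma bdmeas_norm f : bdmeas f -> bdmeas (fun x => `|f x|).
Proof.
move=> [mf [M fM]]; split; first exact: measurableT_comp.
by exists M => x; rewrite normr_id.
Qed.

Lemma bdmeas_sum (I : finType) (P : pred I) (F : I -> T -> R) :
  (forall i, P i -> bdmeas (F i)) -> bdmeas (fun x => \sum_(i | P i) F i x).
Proof.
move=> bF; rewrite (_ : (fun x => _) = \big[(fun f g x => f x + g x)/fun=> 0]_(i | P i) F i).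
  by apply: big_ind => //; [exact: bdmeas_cst | exact: bdmeasD].
by apply/funext => x; apply: (big_ind2 (fun a b => a = b x)) => // a b c d -> ->.
Qed.

Lemma bdmeas_between (l u : R) f :
  measurable_fun setT f -> (forall x, l <= f x <= u) -> bdmeas f.
Proof.
move=> mf flu; split => //; exists (`|l| + `|u|) => x.
have /andP[lf fu] := flu x; rewrite ler_norml.
have := ler_norm (- l); have := ler_norm u; rewrite normrN.
have := normr_ge0 l; have := normr_ge0 u.
by move=> ? ? ? ?; apply/andP; split; lra.
Qed.

(** These finite properties suffice because Jensen's inequality below integrates affine minorants
    only. They are shared by the identity and by weighted convolutions, the two kinds of operators
    attached to labels. *)
Record markov Q : Prop := Markov {
  markov_bdmeas : forall f, bdmeas f -> bdmeas (Q f);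
  markovD : forall f g, bdmeas f -> bdmeas g ->
    forall x, Q (fun z => f z + g z) x = Q f x + Q g x;
  markovZ : forall c f, bdmeas f -> forall x, Q (fun z => c * f z) x = c * Q f x;
  markov_le : forall f g, bdmeas f -> bdmeas g -> (forall z, f z <= g z) ->
    forall x, Q f x <= Q g x;
  markov1 : forall x, Q (fun=> 1) x = 1
}.

Lemma markov_cst Q (c : R) x : markov Q -> Q (fun=> c) x = c.
Proof.
move=> mQ; have := markovZ mQ c (bdmeas_cst 1) x.
by rewrite (markov1 mQ) mulr1.
Qed.

Lemma markovB Q f g x : markov Q -> bdmeas f -> bdmeas g ->
  Q (fun z => f z - g z) x = Q f x - Q g x.
Proof.
move=> mQ bf bg; rewrite (markovD mQ)//; last exact: bdmeasN.
congr (_ + _); rewrite -mulN1r -(markovZ mQ)//.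
by congr (Q _ x); apply/funext => z; rewrite mulN1r.
Qed.

Lemma markov_sum Q (I : finType) (P : pred I) (F : I -> T -> R) x :
  markov Q -> (forall i, P i -> bdmeas (F i)) ->
  Q (fun z => \sum_(i | P i) F i z) x = \sum_(i | P i) Q (F i) x.
Proof.
move=> mQ bF.
have [_ <-] : bdmeas (fun z => \sum_(i | P i) F i z) /\
    Q (fun z => \sum_(i | P i) F i z) x = \sum_(i | P i) Q (F i) x.
  rewrite (_ : (fun z => _) = \big[(fun f g x => f x + g x)/fun=> 0]_(i | P i) F i).
    apply: (big_ind2 (fun f r => bdmeas f /\ Q f x = r)) => //.
    - by split; [exact: bdmeas_cst | exact: markov_cst].
    - move=> f1 r1 f2 r2 [b1 <-] [b2 <-].
      by split; [exact: bdmeasD | exact: markovD].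
    - by move=> i Pi; split => //; exact: bF.
  by apply/funext => z; apply: (big_ind2 (fun a b => a = b z)) => // a b c d -> ->.
by [].
Qed.

Lemma markov_norm Q f x : markov Q -> bdmeas f ->
  `|Q f x| <= Q (fun z => `|f z|) x.
Proof.
move=> mQ bf; have bnf := bdmeas_norm bf.
rewrite ler_norml; apply/andP; split.
  rewrite -mulN1r -(markovZ mQ)//; apply: (markov_le mQ) => //.
    exact: bdmeasZ.
  by move=> z; rewrite mulN1r lerNl ler_normr lexx orbT.
by apply: (markov_le mQ) => // z; exact: ler_norm.
Qed.

Lemma markov_between Q (l u : R) f x : markov Q -> measurable_fun setT f ->
  (forall z, l <= f z <= u) -> l <= Q f x <= u.
Proof.
move=> mQ mf flu; have bf := bdmeas_between mf flu; apply/andP; split.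
- rewrite -(markov_cst l x mQ); apply: (markov_le mQ) => //.
    exact: bdmeas_cst.
  by move=> z; case/andP: (flu z).
- rewrite -(markov_cst u x mQ); apply: (markov_le mQ) => //.
    exact: bdmeas_cst.
  by move=> z; case/andP: (flu z).
Qed.

Lemma markov_iter Q n : markov Q -> markov (iter n Q).
Proof.
move=> mQ; elim: n => [|n IHn]; first by split.
split => /=.
- by move=> f bf; apply/(markov_bdmeas mQ)/(markov_bdmeas IHn).
- move=> f g bf bg x; rewrite -(markovD mQ); try exact: (markov_bdmeas IHn).
  by congr (Q _ x); apply/funext => z; exact: (markovD IHn).
- move=> c f bf x; rewrite -(markovZ mQ); last exact: (markov_bdmeas IHn).
  by congr (Q _ x); apply/funext => z; exact: (markovZ IHn).
- move=> f g bf bg fg x; apply: (markov_le mQ); try exact: (markov_bdmeas IHn).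
  by move=> z; exact: (markov_le IHn).
- by move=> x; rewrite (_ : iter n Q _ = fun=> 1) ?(markov1 mQ)//;
    apply/funext => z; exact: (markov1 IHn).
Qed.

Lemma markov_mix (I : finType) (p : I -> R) (Q : I -> (T -> R) -> T -> R) :
  (forall i, 0 <= p i) -> \sum_i p i = 1 -> (forall i, markov (Q i)) ->
  markov (fun f x => \sum_i p i * Q i f x).
Proof.
move=> p0 p1 mQ; split.
- move=> f bf; apply: bdmeas_sum => i _; apply: bdmeasZ.
  exact: (markov_bdmeas (mQ i)).
- move=> f g bf bg x; rewrite -big_split; apply: eq_bigr => i _ /=.
  by rewrite (markovD (mQ i))// mulrDr.
- move=> c f bf x; rewrite big_distrr; apply: eq_bigr => i _ /=.
  by rewrite (markovZ (mQ i))// mulrCA.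
- move=> f g bf bg fg x; apply: ler_sum => i _.
  by rewrite ler_wpM2l//; exact: (markov_le (mQ i)).
- by move=> x; rewrite -[RHS]p1; apply: eq_bigr => i _; rewrite (markov1 (mQ i)) mulr1.
Qed.

End bounded_measurable.

(** * Entropy of mixtures of commuting Markov operators *)

Definition bregman {R : realType} (phi dphi : R -> R) (a b : R) : R :=
  phi b - phi a - dphi a * (b - a).

(** What the bounded case uses of [Phi] and [Phi'] on a segment [[l, u]]. The functions are total
    and measurable on the line so that they compose with measurable functions, and are otherwise
    constrained on the segment. Joint convexity of the divergence enters as the existence of
    supporting planes, and a single constant [M] serves every estimate. *)
Record entropy_kernel {R : realType} (l u M : R) (phi dphi : R -> R) : Prop :=
  EntropyKernel {
  ek_measurable : measurable_fun setT phi;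
  ek_dmeasurable : measurable_fun setT dphi;
  ek_ge0 : forall a b, l <= a <= u -> l <= b <= u -> 0 <= bregman phi dphi a b;
  ek_lip : forall a b, l <= a <= u -> l <= b <= u ->
    `|phi a - phi b| <= M * `|a - b|;
  ek_dbound : forall a, l <= a <= u -> `|dphi a| <= M;
  ek_quad : forall a b, l <= a <= u -> l <= b <= u ->
    bregman phi dphi a b <= M * (b - a) ^+ 2;
  ek_subgradient : forall a0 b0, l <= a0 <= u -> l <= b0 <= u ->
    exists p q, forall a b, l <= a <= u -> l <= b <= u ->
    bregman phi dphi a0 b0 + p * (a - a0) + q * (b - b0) <= bregman phi dphi a b
}.

Lemma bregmanxx {R : realType} (phi dphi : R -> R) a : bregman phi dphi a a = 0.
Proof. by rewrite /bregman !subrr mulr0 subr0. Qed.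

Section entropy.
Context {R : realType} {disp : measure_display} {T : measurableType disp}.
Context {l u M : R} {phi dphi : R -> R}.
Context (ek : entropy_kernel l u M phi dphi).
Implicit Types (f g : T -> R).
Local Notation A := (bregman phi dphi).

Definition ranged f : Prop :=
  measurable_fun setT f /\ forall x, l <= f x <= u.

Lemma ranged_bdmeas f : ranged f -> bdmeas f.
Proof. by move=> [? ?]; exact: bdmeas_between. Qed.

Lemma markov_ranged (Q : (T -> R) -> T -> R) f :
  markov Q -> ranged f -> ranged (Q f).
Proof.
move=> mQ [mf flu]; split => [|x]; last exact: markov_between.
by have [] := markov_bdmeas mQ (bdmeas_between mf flu).
Qed.

Lemma ek_bdmeas f : ranged f -> bdmeas (fun x => phi (f x)).
Proof.
move=> [mf flu]; split; first by apply: measurableT_comp => //; exact: (ek_measurable ek).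
exists (`|phi l| + `|M| * `|u - l|) => x.
have /andP[lf fu] := flu x; have lu := le_trans lf fu.
have -> : phi (f x) = phi l + (phi (f x) - phi l) by ring.
rewrite (le_trans (ler_normD _ _))// lerD2l.
rewrite (le_trans (ek_lip ek _ _))// ?lexx//.
apply: (@le_trans _ _ (`|M| * `|f x - l|)); first by rewrite ler_wpM2r// ler_norm.
by rewrite ler_wpM2l// !ger0_norm ?subr_ge0// lerD2r.
Qed.

Lemma ek_dbdmeas f : ranged f -> bdmeas (fun x => dphi (f x)).
Proof.
move=> [mf flu]; split; first by apply: measurableT_comp => //; exact: (ek_dmeasurable ek).
by exists M => x; exact: (ek_dbound ek).
Qed.

Lemma bregman_bdmeas f g : ranged f -> ranged g ->
  bdmeas (fun x => A (f x) (g x)).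
Proof.
move=> rf rg; rewrite /bregman; apply: bdmeasB.
  by apply: bdmeasB; exact: ek_bdmeas.
apply: bdmeasM; first exact: ek_dbdmeas.
by apply: bdmeasB; exact: ranged_bdmeas.
Qed.

Lemma bregman_lip2 a b c : l <= a <= u -> l <= b <= u -> l <= c <= u ->
  A a b - A a c <= (M + M) * `|b - c|.
Proof.
move=> ha hb hc; rewrite /bregman.
have := le_trans (ler_norm _) (ek_lip ek hb hc).
have h2 : - (dphi a * (b - c)) <= M * `|b - c|.
  rewrite (le_trans (ler_norm _))// normrN normrM ler_wpM2r//.
  exact: (ek_dbound ek).
by move=> h1; lra.
Qed.

(** [Q] evaluates the supporting plane of the divergence at [(Q f x, Q g x)] exactly at its point of
    contact, and preserves the inequality between the plane and the divergence. *)
Lemma jensen_bregman (Q : (T -> R) -> T -> R) f g x :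
  markov Q -> ranged f -> ranged g ->
  A (Q f x) (Q g x) <= Q (fun z => A (f z) (g z)) x.
Proof.
move=> mQ rf rg.
have [_ fQ] := markov_ranged mQ rf; have [_ gQ] := markov_ranged mQ rg.
have bf := ranged_bdmeas rf; have bg := ranged_bdmeas rg.
have [p [q hpq]] := ek_subgradient ek (fQ x) (gQ x).
pose h z := (A (Q f x) (Q g x) - p * Q f x - q * Q g x) + (p * f z + q * g z).
have <- : Q h x = A (Q f x) (Q g x).
  rewrite /h (markovD mQ) ?(markov_cst _ _ mQ) ?(markovD mQ) ?(markovZ mQ)//;
    do ?[exact: bdmeasZ | exact: bdmeas_cst].
    by ring.
  by apply: bdmeasD; exact: bdmeasZ.
apply: (markov_le mQ).
- apply: bdmeasD; first exact: bdmeas_cst.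
  by apply: bdmeasD; exact: bdmeasZ.
- exact: bregman_bdmeas.
- move=> z; apply: le_trans (hpq _ _ (rf.2 z) (rg.2 z)).
  by rewrite /h le_eqVlt; apply/orP; left; apply/eqP; ring.
Qed.

Context {I : finType} (i0 : I) (p : I -> R) (Q : I -> (T -> R) -> T -> R).
Context (p_ge0 : forall i, 0 <= p i) (p_sum : \sum_i p i = 1).
Context (mQ : forall i, markov (Q i)).
Context (QC : forall i j f, bdmeas f -> Q i (Q j f) = Q j (Q i f)).

Definition mix f x := \sum_i p i * Q i f x.

(** The average of [phi (Q_(i_n) ... Q_(i_1) f x)] over independent labels of law [p], i.e. the mean
    of [phi] of the conditional expectation of [f] given all the labels. By convexity it lies
    between [phi (mix^n f)] and [mix^n (phi f)]; the two gaps are bounded separately. *)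
Fixpoint partial_entropy n f : T -> R :=
  if n is n'.+1 then fun x => \sum_i p i * partial_entropy n' (Q i f) x
  else fun x => phi (f x).

(** The divergence is measured from a reference label [i0], later [None], and not from the mean of
    the mixture: the term of [i0] vanishes, and each other term sees a single jump. *)
Definition jump_energy f x := \sum_i p i * A (Q i0 f x) (Q i f x).

Let mmix : markov mix. Proof. exact: markov_mix. Qed.

Let mixn n : markov (iter n mix). Proof. exact: markov_iter. Qed.

Lemma mix_comm i f : bdmeas f -> mix (Q i f) = Q i (mix f).
Proof.
move=> bf; apply/funext => x.
have bQ j : bdmeas (fun z => p j * Q j f z).
  by apply: bdmeasZ; exact: (markov_bdmeas (mQ j)).
have /= -> := markov_sum (P := xpredT) x (mQ i) (fun j _ => bQ j).
apply: eq_bigr => j _; rewrite (markovZ (mQ i)) ?(QC i)//.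
exact: (markov_bdmeas (mQ j)).
Qed.

Lemma iter_mix_comm n i f : bdmeas f -> iter n mix (Q i f) = Q i (iter n mix f).
Proof.
move=> bf; elim: n => //= n ->; rewrite mix_comm//; exact: (markov_bdmeas (mixn n)).
Qed.

Lemma jump_energy_bdmeas f : ranged f -> bdmeas (jump_energy f).
Proof.
move=> rf; apply: bdmeas_sum => i _; apply: bdmeasZ.
by apply: bregman_bdmeas; exact: markov_ranged.
Qed.

Lemma jump_energy_jensen (S : (T -> R) -> T -> R) f x : markov S ->
  (forall i f, bdmeas f -> S (Q i f) = Q i (S f)) -> ranged f ->
  jump_energy (S f) x <= S (jump_energy f) x.
Proof.
move=> mS SQ rf; have bf := ranged_bdmeas rf.
have bA i : bdmeas (fun z => A (Q i0 f z) (Q i f z)).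
  by apply: bregman_bdmeas; exact: markov_ranged.
have /= -> := markov_sum (P := xpredT) x mS (fun i _ => bdmeasZ (p i) (bA i)).
apply: ler_sum => i _; rewrite (markovZ mS)// ler_wpM2l// -!SQ//.
by apply: jensen_bregman => //; exact: markov_ranged.
Qed.

(** Replacing the mean [mix f x] by another reference point [a] can only enlarge the averaged
    divergence, by the amount [A a (mix f x) >= 0]. *)
Lemma entropy_one_step f x : ranged f ->
  \sum_i p i * phi (Q i f x) <= phi (mix f x) + jump_energy f x.
Proof.
move=> rf; have [_ rm] := markov_ranged mmix rf.
have [_ r0] := markov_ranged (mQ i0) rf.
rewrite /jump_energy /bregman.
set a := Q i0 f x.
have -> : \sum_i p i * (phi (Q i f x) - phi a - dphi a * (Q i f x - a)) =
    \sum_i p i * phi (Q i f x) - phi a - dphi a * (mix f x - a).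
  rewrite /mix -[X in _ - X - _]mul1r -[X in _ * (_ - X)]mul1r -p_sum.
  rewrite !big_distrl/= -!sumrB big_distrr/= -sumrB.
  by apply: eq_bigr => i _; ring.
have := ek_ge0 ek (r0 x) (rm x); rewrite /bregman -/a => h; lra.
Qed.

(* Chain rule: the labels of the n steps are revealed one at a time. *)
Lemma partial_entropy_le n f x : ranged f ->
  partial_entropy n.+1 f x <=
  phi (iter n.+1 mix f x) + n.+1%:R * iter n mix (jump_energy f) x.
Proof.
elim: n f x => [|n IHn] f x rf.
  by rewrite /= mul1r; exact: entropy_one_step.
have bf := ranged_bdmeas rf.
have rn m : ranged (iter m mix f) by exact: markov_ranged.
change (\sum_i p i * partial_entropy n.+1 (Q i f) x <=
  phi (mix (iter n.+1 mix f) x) + n.+2%:R * iter n.+1 mix (jump_energy f) x).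
apply: (@le_trans _ _ (\sum_i p i * (phi (Q i (iter n.+1 mix f) x) +
    n.+1%:R * Q i (iter n mix (jump_energy f)) x))).
  apply: ler_sum => i _; rewrite ler_wpM2l//.
  apply: (le_trans (IHn _ _ (markov_ranged (mQ i) rf))).
  rewrite iter_mix_comm// lerD2l ler_wpM2l//.
  rewrite -iter_mix_comm; last exact: jump_energy_bdmeas.
  apply: (markov_le (mixn n)).
  - exact/jump_energy_bdmeas/markov_ranged.
  - exact/(markov_bdmeas (mQ i))/jump_energy_bdmeas.
  - by move=> z; apply: jump_energy_jensen => // j g bg; exact: QC.
under eq_bigr do rewrite mulrDr mulrCA.
rewrite big_split/= -big_distrr/= -[X in n.+1%:R * X]/(mix _ x).
(* The induction hypothesis supplied [n.+1] copies of the energy; the last copy comes from revealing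
   the remaining label, followed by Jensen for [iter n.+1 mix], which commutes with every [Q i]. *)
have h := entropy_one_step x (rn n.+1).
have h' : jump_energy (iter n.+1 mix f) x <= iter n.+1 mix (jump_energy f) x.
  by apply: jump_energy_jensen => //; exact: iter_mix_comm.
have -> : (n.+2%:R : R) = n.+1%:R + 1 by rewrite -[in LHS]addn1 natrD.
rewrite /= in h h' *; lra.
Qed.

(** This controls the entropy inside the label classes: exchanging [phi] with the label operators of
    one step costs at most [c], uniformly on a class [L] stable under all [Q i], so the costs of the
    [n] steps add up. *)
Lemma partial_entropy_ge (L : (T -> R) -> Prop) (c : R) n f x :
  (forall g, L g -> ranged g) -> (forall g i, L g -> L (Q i g)) ->
  (forall g z, L g ->
    mix (fun y => phi (g y)) z - \sum_i p i * phi (Q i g z) <= c) ->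
  L f ->
  iter n mix (fun y => phi (f y)) x <= partial_entropy n f x + n%:R * c.
Proof.
move=> Lr LQ Lc; elim: n f x => [|n IHn] f x Lf.
  by rewrite /= mul0r addr0.
have bphi g : L g -> bdmeas (fun y => phi (g y)).
  by move=> Lg; exact/ek_bdmeas/Lr.
rewrite iterSr.
apply: (@le_trans _ _ (iter n mix (fun z => c + \sum_i p i * phi (Q i f z)) x)).
  apply: (markov_le (mixn n)).
  - exact/(markov_bdmeas mmix)/bphi.
  - apply: bdmeasD; first exact: bdmeas_cst.
    by apply: bdmeas_sum => i _; apply: bdmeasZ; exact/bphi/LQ.
  - by move=> z; rewrite -lerBlDr; exact: Lc.
rewrite (markovD (mixn n)); last 2 first.
- exact: bdmeas_cst.
- by apply: bdmeas_sum => i _; apply: bdmeasZ; exact/bphi/LQ.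
rewrite (markov_cst _ _ (mixn n)).
have /= -> := markov_sum (P := xpredT) x (mixn n)
  (fun i _ => bdmeasZ (p i) (bphi _ (LQ _ i Lf))).
apply: (@le_trans _ _ (c + \sum_i p i * (partial_entropy n (Q i f) x + n%:R * c))).
  rewrite lerD2l; apply: ler_sum => i _; rewrite (markovZ (mixn n)); last exact/bphi/LQ.
  by rewrite ler_wpM2l//; exact/IHn/LQ.
rewrite [X in c + X](_ : _ =
  \sum_i p i * partial_entropy n (Q i f) x + n%:R * c).
  by rewrite -natr1 /=; lra.
rewrite -[X in _ + X]mul1r -p_sum big_distrl -big_split/=.
by apply: eq_bigr => i _; rewrite mulrDr.
Qed.

(** The class [L] above need not contain [f]; this passes from an approximation to [f] at the price
    of an averaged distance, with a constant independent of [n]. *)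
Lemma partial_entropy_lip n f g x : 0 <= M -> ranged f -> ranged g ->
  `|partial_entropy n f x - partial_entropy n g x| <=
  M * iter n mix (fun z => `|f z - g z|) x.
Proof.
move=> M0; elim: n f g x => [|n IHn] f g x rf rg /=.
  by apply: (ek_lip ek); [exact: rf.2 | exact: rg.2].
have bd f' g' : ranged f' -> ranged g' -> bdmeas (fun z => `|f' z - g' z|).
  by move=> ? ?; apply/bdmeas_norm/bdmeasB; exact: ranged_bdmeas.
rewrite -sumrB (le_trans (ler_norm_sum _ _ _))//.
rewrite /mix big_distrr/=; apply: ler_sum => i _.
rewrite -mulrBr normrM ger0_norm// mulrCA ler_wpM2l//.
apply: le_trans (IHn _ _ _ (markov_ranged (mQ i) rf) (markov_ranged (mQ i) rg)) _.
rewrite ler_wpM2l// -iter_mix_comm; last exact: bd.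
apply: (markov_le (mixn n)).
- by apply: bd; exact: markov_ranged.
- by apply: (markov_bdmeas (mQ i)); exact: bd.
- move=> z; rewrite -markovB//; try exact: ranged_bdmeas.
  by apply: markov_norm => //; apply: bdmeasB; exact: ranged_bdmeas.
Qed.

(** [g] stands in for [f] in the comparison inside the label classes, which takes one Lipschitz
    transfer in each direction, hence [M + M]; the energy on the right is that of [f] itself. *)
Lemma discrete_entropy_bound (L : (T -> R) -> Prop) (c : R) n f g x : 0 <= M ->
  (forall g, L g -> ranged g) -> (forall g i, L g -> L (Q i g)) ->
  (forall g z, L g ->
    mix (fun y => phi (g y)) z - \sum_i p i * phi (Q i g z) <= c) ->
  ranged f -> L g ->
  iter n.+1 mix (fun y => phi (f y)) x - phi (iter n.+1 mix f x) <=
  (M + M) * iter n.+1 mix (fun z => `|f z - g z|) x + n.+1%:R * c +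
  n.+1%:R * iter n mix (jump_energy f) x.
Proof.
move=> M0 Lr LQ Lc rf Lg; have rg := Lr _ Lg.
have h1 := partial_entropy_le n x rf.
have h2 := partial_entropy_ge n.+1 x Lr LQ Lc Lg.
have h3 := le_trans (ler_norm _) (partial_entropy_lip n.+1 x M0 rg rf).
have h4 : iter n.+1 mix (fun y => phi (f y)) x - iter n.+1 mix (fun y => phi (g y)) x
    <= M * iter n.+1 mix (fun z => `|f z - g z|) x.
  rewrite -(markovB x (mixn n.+1)); try exact: ek_bdmeas.
  rewrite -(markovZ (mixn n.+1)); last first.
    by apply/bdmeas_norm/bdmeasB; exact: ranged_bdmeas.
  apply: (markov_le (mixn n.+1)).
  - by apply: bdmeasB; exact: ek_bdmeas.
  - by apply/bdmeasZ/bdmeas_norm/bdmeasB; exact: ranged_bdmeas.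
  - move=> z; apply: (le_trans (ler_norm _)).
    by apply: (ek_lip ek); [exact: rf.2 | exact: rg.2].
have h5 : (fun z => `|g z - f z|) = (fun z => `|f z - g z|).
  by apply/funext => z; rewrite distrC.
by rewrite h5 in h3; lra.
Qed.

End entropy.

(** * Measurability and convolution operators on row vectors *)

Section borel_row_vectors.
Context {R : realType} {d : nat}.
Local Notation V := 'rV[R]_d.

Lemma open_measurable_rV (U : set V) : open U -> measurable U.
Proof. by move=> oU; exact: sub_sigma_algebra. Qed.

(** An open set is the countable union of the balls with rational center and radius [1/(k+1)] that
    it contains, and a ball of the sup norm is a finite intersection of conditions on the
    coordinates. *)
Lemma measurable_rV disp (T : measurableType disp) (F : T -> V) :
  (forall k, measurable_fun setT (fun t => F t 0 k)) -> measurable_fun setT F.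
Proof.
move=> mF; apply: (measurability (@open V)) => // _ [U oU <-].
rewrite setTI.
pose B (q : 'rV[rat]_d * nat) : set V :=
  if `[< ball (map_mx ratr q.1 : V) (q.2.+1%:R^-1 : R) `<=` U >]
  then ball (map_mx ratr q.1 : V) (q.2.+1%:R^-1 : R) else set0.
have -> : U = \bigcup_q B q.
  apply/seteqP; split => [x Ux|x [q _]]; last first.
    by rewrite /B; case: asboolP => // + Bx; apply.
  have /nbhs_ballP[e /= e0 eU] : nbhs x U by exact: open_nbhs_nbhs.
  have [k ke] : exists k, (k.+1%:R^-1 : R) < e / 2.
    by have /ltr_add_invr[k] : 0 < e / 2 by [exact: divr_gt0];
      rewrite add0r; exists k.
  have /choice[q xq] (j : 'I_d) : exists r : rat, ball (x 0 j) (k.+1%:R^-1) (ratr r : R).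
    have : x 0 j - k.+1%:R^-1 < x 0 j + k.+1%:R^-1.
      by rewrite ltrD2l gt0_cp// invr_gt0.
    move=> /rat_in_itvoo[r]; rewrite in_itv/= => /andP[r1 r2]; exists r.
    by rewrite /ball/= ltr_distlC r1 r2.
  have xb : ball (map_mx ratr (\row_j q j) : V) (k.+1%:R^-1) x.
    split; first by rewrite invr_gt0.
    by move=> i j; rewrite ord1 !mxE; apply: ball_sym.
  exists (\row_j q j, k) => //; rewrite /B/=; case: asboolP => //; case.
  move=> y hy; apply: eU; apply: (@le_ball _ _ _ (k.+1%:R^-1 + k.+1%:R^-1)).
    by rewrite [leRHS]splitr lerD// ltW.
  by apply: ball_triangle hy; exact: ball_sym.
rewrite preimage_bigcup; apply: countable_bigcupT_measurable => // q.
rewrite /B; case: asboolP => _; last by rewrite preimage_set0.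
rewrite [X in measurable X](_ : _ = \bigcap_(j in [set: 'I_d])
    ((fun t => F t 0 j) @^-1` ball (ratr (q.1 0 j) : R) (q.2.+1%:R^-1 : R))).
  apply: fin_bigcap_measurable => // j _; rewrite -[X in measurable X]setTI.
  by apply: mF => //; exact: measurable_ball.
apply/seteqP; split => [t /= [_ h] j _ /=|t h /=].
  by have := h 0 j; rewrite mxE.
split; first by rewrite invr_gt0.
by move=> i j; rewrite ord1 mxE; exact: h.
Qed.

Lemma continuous_measurable_rV (f : V -> R) :
  continuous f -> measurable_fun setT f.
Proof.
move=> /continuousP cf; apply: (measurability _ (RGenOpens.measurableE R)).
move=> _ [_ [a [b ->] <-]]; rewrite setTI; apply: open_measurable_rV.
exact/cf/interval_open.
Qed.

Lemma coord_measurable k : measurable_fun setT (fun x : V => x 0 k).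
Proof. by apply: continuous_measurable_rV; exact: coord_continuous. Qed.

Lemma measurable_rVD disp (T : measurableType disp) (F G : T -> V) :
  measurable_fun setT F -> measurable_fun setT G ->
  measurable_fun setT (fun t => F t + G t).
Proof.
move=> mF mG; apply: measurable_rV => k; under eq_fun do rewrite mxE.
by apply: measurable_funD; apply: measurableT_comp (coord_measurable k) _.
Qed.

Lemma measurable_rVB disp (T : measurableType disp) (F G : T -> V) :
  measurable_fun setT F -> measurable_fun setT G ->
  measurable_fun setT (fun t => F t - G t).
Proof.
move=> mF mG; apply: measurable_rV => k; under eq_fun do rewrite !mxE.
by apply: measurable_funB; apply: measurableT_comp (coord_measurable k) _.
Qed.

End borel_row_vectors.

(** * Integrals of bounded functions against probability measures *)

Section bounded_integrals.
Context {R : realType} {d1 d2 : measure_display}.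
Context {T1 : measurableType d1} {T2 : measurableType d2}.
Context (m1 : probability T1 R) (m2 : probability T2 R).

Lemma bdmeas_comp {d3} {T3 : measurableType d3} (f : T1 -> R) (h : T3 -> T1) :
  measurable_fun setT h -> bdmeas f -> bdmeas (fun t => f (h t)).
Proof.
move=> mh [mf [M fM]]; split; first exact: measurableT_comp.
by exists M => x.
Qed.

Lemma bdmeas_integrable (f : T1 -> R) :
  bdmeas f -> m1.-integrable setT (EFin \o f).
Proof.
move=> [mf [M fM]]; apply: measurable_bounded_integrable => //.
  by rewrite ltey_eq fin_num_measure.
exists M; split; first exact: num_real.
by move=> N MN x _; exact: le_trans (fM x) (ltW MN).
Qed.

Lemma bdmeas_Rintegral_EFin (f : T1 -> R) : bdmeas f ->
  (\int[m1]_x f x)%:E = (\int[m1]_x (f x)%:E)%E.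
Proof. by move=> bf; rewrite fineK// integral_fune_fin_num//; exact: bdmeas_integrable. Qed.

End bounded_integrals.

Section bounded_fubini.
Context {R : realType} {d1 d2 : measure_display}.
Context {T1 : measurableType d1} {T2 : measurableType d2}.
Context (m1 : probability T1 R) (m2 : probability T2 R).

Lemma prob_Rintegral_le (f g : T1 -> R) : bdmeas f -> bdmeas g ->
  (forall x, f x <= g x) -> \int[m1]_x f x <= \int[m1]_x g x.
Proof. by move=> bf bg fg; apply: le_Rintegral => //; exact: bdmeas_integrable. Qed.

Lemma prob_Rintegral_cst (c : R) : \int[m1]_x c = c.
Proof. by rewrite Rintegral_cst//= probability_setT mulr1. Qed.

Context (F : T1 * T2 -> R) (bF : bdmeas F).

Let bdF x : bdmeas (fun y => F (x, y)).
Proof. by apply: (bdmeas_comp _ bF); exact: pair1_measurable. Qed.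

Let integrableF : (m1 \x m2)%E.-integrable setT (EFin \o F).
Proof.
have [mF [M FM]] := bF; have mEF : measurable_fun setT (EFin \o F).
  exact/measurable_EFinP.
apply/integrable12ltyP => //.
apply: (@le_lt_trans _ _ (\int[m1]_x \int[m2]_y (M%:E))%E); last first.
  under eq_integral do rewrite integral_cst//= probability_setT mule1.
  by rewrite integral_cst//= probability_setT mule1 ltry.
apply: ge0_le_integral => //=.
- by move=> x _; exact: integral_ge0.
- apply: (measurable_fun_fubini_tonelli_F (abse \o (EFin \o F))) => //=.
  exact: measurableT_comp.
- move=> x _; apply: ge0_le_integral => //=.
  + by apply/measurable_EFinP; exact: (bdmeas_norm (bdF x)).1.
  + by move=> y _; rewrite lee_fin.
Qed.

Lemma bdmeas_Rintegral_param : bdmeas (fun x => \int[m2]_y F (x, y)).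
Proof.
have [mF [M FM]] := bF; split.
  apply/measurable_EFinP.
  rewrite (_ : _ \o _ = fubini_F m2 (EFin \o F)).
    exact: measurable_fubini_F integrableF.
  by apply/funext => x /=; rewrite bdmeas_Rintegral_EFin.
exists M => x; apply: (le_trans (le_normr_Rintegral _ _)) => //.
  exact: bdmeas_integrable.
apply: (@le_trans _ _ (\int[m2]_y M)).
  apply: le_Rintegral => //; apply: bdmeas_integrable; last exact: bdmeas_cst.
  exact: bdmeas_norm.
by rewrite Rintegral_cst//= probability_setT mulr1.
Qed.

Lemma bdmeas_Fubini_prod :
  \int[m1]_x \int[m2]_y F (x, y) = fine (\int[(m1 \x m2)%E]_z (F z)%:E)%E.
Proof.
rewrite -(integral12_prod_meas1 integrableF) /Rintegral; congr fine.
apply: eq_integral => x _; rewrite /= fineK// integral_fune_fin_num//.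
exact/bdmeas_integrable/bdF.
Qed.

Lemma bdmeas_Fubini :
  \int[m1]_x \int[m2]_y F (x, y) = \int[m2]_y \int[m1]_x F (x, y).
Proof.
rewrite bdmeas_Fubini_prod -(integral21_prod_meas1 integrableF) /Rintegral.
congr fine; apply: eq_integral => y _; rewrite /= fineK// integral_fune_fin_num//.
by apply: bdmeas_integrable; apply: (bdmeas_comp _ bF); exact: pair2_measurable.
Qed.

End bounded_fubini.

(** * Weighted convolution operators *)

Section weighted_convolution.
Context {R : realType} {d : nat}.
Local Notation V := 'rV[R]_d.
Context (mu : probability 'rV[R]_d R).
Implicit Types (w f g : V -> R).

(** With [w] constant equal to 1 this is the transition operator of a step of law [mu]; with other
    weights of mass 1 it will be the step conditioned on its label. *)
Definition wconv w f z : R := \int[mu]_y (w y * f (z + y)).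

Lemma bdmeas_shift f z : bdmeas f -> bdmeas (fun y : V => f (z + y)).
Proof.
by move=> bf; apply: bdmeas_comp bf => //; apply: measurable_rVD.
Qed.

Lemma bdmeas_shiftr f z : bdmeas f -> bdmeas (fun y : V => f (y + z)).
Proof. by move=> /(bdmeas_shift z); under eq_fun do rewrite addrC. Qed.

Let bdint w f z : bdmeas w -> bdmeas f -> bdmeas (fun y : V => w y * f (z + y)).
Proof. by move=> bw bf; apply: bdmeasM => //; exact: bdmeas_shift. Qed.

Lemma wconv_bdmeas w f : bdmeas w -> bdmeas f -> bdmeas (wconv w f).
Proof.
move=> bw bf; apply: (bdmeas_Rintegral_param mu mu (F := fun p : V * V => w p.2 * f (p.1 + p.2))).
apply: bdmeasM; first by apply: bdmeas_comp bw; exact: measurable_snd.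
by apply: bdmeas_comp bf; apply: measurable_rVD.
Qed.

Lemma wconvD w f g z : bdmeas w -> bdmeas f -> bdmeas g ->
  wconv w (fun x => f x + g x) z = wconv w f z + wconv w g z.
Proof.
move=> bw bf bg; rewrite /wconv -RintegralD//; try exact/bdmeas_integrable/bdint.
by apply: eq_Rintegral => y _; rewrite mulrDr.
Qed.

Lemma wconvZ w c f z : bdmeas w -> bdmeas f ->
  wconv w (fun x => c * f x) z = c * wconv w f z.
Proof.
move=> bw bf; rewrite /wconv -RintegralZl//; try exact/bdmeas_integrable/bdint.
by apply: eq_Rintegral => y _; rewrite mulrCA.
Qed.

Lemma wconvZl w c f z : bdmeas w -> bdmeas f ->
  wconv (fun x => c * w x) f z = c * wconv w f z.
Proof.
move=> bw bf; rewrite /wconv -RintegralZl//; try exact/bdmeas_integrable/bdint.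
by apply: eq_Rintegral => y _; rewrite mulrA.
Qed.

Lemma wconv_suml (I : finType) (w : I -> V -> R) f z :
  (forall i, bdmeas (w i)) -> bdmeas f ->
  wconv (fun x => \sum_i w i x) f z = \sum_i wconv (w i) f z.
Proof.
move=> bw bf.
have [_ <-] : bdmeas (fun x => \sum_i w i x) /\
    wconv (fun x => \sum_i w i x) f z = \sum_i wconv (w i) f z.
  rewrite (_ : (fun z => _) = \big[(fun f g x => f x + g x)/fun=> 0]_i w i).
    apply: (big_ind2 (fun v r => bdmeas v /\ wconv v f z = r)) => //.
    - split; first exact: bdmeas_cst.
      by rewrite /wconv; under eq_Rintegral do rewrite mul0r; rewrite prob_Rintegral_cst.
    - move=> v1 r1 v2 r2 [b1 <-] [b2 <-]; split; first exact: bdmeasD.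
      rewrite /wconv -RintegralD//; try exact/bdmeas_integrable/bdint.
      by apply: eq_Rintegral => y _; rewrite mulrDl.
  by apply/funext => x; apply: (big_ind2 (fun a b => a = b x)) => // a b c e -> ->.
by [].
Qed.

Lemma wconv_le w f g z : bdmeas w -> bdmeas f -> bdmeas g ->
  (forall y, 0 <= w y) -> (forall x, f x <= g x) -> wconv w f z <= wconv w g z.
Proof.
move=> bw bf bg w0 fg; apply: prob_Rintegral_le; try exact: bdint.
by move=> y; rewrite ler_wpM2l.
Qed.

End weighted_convolution.

(** Translations commute, and the rest is Fubini. This is the source of the commutation of the label
    operators. *)
Lemma wconvC {R : realType} {d : nat} (mu nu : probability 'rV[R]_d R)
    (w v f : 'rV[R]_d -> R) : bdmeas w -> bdmeas v -> bdmeas f ->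
  wconv mu w (wconv nu v f) = wconv nu v (wconv mu w f).
Proof.
move=> bw bv bf; apply/funext => z; rewrite /wconv.
pose F (p : 'rV[R]_d * 'rV[R]_d) := w p.1 * v p.2 * f (z + p.1 + p.2).
have bF : bdmeas F.
  apply: bdmeasM; first apply: bdmeasM.
  - by apply: bdmeas_comp bw; exact: measurable_fst.
  - by apply: bdmeas_comp bv; exact: measurable_snd.
  - apply: bdmeas_comp bf; apply: measurable_rVD => //; first exact: measurable_rVD.
have sh (g h : 'rV[R]_d -> R) y : bdmeas g -> bdmeas h ->
    bdmeas (fun s => g s * h (y + s)).
  by move=> bg bh; apply: bdmeasM => //; exact: bdmeas_shift.
transitivity (\int[mu]_x \int[nu]_y F (x, y)).
  apply: eq_Rintegral => x _; rewrite -RintegralZl//.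
    by apply: eq_Rintegral => y _; rewrite /F/= mulrA.
  exact/bdmeas_integrable/sh.
rewrite bdmeas_Fubini//; apply: eq_Rintegral => y _; rewrite -RintegralZl//.
  by apply: eq_Rintegral => x _; rewrite /F/= mulrA [v y * _]mulrC addrAC.
exact/bdmeas_integrable/sh.
Qed.

Lemma markov_wconv {R : realType} {d : nat} (mu : probability 'rV[R]_d R)
    (w : 'rV[R]_d -> R) : bdmeas w -> (forall y, 0 <= w y) ->
  \int[mu]_y w y = 1 -> markov (wconv mu w).
Proof.
move=> bw w0 w1; split.
- by move=> f; exact: wconv_bdmeas.
- by move=> f g bf bg x; exact: wconvD.
- by move=> c f bf x; exact: wconvZ.
- by move=> f g bf bg fg x; exact: wconv_le.
- by move=> x; rewrite /wconv; under eq_Rintegral do rewrite mulr1.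
Qed.

Section laws.
Context {R : realType} {dO : measure_display} {Omega : measurableType dO}.
Context {P : probability Omega R}.

Lemma Rintegral_distribution {d'} {T' : measurableType d'}
    (Y : {mfun Omega >-> T'}) (f : T' -> R) : bdmeas f ->
  \int[distribution P Y]_y f y = \int[P]_w f (Y w).
Proof.
move=> bf; rewrite /Rintegral integral_distribution//.
  by apply/measurable_EFinP; case: bf.
by apply: bdmeas_integrable; exact: bdmeas_comp bf.
Qed.

Lemma ae_eq_Rintegral (f g : Omega -> R) : bdmeas f -> bdmeas g ->
  {ae P, forall w, f w = g w} -> \int[P]_w f w = \int[P]_w g w.
Proof.
move=> [mf _] [mg _] fg; rewrite /Rintegral; congr fine.
apply: ae_eq_integral => //; try exact/measurable_EFinP.
by apply: filterS fg => w + _ => ->.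
Qed.

End laws.

(** * Laws of a Levy process and their convolution semigroup *)

Definition levy_law {R : realType} {d : nat} {dO : measure_display}
    {Omega : measurableType dO} {P : probability Omega R}
    (X : R -> {RV P >-> 'rV[R]_d}) (h : R) : probability 'rV[R]_d R :=
  distribution P (X h).

Section levy_semigroup.
Context {R : realType} {d : nat} {dO : measure_display}.
Context {Omega : measurableType dO} {P : probability Omega R}.
Local Notation V := 'rV[R]_d.
Context (X : R -> {RV P >-> 'rV[R]_d}) (levyX : levy_process X).

Local Notation law := (levy_law X).

Let measurable_increment s t : measurable_fun setT (increment X s t).
Proof. exact: measurable_rVB. Qed.

Let incr s t : {mfun Omega >-> V} := mfun_Sub (mem_set (measurable_increment s t)).

Let incr_start h f : bdmeas f ->
  \int[P]_w f (incr 0 h w) = \int[P]_w f (X h w).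
Proof.
move=> bf; apply: ae_eq_Rintegral.
- exact: bdmeas_comp bf.
- exact: bdmeas_comp bf.
- apply: filterS (levy_start levyX) => w X0.
  by rewrite /incr/= /increment X0 subr0.
Qed.

(** The increments over [[0, s]] and [[s, s + h]] are independent, so the law of the pair is a
    product measure, and stationarity turns its second factor into the law of [X h]. *)
Lemma levy_convolution s h f : 0 <= s -> 0 <= h -> bdmeas f ->
  \int[law (s + h)]_y f y = \int[law s]_x \int[law h]_y f (x + y).
Proof.
move=> s0 h0 bf.
have bF : bdmeas (fun p : V * V => f (p.1 + p.2)).
  by apply: bdmeas_comp bf; apply: measurable_rVD.
have mZ : measurable_fun setT (fun w => (incr 0 s w, incr s (s + h) w)).
  exact: measurable_fun_pair.
pose Z : {mfun Omega >-> (V * V)%type} := mfun_Sub (mem_set mZ).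
pose U := distribution P (incr 0 s) : probability V R.
pose W := distribution P (incr s (s + h)) : probability V R.
have indep A B : measurable A -> measurable B ->
    distribution P Z (A `*` B) = (U A * W B)%E.
  move=> mA mB.
  (* The times 0, [s], [s + h], continued as a constant because independence is stated for a
     sequence of times. *)
  pose t (n : nat) : R := if n is n'.+1 then if n' is _.+1 then s + h else s else 0.
  pose C (i : 'I_2) := if i == 0 then A else B.
  have tS i : (i < 2)%N -> t i <= t i.+1.
    by case: i => [|[|//]] _ //=; rewrite lerDl.
  have := levy_independent_increments levyX (t := t) (lexx _) tS => /(_ C).
  have -> : \bigcap_(i in [set: 'I_2])
      increment X (t i) (t i.+1) @^-1` C i = Z @^-1` (A `*` B).
    apply/seteqP; split => [w /= h1|w /= [hA hB] i _].
      by split; [exact: (h1 0) | exact: (h1 1)].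
    by case: i => [[|[|//]] ?]; rewrite /C/=.
  rewrite !big_ord_recl big_ord0 mule1; apply.
  by move=> i; rewrite /C; case: ifP.
have mu_eq S : measurable S -> (U \x W)%E S = distribution P Z S.
  by apply: product_measure_unique => A B mA mB; exact: indep.
have lawW g : bdmeas g -> \int[W]_y g y = \int[law h]_y g y.
  move=> bg; rewrite [RHS]Rintegral_distribution// -incr_start//.
  rewrite -(Rintegral_distribution (incr 0 h))//.
  rewrite /Rintegral; congr fine; apply: eq_measure_integral => A mA _.
  exact: (levy_stationary_increments levyX).
transitivity (\int[P]_w f ((Z w).1 + (Z w).2)).
  rewrite Rintegral_distribution//; apply: ae_eq_Rintegral.
  - exact: bdmeas_comp bf.
  - by apply: (bdmeas_comp _ bF).
  - apply: filterS (levy_start levyX) => w X0.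
    by rewrite /Z /incr/= /increment X0 subr0 subrKC.
rewrite -(Rintegral_distribution Z bF).
transitivity (\int[U]_x \int[W]_y f (x + y)).
  rewrite (bdmeas_Fubini_prod U W bF) /Rintegral; congr fine.
  by apply: eq_measure_integral => S mS _; apply: esym; exact: mu_eq.
have shift (x : V) : bdmeas (fun y : V => f (x + y)) by exact: bdmeas_shift.
transitivity (\int[U]_x \int[law h]_y f (x + y)).
  by apply: eq_Rintegral => x _; rewrite lawW.
have bG : bdmeas (fun x : V => \int[law h]_y f (x + y)).
  exact: (bdmeas_Rintegral_param (law h) (law h) bF).
rewrite (Rintegral_distribution (incr 0 s) bG) (incr_start s bG).
by rewrite -(Rintegral_distribution (X s) bG).
Qed.

Let one : V -> R := fun=> 1.

Lemma levy_iter_wconv h n f x : 0 <= h -> bdmeas f ->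
  iter n.+1 (wconv (law h) one) f x = wconv (law (n.+1%:R * h)) one f x.
Proof.
move=> h0 bf; elim: n x => [|n IHn] x; first by rewrite mul1r.
have bone : bdmeas one by exact: bdmeas_cst.
rewrite iterS.
have -> : iter n.+1 (wconv (law h) one) f = wconv (law (n.+1%:R * h)) one f.
  exact/funext.
rewrite /wconv.
have sh (z : V) : bdmeas (fun y : V => f (z + y)) by exact: bdmeas_shift.
have -> : n.+2%:R * h = h + n.+1%:R * h :> R by rewrite mulrS mulrDl mul1r.
under [RHS]eq_Rintegral do rewrite mul1r.
rewrite levy_convolution// ?mulr_ge0//.
apply: eq_Rintegral => y _; rewrite mul1r; apply: eq_Rintegral => z _.
by rewrite mul1r addrA.
Qed.

End levy_semigroup.

(** * Smooth bumps *)

Section smooth_functions_of_one_variable.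
Context {R : realType}.
Implicit Types (f g : R -> R) (x : R) (n m : nat).

(** The class C^n, with the derivative existentially quantified: closure under an operation is an
    induction whose witness is the formula for the derivative. *)
Fixpoint smoothn n f : Prop :=
  if n is n'.+1 then
    exists f', (forall x, is_derive x 1 f (f' x)) /\ smoothn n' f'
  else continuous f.

Definition smooth1 f := forall n, smoothn n f.

Lemma smoothn_continuous n f : smoothn n f -> continuous f.
Proof.
case: n => // n [f' [df _]] x.
by apply/differentiable_continuous/derivable1_diffP; case: (df x).
Qed.

Lemma smoothnS n f : smoothn n.+1 f -> smoothn n f.
Proof.
elim: n f => [|n IHn] f; first exact: (@smoothn_continuous 1).
by move=> [f' [df sf']]; exists f'; split => //; exact: IHn.
Qed.

(** The witnesses obtained for different [n] agree because a derivative is unique, hence a single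
    [f'] that is smooth at all orders. *)
Lemma smooth1_derive f : smooth1 f ->
  exists f', (forall x, is_derive x 1 f (f' x)) /\ smooth1 f'.
Proof.
move=> sf; exists (fun x => 'D_1 f x); split.
  by move=> x; have [f' [df _]] := sf 1%N; apply: DeriveDef => //; case: (df x).
move=> n; have [f' [df sf']] := sf n.+1.
rewrite (_ : (fun x => _) = f')//.
by apply/funext => x; case: (df x).
Qed.

Lemma smoothn_cst n (c : R) : smoothn n (fun=> c).
Proof.
elim: n c => [|n IHn] c; first exact: cst_continuous.
by exists (fun=> 0); split => // x; exact: is_derive_cst.
Qed.

Lemma smoothnD n f g : smoothn n f -> smoothn n g ->
  smoothn n (fun x => f x + g x).
Proof.
elim: n f g => [|n IHn] f g; first by move=> cf cg x; exact: cvgD (cf x) (cg x).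
move=> [f' [df sf']] [g' [dg sg']]; exists (fun x => f' x + g' x).
by split; [move=> x; exact: is_deriveD | exact: IHn].
Qed.

Lemma smoothnM n f g : smoothn n f -> smoothn n g ->
  smoothn n (fun x => f x * g x).
Proof.
elim: n f g => [|n IHn] f g; first by move=> cf cg x; exact: cvgM (cf x) (cg x).
move=> sf sg; have [f' [df sf']] := sf; have [g' [dg sg']] := sg.
exists (fun x => f x * g' x + g x * f' x); split.
  by move=> x; exact: is_deriveM.
by apply: smoothnD; apply: IHn => //; exact: smoothnS.
Qed.

Lemma smoothnZ n (c : R) f : smoothn n f -> smoothn n (fun x => c * f x).
Proof. by move=> ?; apply: smoothnM => //; exact: smoothn_cst. Qed.

Lemma smoothnB n f g : smoothn n f -> smoothn n g ->
  smoothn n (fun x => f x - g x).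
Proof.
move=> sf /(smoothnZ (-1)) sg; have := smoothnD sf sg.
by under eq_fun do rewrite mulN1r.
Qed.

Lemma smoothnV n f : (forall x, f x != 0) -> smoothn n f ->
  smoothn n (fun x => (f x)^-1).
Proof.
move=> f0; elim: n => [|n IHn]; first by move=> cf x; exact: cvgV (cf x).
move=> sf; have [f' [df sf']] := sf.
exists (fun x => (-1) * ((f x)^-1 * (f x)^-1) * f' x); split.
  move=> x; have := is_deriveV (f0 x) (df x).
  by rewrite mulN1r -invfM -expr2.
have sVf := IHn (smoothnS sf).
by apply: smoothnM => //; apply: smoothnZ; exact: smoothnM.
Qed.

Lemma smoothn_affine n (a b : R) f : smoothn n f ->
  smoothn n (fun x => f (a * x + b)).
Proof.
have da x : is_derive x 1 (fun x : R => a * x + b) a.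
  by apply: is_derive_eq; rewrite addr0 scaler1.
elim: n f => [|n IHn] f.
  move=> cf x; apply: (@continuous_comp _ _ _ (fun x => a * x + b)); last exact: cf.
  by apply/differentiable_continuous/derivable1_diffP; case: (da x).
move=> [f' [df sf']]; exists (fun x => f' (a * x + b) * a); split.
  by move=> x; exact: is_derive1_comp.
by apply: smoothnM; [exact: IHn | exact: smoothn_cst].
Qed.

Lemma smooth1_id : smooth1 id.
Proof.
case=> [x|n]; first exact: cvg_id.
by exists (fun=> 1); split; [move=> x; exact: is_derive_id | exact: smoothn_cst].
Qed.

(** The exponent [m] makes the family stable under differentiation: the derivative of [flat m] is
    [flat m.+2 - m * flat m.+1], so smoothness is proved for all [m] at once. *)
Definition flat m x : R := if 0 < x then x^-1 ^+ m * expR (- x^-1) else 0.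

Lemma flat_ge0 m x : 0 <= flat m x.
Proof.
rewrite /flat; case: ifP => // x0.
by rewrite mulr_ge0 ?expR_ge0// exprn_ge0// invr_ge0 ltW.
Qed.

(** The exponential series gives [exp(1/x) >= x^-(m+1) / (m+1)!]. This is the decay needed at 0. *)
Lemma flat_le m x : flat m x <= (m.+1)`!%:R * `|x|.
Proof.
rewrite /flat; case: ifPn => x0; last by rewrite mulr_ge0.
rewrite expRN ler_pdivrMr ?expR_gt0// gtr0_norm//.
have y0 : 0 <= x^-1 by rewrite invr_ge0 ltW.
have h : x^-1 ^+ m.+1 / (m.+1)`!%:R <= expR x^-1.
  by apply: le_trans (expR_ge1Dxn m y0); rewrite lerDr.
have c0 : 0 <= (m.+1)`!%:R * x by rewrite mulr_ge0// ltW.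
apply: le_trans (ler_wpM2l c0 h).
rewrite le_eqVlt; apply/orP; left; apply/eqP; rewrite exprSr.
have f0 : ((m.+1)`!%:R : R) != 0 by rewrite pnatr_eq0 -lt0n fact_gt0.
by field; rewrite f0 gt_eqF.
Qed.

Lemma flatS m x : flat m x = flat m.+1 x * x.
Proof.
rewrite /flat; case: ifPn => x0; last by rewrite mul0r.
by rewrite exprSr mulrAC divfK ?gt_eqF.
Qed.

Lemma is_derive_flat m x :
  is_derive x 1 (flat m) (flat m.+2 x - m%:R * flat m.+1 x).
Proof.
have [x0|x0|->] := ltgtP x 0.
- rewrite /flat ltNge (ltW x0) /= mulr0 subrr.
  apply: (@near_eq_is_derive _ _ _ (cst 0)) => //.
  near=> y; rewrite ifN// -leNgt ltW//.
  by near: y; exact: lt_nbhsl.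
- have xN0 : x != 0 by rewrite gt_eqF.
  have d1 : is_derive x 1 (fun y : R => y^-1) (- x ^- 2).
    have := is_deriveV (f := id) (t := 1) (v := 1) xN0 (is_derive_id _ _).
    by rewrite /GRing.scale/= mulr1.
  have d2 : is_derive x 1 (fun y : R => expR (- y^-1)) (expR (- x^-1) * (x ^- 2)).
    have dN : is_derive x 1 (fun y : R => - y^-1) (x ^- 2).
      by have := is_deriveN d1; rewrite opprK.
    exact: (is_derive1_comp (is_derive_expR _) dN).
  apply: (@near_eq_is_derive _ _ _ (fun y : R => y^-1 ^+ m * expR (- y^-1))).
    near=> y; rewrite /flat ifT//.
    by near: y; exact: lt_nbhsr.
  have d3 := is_deriveM (is_deriveX m d1) d2.
  rewrite /flat x0.
  have <- : (fun y : R => y^-1) ^+ m * (fun y => expR (- y^-1)) =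
      (fun y : R => y^-1 ^+ m * expR (- y^-1)).
    by apply/funext => y; rewrite mulrfctE exprfctE.
  apply: is_derive_eq.
  rewrite exprfctE /GRing.scale/= -exprVn.
  by case: m {d3} => [|m] /=; rewrite !exprS ?expr0; ring.
- have flat0 k : flat k 0 = 0 by rewrite /flat ltxx.
  (* At 0 the slope function of [flat m] is [flat m.+1], by [flatS], and it tends to 0 by
     [flat_le]. *)
  rewrite !flat0 mulr0 subrr; apply/is_derive1_caratheodory.
  exists (flat m.+1); split; [| |exact: flat0].
    by move=> z; rewrite flat0 !subr0 flatS.
  suff : flat m.+1 z @[z --> (0 : R)] --> (0 : R).
    by rewrite -[X in _ --> X](flat0 m.+1).
  apply/cvgr0Pnorm_le => e e0.
  near=> z; rewrite ger0_norm ?flat_ge0// (le_trans (flat_le _ _))//.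
  have F0 : 0 < (m.+2)`!%:R :> R by rewrite ltr0n fact_gt0.
  rewrite mulrC -ler_pdivlMr//.
  near: z; have := @cvgr0_norm_le _ R^o R (nbhs 0) _ id.
  by apply => //; rewrite divr_gt0.
Unshelve. all: by end_near. Qed.

Lemma smoothn_flat n m : smoothn n (flat m).
Proof.
elim: n m => [|n IHn] m.
  move=> x; apply/differentiable_continuous/derivable1_diffP.
  by case: (is_derive_flat m x).
exists (fun x => flat m.+2 x - m%:R * flat m.+1 x); split; first exact: is_derive_flat.
by apply: smoothnB; [exact: IHn | apply: smoothnZ; exact: IHn].
Qed.

Definition smooth_step x : R := flat 0 x / (flat 0 x + flat 0 (1 - x)).

Let step_den x : 0 < flat 0 x + flat 0 (1 - x).
Proof.
have flat_gt0 y : 0 < y -> 0 < flat 0 y.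
  by move=> y0; rewrite /flat y0 mul1r expR_gt0.
have [x0|x0] := ltP 0 x.
  by rewrite ltr_pwDl ?flat_gt0// flat_ge0.
by rewrite ltr_wpDl ?flat_ge0// flat_gt0//; lra.
Qed.

Lemma smooth_step_smooth : smooth1 smooth_step.
Proof.
move=> n; apply: smoothnM; first exact: smoothn_flat.
apply: smoothnV; first by move=> x; rewrite gt_eqF.
apply: smoothnD; first exact: smoothn_flat.
have /(smoothn_affine (-1) 1) := smoothn_flat n 0.
by under eq_fun do rewrite mulN1r addrC.
Qed.

Lemma smooth_step_ge0 x : 0 <= smooth_step x.
Proof. by rewrite divr_ge0 ?flat_ge0// ltW. Qed.

Lemma smooth_step_le1 x : smooth_step x <= 1.
Proof. by rewrite ler_pdivrMr// mul1r lerDl flat_ge0. Qed.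

Lemma smooth_step0 x : x <= 0 -> smooth_step x = 0.
Proof. by move=> x0; rewrite /smooth_step {1}/flat ltNge x0 mul0r. Qed.

Lemma smooth_step1 x : 1 <= x -> smooth_step x = 1.
Proof.
move=> x1; have f0 : flat 0 (1 - x) = 0 by rewrite /flat ltNge subr_le0 x1.
by have := step_den x; rewrite /smooth_step f0 addr0 => ?; rewrite divff// gt_eqF.
Qed.

(* [bump a b] vanishes outside of ]a, b + 1[ and equals 1 on [a + 1, b]; for
   integers a < b it is the sum of the bumps [bump j (j + 1)], a <= j < b. *)
Definition bump (a b x : R) : R := smooth_step (x - a) - smooth_step (x - b).

Lemma bump_smooth a b : smooth1 (bump a b).
Proof.
move=> n; apply: smoothnB.
  have /(smoothn_affine 1 (- a)) := smooth_step_smooth n.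
  by under eq_fun do rewrite mul1r.
have /(smoothn_affine 1 (- b)) := smooth_step_smooth n.
by under eq_fun do rewrite mul1r.
Qed.

Lemma bump_ge0 a b x : a + 1 <= b -> 0 <= bump a b x.
Proof.
move=> ab; rewrite subr_ge0; have [xb|xb] := leP x b.
  by rewrite (smooth_step0 (x := x - b)) ?subr_le0// smooth_step_ge0.
rewrite (smooth_step1 (x := x - a)) ?smooth_step_le1//; lra.
Qed.

Lemma bump_le1 a b x : bump a b x <= 1.
Proof.
by rewrite lerBlDr (le_trans (smooth_step_le1 _))// lerDl smooth_step_ge0.
Qed.

Lemma bump_out a b x : a <= b -> (x <= a) || (b + 1 <= x) -> bump a b x = 0.
Proof.
move=> ab /orP[xa|xb]; rewrite /bump.
  by rewrite !smooth_step0 ?subrr//; lra.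
by rewrite !smooth_step1 ?subrr//; lra.
Qed.

Lemma bump_in a b x : a + 1 <= x <= b -> bump a b x = 1.
Proof.
move=> /andP[ax xb]; rewrite /bump smooth_step1; last by lra.
by rewrite smooth_step0 ?subr0//; lra.
Qed.

Lemma bump_sum (a : R) n x :
  \sum_(j < n) bump (a + j%:R) (a + j%:R + 1) x = bump a (a + n%:R) x.
Proof.
elim: n => [|n IHn]; first by rewrite big_ord0 /bump addr0 subrr.
rewrite big_ord_recr/= IHn /bump -[a + n%:R + 1]addrA -[n%:R + 1]mulrSr.
by rewrite addrA subrK.
Qed.

End smooth_functions_of_one_variable.

(** * Tensor products of bumps, and cutoff functions *)

Section tensor_products.
Context {R : realType} {d : nat}.
Local Notation V := 'rV[R]_d.
Implicit Types (g : 'I_d -> R -> R) (f : V -> R) (x : V).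

Definition tensor g : V -> R := fun x => \prod_k g k (x 0 k).

Lemma tensor_continuous g : (forall k, continuous (g k)) -> continuous (tensor g).
Proof.
move=> cg; rewrite (_ : tensor g =
    \big[(fun f h x => f x * h x)/fun=> 1]_k (fun x : V => g k (x 0 k))).
  apply: (big_ind (fun f : V -> R => continuous f)).
  - exact: cst_continuous.
  - by move=> f h cf ch x; exact: (continuousM (cf x) (ch x)).
  - move=> k _ x; apply: (@continuous_comp _ _ _ (fun x : V => x 0 k) (g k)).
      exact: coord_continuous.
    exact: cg.
by apply/funext => x; apply: (big_ind2 (fun a b => a = b x)) => // a b c e -> ->.
Qed.

Lemma tensor_is_derive g k (g' : R) x : is_derive (x 0 k) 1 (g k) g' ->
  is_derive x (delta_mx 0 k) (tensor g) (g' * \prod_(j | j != k) g j (x 0 j)).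
Proof.
move=> [dg <-]; set c := \prod_(_ | _) _.
have cv : h^-1 *: ((tensor g \o shift x) (h *: delta_mx 0 k) - tensor g x)
    @[h --> 0^'] --> 'D_1 (g k) (x 0 k) * c.
  have -> : (fun h => h^-1 *: ((tensor g \o shift x) (h *: delta_mx 0 k) - tensor g x)) =
      (fun h : R => (h^-1 *: ((g k \o shift (x 0 k)) (h *: 1) - g k (x 0 k))) * c).
    apply/funext => h; rewrite /tensor /= (bigD1 k)//= [in X in _ - X](bigD1 k)//=.
    rewrite (eq_bigr (fun j => g j (x 0 j))); last first.
      by move=> j jk; rewrite !mxE eqxx (negbTE jk) mulr0 add0r.
    rewrite -/c -mulrBl !mxE !eqxx /= -scalerAl; congr (_ *: ((g k (_ + _) - _) * _)).
  by apply: cvgM; [exact: dg | exact: cvg_cst].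
by apply: DeriveDef; [apply/cvg_ex; eexists; exact: cv | exact: cvg_lim cv].
Qed.

(** A partial derivative of a tensor product is again one, with the factor [k] replaced by its
    derivative; by induction every iterated partial derivative is a tensor product of smooth
    factors. *)
Lemma tensor_smooth g : (forall k, smooth1 (g k)) -> smooth (tensor g).
Proof.
move=> sg s.
have [g' [sg' ->]] : exists g', (forall k, smooth1 (g' k)) /\
    iter_partial s (tensor g) = tensor g'.
  elim: s => [|k s [g' [sg' IHs]]]; first by exists g.
  have [gk' [dgk sgk]] := smooth1_derive (sg' k).
  exists (fun j => if j == k then gk' else g' j); split.
    by move=> j; case: ifP.
  rewrite /iter_partial /= -/(iter_partial s _) IHs; apply/funext => x.
  have [_ dv] := tensor_is_derive (g := g') (dgk (x 0 k)).
  rewrite /partial dv /tensor [RHS](bigD1 k)//= eqxx; congr (_ * _).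
  by apply: eq_bigr => j /negbTE ->.
split; first by apply: tensor_continuous => k; exact: (sg' k 0%N).
move=> k x; have [gk' [dgk _]] := smooth1_derive (sg' k).
by case: (tensor_is_derive (g := g') (dgk (x 0 k))).
Qed.

Lemma smoothB f1 f2 : smooth f1 -> smooth f2 -> smooth (fun x => f1 x - f2 x).
Proof.
move=> sf1 sf2 s.
have -> : iter_partial s (fun x => f1 x - f2 x) =
    (fun x => iter_partial s f1 x - iter_partial s f2 x).
  elim: s => [//|k s IHs].
  rewrite /iter_partial /= -!/(iter_partial s _) IHs; apply/funext => x.
  have [_ d1] := sf1 s; have [_ d2] := sf2 s.
  exact: deriveB.
have [c1 d1] := sf1 s; have [c2 d2] := sf2 s; split.
  by move=> x; exact: (continuousB (c1 x) (c2 x)).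
by move=> k x; exact: derivableB.
Qed.

Lemma smooth_compactly_supportedP f (r : R) : smooth f ->
  (forall x, r < `|x| -> f x = 0) -> smooth_compactly_supported f.
Proof.
move=> sf f0; split => //.
have sub : [set x | f x != 0] `<=` [set x : V | `|x| <= r].
  move=> x /= fx; rewrite leNgt; apply/negP => /f0 fx0.
  by rewrite fx0 eqxx in fx.
have cl : closed [set x : V | `|x| <= r].
  apply: (@closed_comp _ _ (fun x : V => `|x|) [set y | y <= r]).
    by move=> x _; exact: norm_continuous.
  exact: closed_le.
apply: bounded_closed_compact; last exact: closed_closure.
exists r; split; first exact: num_real.
move=> M rM x /= cx; apply: ltW; apply: le_lt_trans rM.
by have := closure_subset sub cx; rewrite -(closure_id _).1.
Qed.

Lemma smooth_compactly_supportedB f1 f2 : smooth_compactly_supported f1 ->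
  smooth_compactly_supported f2 ->
  smooth_compactly_supported (fun x => f1 x - f2 x).
Proof.
move=> [s1 c1] [s2 c2]; split; first exact: smoothB.
apply: (@subclosed_compact _ _ (closure [set x | f1 x != 0] `|` closure [set x | f2 x != 0])).
- exact: closed_closure.
- exact: compactU.
- rewrite -closureU; apply: closure_subset => x /= h.
  have [f10|] := eqVneq (f1 x) 0; last by left.
  by right; apply: contraNN h => /eqP ->; rewrite f10 subrr.
Qed.

(** [bump (-2) 1] is 1 on [[-1, 1]] and vanishes outside []-2, 2[], hence the factor 2 between radii
    that recurs below. The product over coordinates reduces smoothness to one variable and fits the
    sup norm. *)
Definition cutoff (r : R) : V -> R := tensor (fun _ y => bump (-2) 1 (y / r)).

Lemma norm_coord (x : V) k : `|x 0 k| <= `|x|.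
Proof.
rewrite [leRHS]/Num.Def.normr /= mx_normrE.
by rewrite (le_bigmax _ (fun ij => `|x ij.1 ij.2|) (0, k)).
Qed.

Lemma norm_coord_le (x : V) (r : R) : 0 <= r ->
  (forall k, `|x 0 k| <= r) -> `|x| <= r.
Proof.
move=> r0 xr; rewrite [leLHS]/Num.Def.normr /= mx_normrE.
by apply/bigmax_leP; split => // -[i k] _ /=; rewrite ord1.
Qed.

Lemma norm_coord_gt (x : V) (r : R) : 0 <= r -> r < `|x| -> exists k, r < `|x 0 k|.
Proof.
move=> r0 xr; apply/not_existsP => h.
have : `|x| <= r by apply: norm_coord_le => // k; rewrite leNgt; apply/negP/h.
by rewrite leNgt xr.
Qed.

Lemma tensor_ge0 g x : (forall k y, 0 <= g k y) -> 0 <= tensor g x.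
Proof. by move=> g0; exact: prodr_ge0. Qed.

Lemma tensor_le1 g x : (forall k y, 0 <= g k y <= 1) -> tensor g x <= 1.
Proof. by move=> g01; apply: prodr_ile1 => k _. Qed.

Lemma cutoff_ge0 r x : 0 <= cutoff r x.
Proof. by apply: tensor_ge0 => k y; rewrite bump_ge0//; lra. Qed.

Lemma cutoff_le1 r x : cutoff r x <= 1.
Proof. by apply: tensor_le1 => k y; rewrite bump_ge0 ?bump_le1//; lra. Qed.

Lemma cutoff1 r x : 0 < r -> `|x| <= r -> cutoff r x = 1.
Proof.
move=> r0 xr; apply: big1 => k _; apply: bump_in.
have := le_trans (norm_coord x k) xr; rewrite ler_norml => /andP[h1 h2].
rewrite ler_pdivlMr// ler_pdivrMr// mul1r h2 andbT.
by rewrite (le_trans _ h1)//; lra.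
Qed.

Lemma cutoff0 r x : 0 < r -> 2 * r < `|x| -> cutoff r x = 0.
Proof.
move=> r0 xr; have [|k xk] := @norm_coord_gt x (2 * r) _ xr; first by lra.
rewrite /cutoff /tensor (bigD1 k)//= [X in X * _](_ : _ = 0) ?mul0r//.
apply: bump_out; first by lra.
rewrite ler_pdivrMr// ler_pdivlMr//.
move: xk; rewrite ltr_normr => /orP[h|h]; apply/orP; [right|left]; lra.
Qed.

Let scaled_bump_smooth r : smooth1 (fun y : R => bump (-2) 1 (y / r)).
Proof.
move=> n; have := smoothn_affine r^-1 0 (bump_smooth (-2) 1 n).
by under eq_fun do rewrite addr0 mulrC.
Qed.

Lemma cutoff_smooth r : smooth (cutoff r).
Proof. by apply: tensor_smooth => k; exact: scaled_bump_smooth. Qed.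

Lemma cutoff_compact r : 0 < r -> smooth_compactly_supported (cutoff r).
Proof.
move=> r0; apply: (@smooth_compactly_supportedP _ (2 * r)); first exact: cutoff_smooth.
by move=> x; exact: cutoff0.
Qed.

(** These functions give the generator access to the second moments of the small jumps. *)
Lemma sqr_cutoff_compact r j : 0 < r ->
  smooth_compactly_supported (fun x : V => x 0 j ^+ 2 * cutoff r x).
Proof.
move=> r0; apply: (@smooth_compactly_supportedP _ (2 * r)); last first.
  by move=> x xr; rewrite cutoff0// mulr0.
rewrite (_ : (fun x => _) = tensor (fun k y =>
    (if k == j then y ^+ 2 else 1) * bump (-2) 1 (y / r))).
  apply: tensor_smooth => k n; apply: smoothnM; last exact: scaled_bump_smooth.
  case: (k == j); last exact: smoothn_cst.
  by under eq_fun do rewrite expr2; apply: smoothnM; exact: smooth1_id.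
apply/funext => x; rewrite /cutoff /tensor big_split/=; congr (_ * _).
by rewrite (bigD1 j)//= eqxx big1 ?mulr1// => k /negbTE ->.
Qed.

Lemma cutoff_measurable r : measurable_fun setT (cutoff r).
Proof. by apply: continuous_measurable_rV; have [] := cutoff_smooth r [::]. Qed.

Lemma cutoff_bdmeas r : bdmeas (cutoff r).
Proof.
apply: (@bdmeas_between _ _ _ 0 1); first exact: cutoff_measurable.
by move=> x; rewrite cutoff_ge0 cutoff_le1.
Qed.

Lemma smooth_compactly_supported_bdmeas f :
  smooth_compactly_supported f -> bdmeas f.
Proof.
move=> [sf cf]; have [contf _] := sf [::]; split; first exact: continuous_measurable_rV.
have : compact (f @` closure [set x | f x != 0]).
  by apply: continuous_compact => //; exact: continuous_subspaceT.
move/compact_bounded => [M [_ hM]]; exists (`|M| + 1) => x.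
have [->|fx0] := eqVneq (f x) 0; first by rewrite normr0 addr_ge0.
apply: (hM (`|M| + 1)); first by rewrite (le_lt_trans (ler_norm _))// ltrDl.
by exists x => //; exact: subset_closure.
Qed.

End tensor_products.

(** * Levy measures and the generator *)

Section levy_measure_integrals.
Context {R : realType} {d : nat}.
Local Notation V := 'rV[R]_d.
Context (nu : {measure set 'rV[R]_d -> \bar R}) (levy_nu : levy_measure nu).
Implicit Types (F : V -> R) (x y : V).

Local Notation trunc y := (Num.min 1 (sqnorm y)).

Lemma sqnorm_ge0 y : 0 <= sqnorm y.
Proof. by apply: sumr_ge0 => k _; exact: sqr_ge0. Qed.

Lemma sqnorm_ge y k : y 0 k ^+ 2 <= sqnorm y.
Proof. by rewrite /sqnorm (bigD1 k)//= lerDl sumr_ge0// => j _; exact: sqr_ge0. Qed.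

Lemma sqnorm_gt y (r : R) : 0 <= r -> r < `|y| -> r ^+ 2 <= sqnorm y.
Proof.
move=> r0 /(norm_coord_gt r0)[k yk]; apply: le_trans (sqnorm_ge y k).
by rewrite -[leRHS]real_normK ?num_real// lerXn2r ?nnegrE// ltW.
Qed.

Lemma trunc_ge0 y : 0 <= trunc y.
Proof. by rewrite le_min ler01 sqnorm_ge0. Qed.

Lemma measurable_trunc : measurable_fun setT (fun y : V => trunc y).
Proof.
apply: measurable_minr => //; apply: measurable_sum => k.
by apply: measurable_funX; exact: coord_measurable.
Qed.

Lemma trunc_integrable : nu.-integrable setT (fun y => (trunc y)%:E).
Proof.
apply/integrableP; split.
  by apply/measurable_EFinP; exact: measurable_trunc.
by under eq_integral do rewrite gee0_abs ?lee_fin ?trunc_ge0//; case: levy_nu.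
Qed.

Lemma trunc_dominated_integrable (C : R) F : measurable_fun setT F ->
  (forall y, `|F y| <= C * trunc y) -> nu.-integrable setT (EFin \o F).
Proof.
move=> mF FC.
apply: (@le_integrable _ _ _ nu setT measurableT _ (fun y => C%:E * (trunc y)%:E)%E).
- exact/measurable_EFinP.
- by move=> y _; rewrite /= lee_fin (le_trans (FC y))// ler_norm.
- exact: integrableZl trunc_integrable.
Qed.

(** Beyond [r] the truncation is either 1 or [sqnorm y >= r^2]; the two cases give the two terms of
    the constant. *)
Lemma vanishing_near0_dominated (r : R) F y : 0 < r -> `|F y| <= 1 ->
  (`|y| <= r -> F y = 0) -> `|F y| <= (1 + r ^- 2) * trunc y.
Proof.
move=> r0 F1 Fr; have c1 : 0 <= r ^- 2 by rewrite invr_ge0 sqr_ge0.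
have [yr|yr] := leP `|y| r.
  by rewrite Fr// normr0 mulr_ge0 ?trunc_ge0// addr_ge0.
apply: (le_trans F1); have := sqnorm_gt (ltW r0) yr.
rewrite minEle; case: ifP => _ h; first by rewrite mulr1 lerDl.
apply: (@le_trans _ _ (r ^- 2 * sqnorm y)).
  by rewrite ler_pdivlMl ?exprn_gt0// mulr1.
by rewrite ler_wpM2r ?sqnorm_ge0// lerDr.
Qed.

Let dominated (F : nat -> V -> R) : (forall n, measurable_fun setT (F n)) ->
  (forall n y, `|F n y| <= trunc y) ->
  (forall y, \forall n \near \oo, F n y = 0) ->
  \int[nu]_y F n y @[n --> \oo] --> (0 : R).
Proof.
move=> mF Ftr F0.
apply: fine_cvg.
have -> : (fine 0%E)%:E = (\int[nu]_y (cst 0%E y : \bar R))%E.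
  by rewrite integral_cst//= mul0e.
apply: (@dominated_cvg _ _ _ nu setT measurableT (fun n => EFin \o F n)
  (cst 0%E) (fun y => (trunc y)%:E)) => //.
- by move=> n; exact/measurable_EFinP.
- move=> y _; apply: cvg_near_cst; apply: filterS (F0 y) => n /= ->//.
- exact: trunc_integrable.
- by move=> n y _ /=; rewrite lee_fin.
Qed.

(** Dominated convergence along the radii [n.+1]: being at least 1, they make [1 - cutoff] vanish on
    the unit ball, where a Levy measure may have infinite mass. *)
Lemma cutoff_tail (e : R) : 0 < e -> exists2 r : R, 1 <= r &
  \int[nu]_y (1 - cutoff r y) < e.
Proof.
move=> e0.
have tr n y : `|1 - cutoff n.+1%:R y| <= trunc y.
  have c1 := cutoff_le1 n.+1%:R y; have c0 := cutoff_ge0 n.+1%:R y.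
  rewrite ger0_norm ?subr_ge0// le_min lerBlDr lerDl c0/=.
  have [yn|yn] := leP `|y| n.+1%:R; first by rewrite cutoff1// subrr sqnorm_ge0.
  rewrite lerBlDr (le_trans _ (_ : 1 <= sqnorm y + _))// ler_wpDr//.
  rewrite -[leLHS](expr1n _ 2); apply: sqnorm_gt => //.
  by rewrite (le_lt_trans _ yn)// ler1n.
have /(_ _ _)/cvgrPdist_lt := dominated _ tr _.
have mc n : measurable_fun setT (fun y : V => 1 - cutoff n.+1%:R y).
  by apply: measurable_funB => //; exact: cutoff_measurable.
have ev y : \forall n \near \oo, 1 - cutoff n.+1%:R y = 0 :> R.
  near=> n; rewrite cutoff1 ?subrr//.
  rewrite (@le_trans _ _ n%:R)// ?ler_nat//.
  near: n; exact: nbhs_infty_ger.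
move=> /(_ mc ev e e0)[N _ /(_ N (leqnn _))]; rewrite sub0r normrN => h.
exists N.+1%:R; first by rewrite ler1n.
exact: le_lt_trans (ler_norm _) h.
Unshelve. all: by end_near. Qed.

Lemma sqr_cutoff_le_trunc (r : R) j y : 0 < r -> 2 * r <= 1 ->
  `|y 0 j ^+ 2 * cutoff r y| <= trunc y.
Proof.
move=> r0 r1; have c1 := cutoff_le1 r y; have c0 := cutoff_ge0 r y.
rewrite (ger0_norm (mulr_ge0 (sqr_ge0 _) c0)).
have [yn|yn] := leP `|y| (2 * r); last by rewrite cutoff0// mulr0 trunc_ge0.
apply: (@le_trans _ _ (y 0 j ^+ 2)); first by rewrite ler_piMr ?sqr_ge0.
rewrite le_min sqnorm_ge andbT -(real_normK (num_real (y 0 j))).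
rewrite exprn_ile1//; exact: le_trans (norm_coord y j) (le_trans yn r1).
Qed.

Lemma sqr_cutoff_small (e : R) : 0 < e -> exists r : R, [/\ 0 < r, 2 * r <= 1 &
  forall j, \int[nu]_y (y 0 j ^+ 2 * cutoff r y) < e].
Proof.
(* The support then lies in the ball of radius [2 * r n = 1 / n.+1 <= 1], where the square of a
   coordinate is below the truncation. *)
move=> e0; pose r n : R := 2^-1 / n.+1%:R.
have r0 n : 0 < r n by rewrite divr_gt0// invr_gt0.
have r1 n : 2 * r n <= 1.
  by rewrite /r mulrA mulfV ?pnatr_eq0// mul1r invf_le1// ler1n.
have mF j n : measurable_fun setT (fun y : V => y 0 j ^+ 2 * cutoff (r n) y).
  apply: measurable_funM; last exact: cutoff_measurable.
  by apply: measurable_funX; exact: coord_measurable.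
have ev j (y : V) : \forall n \near \oo, y 0 j ^+ 2 * cutoff (r n) y = 0 :> R.
  have [->|y0] := eqVneq y 0.
    by apply: nearW => n; rewrite mxE expr0n mul0r.
  have ny : 0 < `|y| by rewrite normr_gt0.
  near=> n; rewrite cutoff0 ?mulr0//.
  rewrite /r mulrA mulfV ?pnatr_eq0// mul1r invf_plt ?posrE//.
  rewrite (lt_le_trans (_ : _ < n%:R))// ?ler_nat//.
  by near: n; exact: nbhs_infty_gtr.
have small j : \forall n \near \oo, \int[nu]_y (y 0 j ^+ 2 * cutoff (r n) y) < e.
  have h := dominated (mF j) (fun n y => sqr_cutoff_le_trunc j y (r0 n) (r1 n)) (ev j).
  have /cvgrPdist_lt/(_ e e0) := h; apply: filterS => n.
  by rewrite sub0r normrN; exact: le_lt_trans (ler_norm _).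
have [N _ hN] : \forall n \near \oo, forall j,
    \int[nu]_y (y 0 j ^+ 2 * cutoff (r n) y) < e.
  exact: filter_forall.
by exists (r N); split => // j; apply: hN => /=.
Unshelve. all: by end_near. Qed.

End levy_measure_integrals.

(** * The generator tested at the origin *)

Section generator_at_the_origin.
Context {R : realType} {d : nat} {dO : measure_display}.
Context {Omega : measurableType dO} {P : probability Omega R}.
Local Notation V := 'rV[R]_d.
Context (X : R -> {RV P >-> 'rV[R]_d}) (lambda : R) (theta : V).
Context (nu : {measure set 'rV[R]_d -> \bar R}) (levy_nu : levy_measure nu).
Context (genX : has_generator X (levy_operator lambda theta nu)).
Implicit Types F : V -> R.

Local Notation law := (levy_law X).

(** [F] is constant at 0 up to a quadratic error. Consequently the drift term of the generator
    vanishes at the origin. *)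
Lemma partial_at_0 F (C : R) k :
  (forall y, `|F y - F 0| <= C * Num.min 1 (sqnorm y)) -> partial k F 0 = 0.
Proof.
(* Evaluate the bound at the vector of ones, whose truncated squared norm is positive. *)
move=> FC; have C0 : 0 <= C.
  have := le_trans (normr_ge0 _) (FC (const_mx 1)).
  rewrite pmulr_lge0// lt_min ltr01/= (lt_le_trans _ (sqnorm_ge _ k))// mxE.
  by rewrite exprn_gt0.
apply: (@cvg_lim _ _ _ (0^' : set_system R)) => //.
apply/cvgr0Pnorm_le => e e0; near=> h.
have h0 : h != 0 by near: h; exact: nbhs_dnbhs_neq.
rewrite normrM normfV ler_pdivrMl ?normr_gt0// /= addr0.
have hk : h *: delta_mx 0 k = \row_j (if j == k then h else 0) :> V.
  by apply/rowP => j; rewrite !mxE eqxx/=; case: eqP => _; rewrite ?mulr1 ?mulr0.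
have sh : sqnorm (h *: delta_mx 0 k : V) = h ^+ 2.
  rewrite /sqnorm (bigD1 k)//= big1 ?addr0 ?hk ?mxE ?eqxx// => j jk.
  by rewrite mxE (negbTE jk) expr0n.
apply: (le_trans (FC _)); rewrite sh.
apply: (@le_trans _ _ (C * h ^+ 2)); first by rewrite ler_wpM2l// ge_min lexx orbT.
rewrite -(real_normK (num_real h)) expr2 mulrCA ler_wpM2l//.
rewrite (@le_trans _ _ ((C + 1) * `|h|))// ?ler_wpM2r ?lerDl//.
rewrite mulrC -ler_pdivlMr ?ltr_pwDr//.
near: h; apply: dnbhs0_le; rewrite divr_gt0// ltr_pwDr.
Unshelve. all: by end_near. Qed.

(** The uniform limit is read at 0, where [P_h F] is the integral of [F] against the law of [X h],
    and where [partial_at_0] leaves the jump part of the generator. *)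
Lemma generator_limit F (C : R) : smooth_compactly_supported F ->
  (forall y, `|F y - F 0| <= C * Num.min 1 (sqnorm y)) ->
  h^-1 * (\int[law h]_y F y - F 0) @[h --> 0^'+] -->
  lambda * \int[nu]_y (F y - F 0).
Proof.
move=> cF FC; have bF := smooth_compactly_supported_bdmeas cF.
have := genX cF; move=> /(@uniform_subset_cvg V R _ _ [set 0]).
rewrite uniform_set1 => /(_ (@subsetT _ _)) h.
have -> : lambda * \int[nu]_y (F y - F 0) = levy_operator lambda theta nu F 0.
  congr (_ * _); apply: eq_Rintegral => y _.
  rewrite /levy_integrand /D_ add0r big1 ?subr0// => k _.
  by rewrite (partial_at_0 _ FC) mulr0.
apply: cvg_trans h; apply: near_eq_cvg; apply: nearW => h /=.
congr (_ * (_ - _)); rewrite /rsemigroup /semigroup.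
rewrite [LHS](_ : _ = \int[P]_w F (X h w)).
  exact: esym (Rintegral_distribution (P := P) (X h) bF).
by congr fine; apply: eq_integral => w _ /=; rewrite add0r.
Qed.

Lemma generator_limitn F (C t : R) : 0 < t -> smooth_compactly_supported F ->
  (forall y, `|F y - F 0| <= C * Num.min 1 (sqnorm y)) ->
  n.+1%:R * (\int[law (t / n.+1%:R)]_y F y - F 0) @[n --> \oo] -->
  t * lambda * \int[nu]_y (F y - F 0).
Proof.
move=> t0 cF FC.
have /cvg_at_rightP := generator_limit cF FC.
move=> /(_ (fun n => t / n.+1%:R)) h.
have {}h := h _; rewrite (_ : (fun n => _) =
    (fun n => t * ((t / n.+1%:R)^-1 * (\int[law (t / n.+1%:R)]_y F y - F 0)))).
  rewrite -mulrA; apply: cvgM; first exact: cvg_cst.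
  apply: h; split; first by move=> n; rewrite divr_gt0.
  rewrite -[X in _ --> X](mulr0 t); apply: cvgM; first exact: cvg_cst.
  exact: cvg_harmonic.
by apply/funext => n; rewrite invf_div mulrA [t * (_ / t)]mulrC divfK ?gt_eqF.
Qed.

End generator_at_the_origin.

(** * Lipschitz approximation and partitions of unity *)

Section approximation.
Context {R : realType} {d : nat}.
Local Notation V := 'rV[R]_d.
Implicit Types (f g : V -> R).

Lemma continuous_rVP (f : V -> R) (x : V) : {for x, continuous f} <->
  forall e : R, 0 < e -> exists2 r : R, 0 < r &
  forall y : V, `|x - y| < r -> `|f x - f y| <= e.
Proof.
have E := @cvgrPdist_le R R^o V (nbhs x) (nbhs_filter x) f (f x).
split=> [/E h e e0|h].
  have /nbhs_ballP[r /= r0 hr] := h _ e0; exists r => // y xy.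
  by apply: hr; rewrite -ball_normE.
apply/E => e e0; have [r r0 hr] := h _ e0.
by apply/nbhs_ballP; exists r => // y; rewrite -ball_normE; exact: hr.
Qed.
Definition lipschitz_bound (L : R) g := forall x y, `|g x - g y| <= L * `|x - y|.

Lemma lipschitz_bound_continuous L g : lipschitz_bound L g -> continuous g.
Proof.
move=> Lg x; apply/continuous_rVP => e e0.
have L1 : 0 < `|L| + 1 by rewrite ltr_wpDl.
exists (e / (`|L| + 1)); first exact: divr_gt0.
move=> y xy; apply: (le_trans (Lg x y)).
rewrite (@le_trans _ _ ((`|L| + 1) * `|x - y|))//.
  by rewrite ler_wpM2r// (le_trans (ler_norm _))// lerDl.
by rewrite mulrC -ler_pdivlMr// ltW.
Qed.

(** An average of translates keeps the Lipschitz constant, so Lipschitz functions form a class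
    stable under every label operator. *)
Lemma wconv_lipschitz (mu : probability V R) w L g : bdmeas w -> bdmeas g ->
  (forall y, 0 <= w y) -> \int[mu]_y w y = 1 ->
  lipschitz_bound L g -> lipschitz_bound L (wconv mu w g).
Proof.
move=> bw bg w0 w1 Lg x y.
have mQ := markov_wconv bw w0 w1.
have sh z : bdmeas (fun s : V => w s * g (z + s)).
  by apply: bdmeasM => //; exact: bdmeas_shift.
rewrite /wconv -RintegralB//; try exact: bdmeas_integrable.
apply: (le_trans (le_normr_Rintegral _ _)) => //.
  by apply: bdmeas_integrable; exact: bdmeasB.
rewrite -[leRHS]mul1r -w1 -RintegralZr//; last exact: bdmeas_integrable.
apply: le_Rintegral => //; try apply: bdmeas_integrable.
- by apply: bdmeas_norm; exact: bdmeasB.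
- by apply: bdmeasM => //; exact: bdmeas_cst.
move=> s _; rewrite -mulrBr normrM ger0_norm// ler_wpM2l//.
by have := Lg (x + s) (y + s); rewrite opprD addrACA subrr addr0.
Qed.

Section inf_convolution.
Context (f : V -> R) (l u : R).
Context (cf : continuous f) (flu : forall x, l <= f x <= u).

Let iconv_set (k : R) x := [set f y + k * `|x - y| | y in [set: V]].

(** The Pasch-Hausdorff envelope: for [0 <= k], the largest [k]-Lipschitz function below [f]. *)
Definition inf_convolution (k : R) x : R := inf (iconv_set k x).

Let iconv_lb k x : 0 <= k -> lbound (iconv_set k x) l.
Proof.
move=> k0 _ [y _ <-]; have /andP[ly _] := flu y.
by rewrite (le_trans ly)// lerDl mulr_ge0.
Qed.

Let iconv_has_inf k x : 0 <= k -> has_inf (iconv_set k x).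
Proof.
by move=> k0; split; [exists (f x + k * `|x - x|); exists x | exists l; exact: iconv_lb].
Qed.

Let iconv_le k x y : 0 <= k -> inf_convolution k x <= f y + k * `|x - y|.
Proof. by move=> k0; apply: ge_inf; [exists l; exact: iconv_lb | exists y]. Qed.

Lemma inf_convolution_le k x : 0 <= k -> inf_convolution k x <= f x.
Proof. by move=> k0; have := iconv_le x x k0; rewrite subrr normr0 mulr0 addr0. Qed.

Lemma inf_convolution_between k x : 0 <= k -> l <= inf_convolution k x <= u.
Proof.
move=> k0; have /andP[_ fu] := flu x.
rewrite (le_trans (inf_convolution_le x k0) fu) andbT.
by apply: lb_le_inf; [case: (iconv_has_inf x k0) | exact: iconv_lb].
Qed.

Lemma inf_convolution_lipschitz k : 0 <= k -> lipschitz_bound k (inf_convolution k).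
Proof.
move=> k0.
have h x y : inf_convolution k x - k * `|x - y| <= inf_convolution k y.
  apply: lb_le_inf; first by case: (iconv_has_inf y k0).
  move=> _ [z _ <-]; rewrite lerBlDr (le_trans (iconv_le x z k0))//.
  rewrite -addrA lerD2l -mulrDr ler_wpM2l// [leRHS]addrC.
  exact: ler_distD.
move=> x y; have := h y x; have := h x y; rewrite [`|y - x|]distrC => h1 h2.
by rewrite ler_norml; apply/andP; split; lra.
Qed.

(** Points near [x] have values close to [f x] by continuity; a point at distance at least [r] pays
    [k * r], which is at least [u - l] once [k] is large. *)
Lemma inf_convolution_cvg x (e : R) : 0 < e ->
  \forall k \near +oo, f x - e <= inf_convolution k x.
Proof.
move=> e0.
have [r r0 fr] := (continuous_rVP f x).1 (@cf x) e e0.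
near=> k.
have k0 : 0 <= k by near: k; exact: nbhs_pinfty_ge.
apply: lb_le_inf; first by case: (iconv_has_inf x k0).
move=> _ [y _ <-]; have [xy|xy] := ltP `|x - y| r.
  have := fr y xy; rewrite ler_norml => /andP[_ h].
  by have := mulr_ge0 k0 (normr_ge0 (x - y)); lra.
have /andP[ly _] := flu y; have /andP[_ fu] := flu x.
apply: (@le_trans _ _ u); first by rewrite (le_trans _ fu)// gerBl ltW.
rewrite -(subrKC l u) lerD//.
apply: (@le_trans _ _ (k * r)); last by rewrite ler_wpM2l.
by rewrite -ler_pdivrMr//; near: k; apply: nbhs_pinfty_ge; exact: num_real.
Unshelve. all: by end_near. Qed.

End inf_convolution.

(** A bounded continuous function need not be a uniform limit of Lipschitz functions; the discrete
    bound asks for an averaged distance, and dominated convergence supplies it. *)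
Lemma lipschitz_approximation (mu : probability V R) f (l u : R) x (e : R) :
  continuous f -> (forall x, l <= f x <= u) -> 0 < e ->
  exists L g, [/\ 0 <= L, lipschitz_bound L g, (forall x, l <= g x <= u) &
    \int[mu]_y `|f (x + y) - g (x + y)| < e].
Proof.
move=> cf flu e0; pose g n := inf_convolution f n%:R.
have cg n : continuous (g n).
  by apply: (lipschitz_bound_continuous (L := n%:R)); exact: (inf_convolution_lipschitz flu).
have bg n z : l <= g n z <= u by exact: (inf_convolution_between flu).
have bf := bdmeas_between (continuous_measurable_rV cf) flu.
have bgn n := bdmeas_between (continuous_measurable_rV (cg n)) (bg n).
have b n : bdmeas (fun y : V => `|f (x + y) - g n (x + y)|).
  by apply: bdmeas_norm; apply: bdmeasB; exact: bdmeas_shift.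
have h : \int[mu]_y `|f (x + y) - g n (x + y)| @[n --> \oo] --> (0 : R).
  apply: fine_cvg.
  have -> : (fine 0%E)%:E = (\int[mu]_y (cst 0%E y : \bar R))%E.
    by rewrite integral_cst//= mul0e.
  apply: (@dominated_cvg _ _ _ mu setT measurableT
    (fun n y => (`|f (x + y) - g n (x + y)|)%:E) (cst 0%E) (cst (u - l)%:E)) => //.
  - by move=> n; apply/measurable_EFinP; case: (b n).
  - move=> y _ /=; apply: cvg_EFin; first exact: nearW.
    apply/cvgr0Pnorm_le => e' e'0.
    have [K [_ hK]] := inf_convolution_cvg cf flu (x + y) e'0.
    near=> n; rewrite normr_id ger0_norm ?subr_ge0 ?(inf_convolution_le flu)//.
    rewrite lerBlDr -lerBlDl.
    by apply: hK; near: n; exact: nbhs_infty_gtr.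
  - by apply: bdmeas_integrable; exact: bdmeas_cst.
  - move=> n y _ /=; rewrite lee_fin normr_id ler_norml.
    have /andP[? ?] := flu (x + y); have /andP[? ?] := bg n (x + y).
    by apply/andP; split; lra.
have /cvgrPdist_lt/(_ e e0)[N _ /(_ N (leqnn _))] := h.
rewrite sub0r normrN => hN; exists N%:R, (g N); split => //.
- exact: (inf_convolution_lipschitz flu).
- exact: le_lt_trans (ler_norm _) hN.
Unshelve. all: by end_near. Qed.

Lemma uniform_continuity_on_ball f (r e : R) : continuous f -> 0 < e ->
  exists2 s, 0 < s & forall z v : V, `|z| <= r -> `|v| <= s -> `|f (z + v) - f z| <= e.
Proof.
move=> cf e0.
have cK : compact [set x : V | `|x| <= r].
  apply: bounded_closed_compact.
    exists r; split; first exact: num_real.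
    by move=> M rM x /= xr; exact: le_trans xr (ltW rM).
  apply: (@closed_comp _ _ (fun x : V => `|x|) [set y | y <= r]).
    by move=> x _; exact: norm_continuous.
  exact: closed_le.
move/compact_near_coveringP : cK => /(_ R (0 : R)^'+
  (fun s z => forall v : V, `|v| <= s -> `|f (z + v) - f z| <= e) _) h.
have [|s /= s0 hs] := h.
  move=> z _.
  have [|q q0 fq] := (continuous_rVP f z).1 (cf z) (e / 2).
    by rewrite divr_gt0.
  (* One half of [q] is for moving the center, the other for the displacement [v]. *)
  exists (ball z (q / 2), [set s : R | 0 < s < q / 2]).
    split; first by apply: nbhsx_ballx; rewrite divr_gt0.
    exists (q / 2) => /=; first by rewrite divr_gt0.
    move=> s /=; rewrite sub0r normrN => sq s0; rewrite s0/=.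
    exact: le_lt_trans (ler_norm _) sq.
  move=> [y s] /= [zy /andP[s0 sq]] v vs.
  have {}zy : `|z - y| < q / 2 by move: zy; rewrite -ball_normE.
  have h1 : `|f z - f y| <= e / 2.
    by apply: fq; apply: (lt_trans zy); rewrite ltr_pdivrMr// ltr_pMr// ltr1n.
  have h2 : `|f z - f (y + v)| <= e / 2.
    apply: fq; rewrite [q]splitr opprD addrA (le_lt_trans (ler_normD _ _))//.
    by rewrite normrN ltr_leD// ltW// (le_lt_trans vs).
  rewrite [e]splitr; apply: (@le_trans _ _ (`|f z - f (y + v)| + `|f z - f y|)).
    rewrite [X in `|X|](_ : _ = - (f z - f (y + v)) + (f z - f y)); last by ring.
    by rewrite (le_trans (ler_normD _ _))// normrN.
  by rewrite lerD.
exists (s / 2); first by rewrite divr_gt0.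
move=> z v zr vs; apply: (hs (s / 2)) => //=.
  by rewrite sub0r normrN gtr0_norm ?divr_gt0// ltr_pdivrMr// ltr_pMr// ltr1n.
by rewrite divr_gt0.
Qed.

Lemma cutoff_tight (mu : probability V R) x (e : R) : 0 < e -> exists2 r : R, 0 < r &
  \int[mu]_y (1 - cutoff r (x + y)) < e.
Proof.
move=> e0.
have b n : bdmeas (fun y : V => 1 - cutoff n.+1%:R (x + y) : R).
  by apply: bdmeasB; [exact: bdmeas_cst | exact/bdmeas_shift/cutoff_bdmeas].
have h : \int[mu]_y (1 - cutoff n.+1%:R (x + y)) @[n --> \oo] --> (0 : R).
  apply: fine_cvg.
  have -> : (fine 0%E)%:E = (\int[mu]_y (cst 0%E y : \bar R))%E.
    by rewrite integral_cst//= mul0e.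
  apply: (@dominated_cvg _ _ _ mu setT measurableT
    (fun n y => (1 - cutoff n.+1%:R (x + y))%:E) (cst 0%E) (cst 1%E)) => //.
  - by move=> n; apply/measurable_EFinP; case: (b n).
  - move=> y _; apply: cvg_near_cst; near=> n; rewrite cutoff1 ?subrr//.
    rewrite (@le_trans _ _ n%:R)// ?ler_nat//.
    by near: n; exact: nbhs_infty_ger.
  - by apply: (bdmeas_integrable mu (f := cst 1)); exact: bdmeas_cst.
  - move=> n y _ /=; have c1 := cutoff_le1 n.+1%:R (x + y).
    by rewrite lee_fin ger0_norm ?subr_ge0// gerBl cutoff_ge0.
have /cvgrPdist_lt/(_ e e0)[N _ /(_ N (leqnn _))] := h.
rewrite sub0r normrN => hN; exists N.+1%:R => //.
exact: le_lt_trans (ler_norm _) hN.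
Unshelve. all: by end_near. Qed.

End approximation.

(** * A smooth partition of unity on a grid *)

Section partition_of_unity.
Context {R : realType} {d : nat}.
Local Notation V := 'rV[R]_d.

Lemma cutoff_mono (r r' : R) (y : V) : 0 < r' -> 2 * r' <= r ->
  cutoff r' y <= cutoff r y.
Proof.
move=> r'0 r'r; have [yr|yr] := leP `|y| (2 * r').
  rewrite (@cutoff1 _ _ r) ?cutoff_le1//; first by lra.
  exact: le_trans yr r'r.
by rewrite (@cutoff0 _ _ r')// cutoff_ge0.
Qed.

(** On a grid of mesh [s], the products of one-dimensional bumps, indexed by maps from coordinates
    to grid positions, sum to 1 on the support of [cutoff r]. The factor [cutoff r - cutoff r'] then
    removes the small and the large jumps. *)
Lemma partition_of_unity (r r' s : R) : 0 < r' -> 2 * r' <= r -> 0 < s ->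
  exists (K : finType) (w : K -> V -> R) (c : K -> V),
  [/\ forall i, smooth_compactly_supported (w i),
      forall i y, 0 <= w i y,
      forall y, \sum_i w i y = cutoff r y - cutoff r' y,
      forall i y, w i y != 0 -> `|y - c i| <= s &
      forall i, `|c i| <= 2 * r + s].
Proof.
move=> r'0 r'r s0; have r0 : 0 < r by lra.
(* In units of [s] the bumps start at [-N, ..., N - 1], and their sum is 1 from [1 - N] to [N];
   hence [N] has to be at least [2 * r / s + 1]. *)
pose N := (Num.truncn (2 * r / s)).+2.
have Nr : 2 * r / s + 1 <= N%:R.
  have -> : N%:R = (Num.truncn (2 * r / s)).+1%:R + 1 :> R by rewrite natr1.
  by rewrite lerD2r ltW// truncnS_gt.
pose a : R := - N%:R.
pose K : finType := {ffun 'I_d -> 'I_(N + N)}.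
pose b (j : nat) (t : R) := bump (a + j%:R) (a + j%:R + 1) (t / s).
pose psi (i : K) : V -> R := tensor (fun k => b (i k)).
pose w (i : K) y := (cutoff r y - cutoff r' y) * psi i y.
have b0 j t : 0 <= b j t by exact: bump_ge0.
have sb (q : R) (j : nat) : smooth1 (fun y => bump (-2) 1 (y / q) * b j y).
  move=> n; apply: smoothnM.
    have := smoothn_affine q^-1 0 (bump_smooth (-2) 1 n).
    by under eq_fun do rewrite addr0 mulrC.
  have := smoothn_affine s^-1 0 (bump_smooth (a + j%:R) (a + j%:R + 1) n).
  by under eq_fun do rewrite addr0 mulrC.
have cpsi (q : R) (i : K) : 0 < q ->
    smooth_compactly_supported (fun y => cutoff q y * psi i y).
  move=> q0; apply: (@smooth_compactly_supportedP _ _ _ (2 * q)); last first.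
    by move=> y yq; rewrite cutoff0// mul0r.
  rewrite (_ : (fun y => _) =
      tensor (fun k y => bump (-2) 1 (y / q) * b (i k) y)).
    by apply: tensor_smooth => k; exact: sb.
  by apply/funext => y; rewrite /cutoff /psi /tensor big_split.
have wK (i : K) : exists c : V, (forall y, w i y != 0 -> `|y - c| <= s) /\ `|c| <= 2 * r + s.
  (* A cell whose weight vanishes identically may lie far away; its center is set to 0 to keep the
     bound on the centers. *)
  have [[y0 wy0]|nw] := pselect (exists y, w i y != 0); last first.
    exists 0; split; last by rewrite normr0; lra.
    by move=> y wy; case: nw; exists y.
  (* In units of [s], the midpoint of the interval []a + j, a + j + 2[] outside which the bump of
     index [j] vanishes; the half-width is 1, that is [s] after scaling. *)
  pose c : V := \row_k (s * (a + (i k)%:R + 1)).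
  have hc y : w i y != 0 -> `|y - c| <= s.
    move=> wy; apply: norm_coord_le; first exact: ltW.
    move=> k; rewrite !mxE.
    have : b (i k) (y 0 k) != 0.
      apply: contraNneq wy => bk.
      by rewrite /w /psi /tensor (bigD1 k)//= bk mul0r mulr0.
    move=> bk; have : ~~ ((y 0 k / s <= a + (i k)%:R) || (a + (i k)%:R + 1 + 1 <= y 0 k / s)).
      by apply: contraNN bk => h; apply/eqP; apply: bump_out => //; lra.
    rewrite negb_or -!ltNge => /andP[]; rewrite ltr_pdivlMr// ltr_pdivrMr// => h1 h2.
    by rewrite ler_norml; apply/andP; split; lra.
  exists c; split => //; rewrite -[c](subrKC y0) (le_trans (ler_normD _ _))//.
  rewrite lerD ?[`|c - y0|]distrC ?hc//.
  rewrite leNgt; apply/negP => y0r; move: wy0.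
  rewrite /w !cutoff0 ?subrr ?mul0r ?eqxx//.
  by apply: le_lt_trans y0r; rewrite ler_pM2l//; lra.
have [c hc] := choice wK.
exists K, w, c; split.
- move=> i; rewrite (_ : w i = fun y => cutoff r y * psi i y - cutoff r' y * psi i y).
    by apply: smooth_compactly_supportedB; apply: cpsi.
  by apply/funext => y; rewrite /w mulrBl.
- move=> i y; rewrite mulr_ge0 ?subr_ge0 ?cutoff_mono//.
  by apply: prodr_ge0 => k _; exact: b0.
- move=> y; rewrite -big_distrr/=.
  have [yr|yr] := leP `|y| (2 * r); last first.
    rewrite !cutoff0// ?subrr ?mul0r//.
    by apply: le_lt_trans yr; rewrite ler_pM2l//; lra.
  rewrite (_ : \sum_(i : K) psi i y = 1) ?mulr1//.
  (* The sum over the cells factors into one telescoping sum of bumps per coordinate. *)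
  rewrite -(bigA_distr_bigA (fun (k : 'I_d) (j : 'I_(N + N)) => b j (y 0 k)))/=; apply: big1 => k _.
  rewrite /b bump_sum bump_in//.
  have := le_trans (norm_coord y k) yr; rewrite ler_norml => /andP[h1 h2].
  have q1 : y 0 k / s <= 2 * r / s by rewrite ler_pM2r ?invr_gt0.
  have q2 : - (2 * r / s) <= y 0 k / s by rewrite -mulNr ler_pM2r ?invr_gt0.
  by rewrite natrD /a; apply/andP; split; lra.
- by move=> i y; exact: (hc i).1.
- by move=> i; exact: (hc i).2.
Qed.

End partition_of_unity.

Lemma sum_option {R : nmodType} {K : finType} (F : option K -> R) :
  \sum_o F o = F None + \sum_i F (Some i).
Proof.
have E : enum {: option K} = None :: map Some (enum K).
  by rewrite [LHS]enumT [in RHS]enumT [in LHS]unlock.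
by rewrite -[LHS]big_enum E big_cons big_map big_enum.
Qed.

(** * Decomposition of one time step *)

Section one_step_decomposition.
Context {R : realType} {d : nat}.
Local Notation V := 'rV[R]_d.
Context {l u M : R} {phi dphi : R -> R}.
Context (ek : entropy_kernel l u M phi dphi).
Context (M0 : 0 <= M) (lu : l <= u) (mu : probability 'rV[R]_d R).
Context {K : finType} (w : K -> V -> R) (c : K -> V) (r r' s : R).
Context (bw : forall i, bdmeas (w i)) (w_ge0 : forall i y, 0 <= w i y).
Context (wE : forall y, \sum_i w i y = cutoff r y - cutoff r' y).
Context (r_gt0 : 0 < r) (r'_gt0 : 0 < r').
Context (s_ge0 : 0 <= s) (w_supp : forall i y, w i y != 0 -> `|y - c i| <= s).
Implicit Types (f g h k v : V -> R).
Local Notation A := (bregman phi dphi).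

(* A jump [y] receives the label [Some i] with probability [w i y]; the label
   [None] gathers the jumps that are too small or too large. *)
Definition weight (o : option K) : V -> R :=
  if o is Some i then w i else fun y => 1 - (cutoff r y - cutoff r' y).

Definition weight_mass o := \int[mu]_y weight o y.

(** A label of mass 0 gets the identity as default value: every label then has a Markov operator
    that keeps Lipschitz constants, and its product with [weight_mass o] is the weighted convolution
    in all cases. *)
Definition weight_op o : (V -> R) -> V -> R :=
  if weight_mass o == 0 then id
  else wconv mu (fun y => (weight_mass o)^-1 * weight o y).

Local Notation p := weight_mass.
Local Notation Q := weight_op.

Lemma weight_bdmeas o : bdmeas (weight o).
Proof.
case: o => [i|]; first exact: bw.
by apply: bdmeasB; [exact: bdmeas_cst | apply: bdmeasB; exact: cutoff_bdmeas].
Qed.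

Lemma weight_ge0 o y : 0 <= weight o y.
Proof.
case: o => [i|] /=; first exact: w_ge0.
by have := cutoff_le1 r y; have := cutoff_ge0 r' y; lra.
Qed.

Lemma weight_sum y : \sum_o weight o y = 1.
Proof. by rewrite sum_option /= wE subrK. Qed.

Lemma weight_mass_ge0 o : 0 <= p o.
Proof. by apply: Rintegral_ge0 => y _; exact: weight_ge0. Qed.

Lemma wconv_dist v f k (a : R) z : bdmeas v -> bdmeas f -> bdmeas k ->
  (forall y, 0 <= v y) -> \int[mu]_y v y = 1 ->
  (forall y, v y != 0 -> `|f (z + y) - a| <= k y) ->
  `|wconv mu v f z - a| <= \int[mu]_y (v y * k y).
Proof.
move=> bv bf bk v0 v1 h.
have bfz : bdmeas (fun y : V => f (z + y)) by exact: bdmeas_shift.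
have bfa : bdmeas (fun y : V => f (z + y) - a).
  by apply: bdmeasB => //; exact: bdmeas_cst.
have -> : wconv mu v f z - a = \int[mu]_y (v y * (f (z + y) - a)).
  rewrite -[X in _ - X = _]mul1r -v1 -RintegralZr//; last exact: bdmeas_integrable.
  rewrite -RintegralB//; last 2 first.
  - by apply: bdmeas_integrable; exact: bdmeasM.
  - by apply: bdmeas_integrable; apply: bdmeasM => //; exact: bdmeas_cst.
  by apply: eq_Rintegral => y _; rewrite mulrBr.
apply: (le_trans (le_normr_Rintegral _ _)) => //.
  by apply: bdmeas_integrable; exact: bdmeasM.
apply: prob_Rintegral_le.
- by apply: bdmeas_norm; exact: bdmeasM.
- exact: bdmeasM.
- move=> y; rewrite normrM ger0_norm//.
  have [->|vy] := eqVneq (v y) 0; first by rewrite !mul0r.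
  by rewrite ler_wpM2l// h.
Qed.

Lemma wconv_mass0 v f z : bdmeas v -> bdmeas f -> (forall y, 0 <= v y) ->
  \int[mu]_y v y = 0 -> wconv mu v f z = 0.
Proof.
move=> bv bf v0 v1; have [mf [B fB]] := bf.
apply/normr0_eq0/eqP; rewrite eq_le normr_ge0 andbT.
apply: (le_trans (le_normr_Rintegral _ _)) => //.
  by apply: bdmeas_integrable; apply: bdmeasM => //; exact: bdmeas_shift.
rewrite -[leRHS](mul0r B) -v1 -RintegralZr//; last exact: bdmeas_integrable.
apply: prob_Rintegral_le.
- by apply: bdmeas_norm; apply: bdmeasM => //; exact: bdmeas_shift.
- by apply: bdmeasM => //; exact: bdmeas_cst.
- by move=> y; rewrite normrM ger0_norm// ler_wpM2l.
Qed.

Let nweight o := fun y => (p o)^-1 * weight o y.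

Let nweight_bdmeas o : bdmeas (nweight o).
Proof. by apply: bdmeasZ; exact: weight_bdmeas. Qed.

Let nweight_ge0 o y : 0 <= nweight o y.
Proof. by rewrite mulr_ge0 ?weight_ge0// invr_ge0 weight_mass_ge0. Qed.

Let nweight_mass o : p o != 0 -> \int[mu]_y nweight o y = 1.
Proof.
move=> po; rewrite RintegralZl ?mulVf//.
by apply: bdmeas_integrable; exact: weight_bdmeas.
Qed.

Lemma weight_op_markov o : markov (Q o).
Proof.
rewrite /Q; case: ifPn => [_|po]; first by split.
exact: (markov_wconv (nweight_bdmeas o) (@nweight_ge0 o) (nweight_mass po)).
Qed.

Lemma weight_opC o o' f : bdmeas f -> Q o (Q o' f) = Q o' (Q o f).
Proof.
move=> bf; rewrite /Q; case: ifPn => // _; case: ifPn => // _.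
exact: (wconvC mu mu (nweight_bdmeas o) (nweight_bdmeas o')).
Qed.

Lemma weight_opE o f z : bdmeas f -> p o * Q o f z = wconv mu (weight o) f z.
Proof.
move=> bf; rewrite /Q; case: ifPn => [/eqP po|po].
  rewrite po mul0r wconv_mass0//; [exact: weight_bdmeas | exact: weight_ge0].
by rewrite wconvZl ?mulrA ?divff ?mul1r//; exact: weight_bdmeas.
Qed.

Lemma weight_mass_sum : \sum_o p o = 1.
Proof.
have := wconv_suml mu (0 : V) weight_bdmeas (bdmeas_cst 1).
rewrite {1}/wconv; under eq_Rintegral do rewrite weight_sum mulr1.
rewrite prob_Rintegral_cst => ->; apply: eq_bigr => o _.
by rewrite /wconv; apply: eq_Rintegral => y _; rewrite mulr1.
Qed.

Lemma mix_weight_op f : bdmeas f -> mix p Q f = wconv mu (fun=> 1) f.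
Proof.
move=> bf; apply/funext => z; rewrite /mix.
under eq_bigr do rewrite weight_opE//.
rewrite -wconv_suml//; last exact: weight_bdmeas.
by congr (wconv mu _ f z); apply/funext => y; exact: weight_sum.
Qed.

Lemma iter_mix_weight_op n f : bdmeas f ->
  iter n (mix p Q) f = iter n (wconv mu (fun=> 1)) f.
Proof.
move=> bf; have mT : markov (wconv mu (fun=> 1)).
  by apply: markov_wconv => //; [exact: bdmeas_cst | exact: prob_Rintegral_cst].
elim: n => //= n ->; rewrite mix_weight_op//.
exact: (markov_bdmeas (markov_iter n mT)).
Qed.

(** The same variational principle as in [entropy_one_step]: the gap is [A a (S g z) >= 0], so the
    reference point [a] can be chosen at will. *)
Lemma entropy_le_bregman (S : (V -> R) -> V -> R) g (a : R) z : markov S ->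
  ranged (l := l) (u := u) g -> l <= a <= u ->
  S (fun y => phi (g y)) z - phi (S g z) <= S (fun y => A a (g y)) z.
Proof.
move=> mS rg ha; have bg := ranged_bdmeas rg; have bpg := ek_bdmeas ek rg.
have ba : bdmeas (fun _ : V => a) by exact: bdmeas_cst.
have -> : S (fun y => A a (g y)) z =
    S (fun y => phi (g y)) z - phi a - dphi a * (S g z - a).
  rewrite /bregman (markovB _ mS).
  - rewrite (markovB _ mS) ?(markov_cst _ _ mS)//; last exact: bdmeas_cst.
    rewrite (markovZ mS); last by apply: bdmeasB => //; exact: bdmeas_cst.
    by rewrite (markovB _ mS) ?(markov_cst _ _ mS)//; exact: bdmeas_cst.
  - by apply: bdmeasB => //; exact: bdmeas_cst.
  - by apply: bdmeasZ; apply: bdmeasB => //; exact: bdmeas_cst.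
have [_ rS] := markov_ranged mS rg.
by have := ek_ge0 ek ha (rS z); rewrite /bregman; lra.
Qed.

Lemma weight_mass_some : \sum_i p (Some i) = \int[mu]_y (cutoff r y - cutoff r' y).
Proof.
have bchi : bdmeas (fun y : V => cutoff r y - cutoff r' y).
  by apply: bdmeasB; exact: cutoff_bdmeas.
have pN : p None = 1 - \int[mu]_y (cutoff r y - cutoff r' y).
  rewrite -[X in X - _](prob_Rintegral_cst mu) -RintegralB//.
    by apply: bdmeas_integrable; exact: bdmeas_cst.
  exact: bdmeas_integrable.
by have := weight_mass_sum; rewrite sum_option pN; lra.
Qed.

(** The three summands bound the entropy inside the label classes due to the jumps beyond [r], to
    the jumps within [2 * r'], and to the extent [s] of a cell. *)
Definition step_error (L : R) : R :=
  M * (u - l) ^+ 2 * \int[mu]_y (1 - cutoff r y) +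
  M * L ^+ 2 * \sum_(j < d) \int[mu]_y (y 0 j ^+ 2 * cutoff r' y) +
  M * L ^+ 2 * s ^+ 2 * \int[mu]_y (cutoff r y - cutoff r' y).

Let bsqr j : bdmeas (fun y : V => y 0 j ^+ 2 * cutoff r' y).
Proof. exact/smooth_compactly_supported_bdmeas/sqr_cutoff_compact. Qed.

Let quad a b : l <= a <= u -> l <= b <= u -> A a b <= M * `|a - b| ^+ 2.
Proof.
by move=> ha hb; rewrite distrC real_normK ?num_real//; exact: (ek_quad ek).
Qed.

Let quad_ul a b : l <= a <= u -> l <= b <= u -> A a b <= M * (u - l) ^+ 2.
Proof.
move=> ha hb; apply: (le_trans (quad ha hb)); rewrite ler_wpM2l//.
rewrite lerXn2r ?nnegrE ?subr_ge0// ler_norml.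
by move: ha hb => /andP[? ?] /andP[? ?]; apply/andP; split; lra.
Qed.

Lemma norm_sqr_le (y : V) : `|y| ^+ 2 <= \sum_j y 0 j ^+ 2.
Proof.
have [y0|y0] := eqVneq `|y| 0.
  by rewrite y0 expr0n/= sumr_ge0// => j _; exact: sqr_ge0.
have [[i j] h] := mx_norm_neq0 y0.
have -> : `|y| = `|y 0 j| by rewrite -[0 in RHS](ord1 i).
by rewrite real_normK ?num_real// (bigD1 j)//= lerDl sumr_ge0// => k _; exact: sqr_ge0.
Qed.

(** The reference point is [g z] for the label [None] and [g (z + c i)] for [Some i]. The weight of
    [None] splits into [1 - cutoff r], where the range of [g] bounds the divergence, and
    [cutoff r'], where the Lipschitz bound gives squared jumps. *)
Lemma step_error_bound L g z : 0 <= L -> lipschitz_bound L g ->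
  ranged (l := l) (u := u) g ->
  mix p Q (fun y => phi (g y)) z - \sum_o p o * phi (Q o g z) <= step_error L.
Proof.
move=> L0 Lg rg; have [_ lgu] := rg; have bpg := ek_bdmeas ek rg.
rewrite /mix -sumrB sum_option.
have term o a : l <= a <= u ->
    p o * Q o (fun y => phi (g y)) z - p o * phi (Q o g z) <=
    \int[mu]_y (weight o y * A a (g (z + y))).
  move=> ha; rewrite -mulrBr.
  have bA : bdmeas (fun y => A a (g y)).
    by apply: (bregman_bdmeas ek (f := fun=> a)) => //; split.
  rewrite -[leRHS]/(wconv mu (weight o) (fun y => A a (g y)) z) -weight_opE//.
  rewrite ler_wpM2l ?weight_mass_ge0//; apply: entropy_le_bregman => //.
  exact: weight_op_markov.
have bAz a : l <= a <= u -> bdmeas (fun y : V => A a (g (z + y))).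
  move=> ha; apply: (bdmeas_shift z (f := fun y => A a (g y))).
  by apply: (bregman_bdmeas ek (f := fun=> a)) => //; split.
have bcut : bdmeas (fun y : V => 1 - cutoff r y).
  by apply: bdmeasB; [exact: bdmeas_cst | exact: cutoff_bdmeas].
have bchi : bdmeas (fun y : V => cutoff r y - cutoff r' y).
  by apply: bdmeasB; exact: cutoff_bdmeas.
rewrite lerD//.
- apply: (le_trans (term None (g z) (lgu z))).
  have bS : bdmeas (fun y : V => \sum_(j < d) y 0 j ^+ 2 * cutoff r' y).
    exact: bdmeas_sum.
  have -> : \sum_(j < d) \int[mu]_y (y 0 j ^+ 2 * cutoff r' y) =
      \int[mu]_y (\sum_(j < d) y 0 j ^+ 2 * cutoff r' y).
    transitivity (\sum_(j < d) wconv mu (fun y => y 0 j ^+ 2 * cutoff r' y) (fun=> 1) 0).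
      by apply: eq_bigr => j _; apply: eq_Rintegral => y _; rewrite mulr1.
    rewrite -wconv_suml//; last exact: bdmeas_cst.
    by apply: eq_Rintegral => y _; rewrite mulr1.
  rewrite -!RintegralZl//; try exact: bdmeas_integrable.
  rewrite -RintegralD//; try by apply: bdmeas_integrable; exact: bdmeasZ.
  apply: prob_Rintegral_le.
  + by apply: bdmeasM; [exact: weight_bdmeas | exact/bAz/lgu].
  + by apply: bdmeasD; exact: bdmeasZ.
  move=> y /=.
  have h1 := quad_ul (lgu z) (lgu (z + y)).
  have h2 : A (g z) (g (z + y)) <= M * L ^+ 2 * \sum_j y 0 j ^+ 2.
    apply: (le_trans (quad (lgu z) (lgu (z + y)))); rewrite -mulrA ler_wpM2l//.
    apply: (@le_trans _ _ ((L * `|y|) ^+ 2)).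
      rewrite lerXn2r ?nnegrE// ?mulr_ge0//.
      by have := Lg z (z + y); rewrite opprD addNKr normrN.
    by rewrite exprMn ler_wpM2l ?sqr_ge0// norm_sqr_le.
  have c1 : 0 <= 1 - cutoff r y by rewrite subr_ge0 cutoff_le1.
  have c2 := cutoff_ge0 r' y.
  rewrite -mulr_suml mulrA opprB addrCA addrC mulrDl.
  by rewrite lerD// 1?mulrC ?ler_wpM2r// ?[cutoff _ _ * _]mulrC ?ler_wpM2l.
- rewrite -weight_mass_some big_distrr/=; apply: ler_sum => i _.
  apply: (le_trans (term (Some i) _ (lgu (z + c i)))).
  rewrite [leRHS]mulrC /weight_mass -RintegralZr//; last exact/bdmeas_integrable/(weight_bdmeas (Some i)).
  apply: prob_Rintegral_le.
  + by apply: bdmeasM; [exact: bw | exact/bAz/lgu].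
  + by apply: bdmeasM; [exact: (weight_bdmeas (Some i)) | exact: bdmeas_cst].
  move=> y /=; have [->|wy] := eqVneq (w i y) 0; first by rewrite !mul0r.
  rewrite ler_wpM2l//.
  apply: (le_trans (quad (lgu (z + c i)) (lgu (z + y)))).
  rewrite -mulrA ler_wpM2l// -exprMn lerXn2r ?nnegrE ?mulr_ge0//.
  apply: (le_trans (Lg _ _)); rewrite ler_wpM2l//.
  by rewrite opprD addrACA subrr add0r distrC w_supp.
Qed.

(** * Comparison of a labelled jump with the translation by the center of its cell *)

Context (eta q rho B : R) (f : V -> R) (rf : ranged (l := l) (u := u) f).
Context (eta_ge0 : 0 <= eta) (q_gt0 : 0 < q) (q_le1 : q <= 1) (s_le : s <= q).
Context (rho_gt0 : 0 < rho) (c_bound : forall i, 2 * (2 * rho + 1) + `|c i| <= B).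
Context (f_unif : forall z v : V, `|z| <= B -> `|v| <= q -> `|f (z + v) - f z| <= eta).

Local Notation rho1 := (2 * rho + 1).

(** A majorant of the probability that a jump labelled [None] exceeds [q], since that label also
    carries the large jumps. The indicator is replaced by a function whose mass under small-time
    laws is controlled by the generator. *)
Definition large_jump_mass : R := (p None)^-1 * \int[mu]_y (1 - cutoff (q / 2) y).

Let bkappa : bdmeas (fun y : V => 1 - cutoff (q / 2) y : R).
Proof. by apply: bdmeasB; [exact: bdmeas_cst | exact: cutoff_bdmeas]. Qed.

Let kappa_ge0 (y : V) : 0 <= 1 - cutoff (q / 2) y :> R.
Proof. by rewrite subr_ge0 cutoff_le1. Qed.

Let kappa1 (y : V) : q < `|y| -> 1 - cutoff (q / 2) y = 1 :> R.
Proof.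
move=> qy; rewrite cutoff0 ?subr0//; first by rewrite divr_gt0.
by rewrite mulrC divfK ?pnatr_eq0.
Qed.

Context (p0 : 0 < p None).

Let QNone : Q None = wconv mu (nweight None).
Proof. by rewrite /Q gt_eqF. Qed.

Let kappa_mass : \int[mu]_y (nweight None y * (1 - cutoff (q / 2) y)) <= large_jump_mass.
Proof.
rewrite /large_jump_mass -RintegralZl//; last exact: bdmeas_integrable.
apply: prob_Rintegral_le.
- exact: bdmeasM.
- exact: bdmeasZ.
- move=> y; rewrite ler_wpM2r// -[leRHS]mulr1 ler_wpM2l ?invr_ge0 ?weight_mass_ge0//.
  by rewrite -(weight_sum y) sum_option lerDl sumr_ge0// => i _; exact: weight_ge0.
Qed.

Lemma large_jump_mass_ge0 : 0 <= large_jump_mass.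
Proof. by rewrite mulr_ge0 ?invr_ge0 ?weight_mass_ge0//; apply: Rintegral_ge0. Qed.

Let tail n z := iter n (mix p Q) (fun y => 1 - cutoff rho y) z.

Let mixM : markov (mix p Q).
Proof.
apply: markov_mix; [exact: weight_mass_ge0 | exact: weight_mass_sum |].
exact: weight_op_markov.
Qed.

(* The last step is made with a small jump, which costs a factor (p None)^-1. *)
Lemma iter_small_jump n h z : bdmeas h -> (forall y, 0 <= h y) ->
  iter n (mix p Q) (Q None h) z <= (p None)^-1 * iter n.+1 (mix p Q) h z.
Proof.
move=> bh h0; have mn := markov_iter n mixM.
have bQ o : bdmeas (Q o h) := markov_bdmeas (weight_op_markov o) bh.
rewrite ler_pdivlMl// iterSr -(markovZ mn)//.
apply: (markov_le mn); [exact: bdmeasZ | exact: (markov_bdmeas mixM) |].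
move=> y; rewrite /mix sum_option lerDl sumr_ge0// => i _.
rewrite mulr_ge0 ?weight_mass_ge0// -(markov_cst 0 y (weight_op_markov (Some i))).
by apply: (markov_le (weight_op_markov (Some i))) => //; exact: bdmeas_cst.
Qed.

Let btail (a : R) : bdmeas (fun y : V => 1 - cutoff a y : R).
Proof. by apply: bdmeasB; [exact: bdmeas_cst | exact: cutoff_bdmeas]. Qed.

(** The energy is evaluated after [n] steps, whereas the law known independently of [n] is that of
    all [n.+1] steps. A point outside the ball of radius [2 * rho + 1] stays outside that of radius
    [2 * rho] after a jump of size at most [q <= 1], so the earlier tail is bounded by the later
    one. *)
Lemma iter_tail n z :
  iter n (mix p Q) (fun y => 1 - cutoff rho1 y) z <=
  (p None)^-1 * tail n.+1 z + large_jump_mass.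
Proof.
have mn := markov_iter n mixM.
have mQ := weight_op_markov None.
apply: (@le_trans _ _ (iter n (mix p Q)
   (fun y => Q None (fun y => 1 - cutoff rho y) y + large_jump_mass) z)); last first.
  rewrite (markovD mn)//; [|exact: (markov_bdmeas mQ) | exact: bdmeas_cst].
  rewrite (markov_cst _ _ mn) lerD2r; apply: iter_small_jump => //.
  by move=> y; rewrite subr_ge0 cutoff_le1.
apply: (markov_le mn) => //.
  by apply: bdmeasD; [exact: (markov_bdmeas mQ) | exact: bdmeas_cst].
move=> y; rewrite -lerBlDr.
apply: (@le_trans _ _ (1 - cutoff rho1 y - \int[mu]_v (nweight None v * (1 - cutoff (q / 2) v)))).
  by rewrite lerD2l lerN2.
rewrite QNone /wconv lerBlDr -RintegralD//; last 2 first.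
- exact/bdmeas_integrable/(bdmeasM (nweight_bdmeas None) (bdmeas_shift y (btail rho))).
- exact/bdmeas_integrable/(bdmeasM (nweight_bdmeas None) bkappa).
rewrite -[leLHS]mul1r -[X in X * _ <= _](nweight_mass (o := None)) ?gt_eqF// -RintegralZr//; last first.
  exact: bdmeas_integrable.
apply: prob_Rintegral_le.
- exact: (bdmeasM (nweight_bdmeas None) (bdmeas_cst _)).
- exact: (bdmeasD (bdmeasM (nweight_bdmeas None) (bdmeas_shift y (btail rho)))
    (bdmeasM (nweight_bdmeas None) bkappa)).
move=> v; rewrite -mulrDr ler_wpM2l//.
have c1 := cutoff_le1 rho (y + v); have c0 := cutoff_ge0 rho1 y.
have c2 := kappa_ge0 v.
have rho10 : 0 < rho1 by rewrite addr_gt0// mulr_gt0.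
have [yr|yr] := leP `|y| rho1; first by rewrite (cutoff1 (r := rho1))//; lra.
have [vq|vq] := leP `|v| q; last by rewrite (kappa1 vq); lra.
have yv : 2 * rho < `|y + v|.
  have := ler_normD (y + v) (- v); rewrite addrK normrN => yv.
  have := lt_le_trans yr yv; have := le_trans vq q_le1; lra.
by rewrite (cutoff0 (r := rho))//; lra.
Qed.

(** Both values are near [f (z + c i)]: the jumps of the cell lie within [s <= q] of [c i], and
    those labelled [None] lie within [q] of 0 up to [large_jump_mass]. *)
Lemma weight_op_dist i z : p (Some i) != 0 ->
  `|Q (Some i) f z - Q None (fun y => f (y + c i)) z| <=
  2 * eta + (u - l) * (large_jump_mass + (1 - cutoff rho1 z)).
Proof.
move=> pi; have [mf flu] := rf; have bf := ranged_bdmeas rf.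
have ul0 : 0 <= u - l by rewrite subr_ge0.
have S0 := large_jump_mass_ge0; have e0 := eta_ge0.
(* Outside this ball no modulus of continuity is at hand; there [cutoff rho1] is 0 and the trivial
   bound [u - l] is enough. *)
have [zr|zr] := leP `|z| (2 * rho1); last first.
  have rho10 : 0 < rho1 by rewrite addr_gt0// mulr_gt0.
  rewrite (cutoff0 (r := rho1))//.
  have m1 := weight_op_markov (Some i); have m0 := weight_op_markov None.
  have /andP[a1 a2] := markov_between z m1 mf flu.
  have bfc : measurable_fun setT (fun y : V => f (y + c i)).
    by case: (bdmeas_shiftr (c i) bf).
  have /andP[b1 b2] := markov_between z m0 bfc (fun y => flu (y + c i)).
  have h : 0 <= (u - l) * large_jump_mass by exact: mulr_ge0.
  by rewrite ler_norml; apply/andP; split; lra.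
have zB : `|z + c i| <= B.
  by apply: le_trans (c_bound i); rewrite (le_trans (ler_normD _ _))// lerD2r.
have h1 : `|Q (Some i) f z - f (z + c i)| <= eta.
  rewrite /Q (negbTE pi).
  have -> : eta = \int[mu]_y (nweight (Some i) y * eta).
    rewrite RintegralZr ?nweight_mass ?mul1r//; exact: bdmeas_integrable.
  apply: (wconv_dist (nweight_bdmeas (Some i)) bf (bdmeas_cst eta)
    (@nweight_ge0 (Some i)) (nweight_mass pi)).
  move=> y; rewrite mulf_eq0 negb_or => /andP[_ wy].
  have := f_unif (v := y - c i) zB; rewrite addrA [z + c i + y]addrAC addrK; apply.
  exact: le_trans (w_supp wy) s_le.
have h2 : `|Q None (fun y => f (y + c i)) z - f (z + c i)| <= eta + (u - l) * large_jump_mass.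
  rewrite QNone.
  apply: (@le_trans _ _ (\int[mu]_y (nweight None y * (eta + (u - l) * (1 - cutoff (q / 2) y))))).
    apply: (wconv_dist (nweight_bdmeas None) (bdmeas_shiftr (c i) bf)
      (bdmeasD (bdmeas_cst eta) (bdmeasZ (u - l) bkappa)) (@nweight_ge0 None)
      (nweight_mass (lt0r_neq0 p0))).
    move=> y _; have [yq|yq] := leP `|y| q.
      rewrite addrAC (le_trans (f_unif zB yq))// lerDl mulr_ge0//.
    rewrite kappa1// mulr1 ler_norml.
    have /andP[? ?] := flu (z + y + c i); have /andP[? ?] := flu (z + c i).
    by apply/andP; split; lra.
  under eq_Rintegral do rewrite mulrDr mulrCA.
  rewrite RintegralD//; last 2 first.
  - by apply: bdmeas_integrable; apply: bdmeasM => //; exact: bdmeas_cst.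
  - by apply: bdmeas_integrable; apply: bdmeasZ; exact: bdmeasM.
  rewrite RintegralZr//; last exact: bdmeas_integrable.
  rewrite nweight_mass ?gt_eqF// mul1r lerD2l RintegralZl//.
    by rewrite ler_wpM2l.
  by apply: bdmeas_integrable; exact: bdmeasM.
have c1 : 0 <= (u - l) * (1 - cutoff rho1 z) by rewrite mulr_ge0// subr_ge0 cutoff_le1.
have := ler_distD (f (z + c i)) (Q (Some i) f z) (Q None (fun y => f (y + c i)) z).
by rewrite [`|f (z + c i) - _|]distrC; lra.
Qed.

Definition shifted_bregman i z := A (f z) (f (z + c i)).

(** [large_jump_mass] counts twice, once from [weight_op_dist] and once from [iter_tail]. *)
Definition jump_bound n x i := (p None)^-1 * iter n.+1 (mix p Q) (shifted_bregman i) x +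
  (M + M) * (2 * eta + (u - l) *
    (2 * large_jump_mass + (p None)^-1 * tail n.+1 x)).

Let rfc i : ranged (l := l) (u := u) (fun y : V => f (y + c i)).
Proof.
split; last by move=> y; exact: rf.2.
by case: (bdmeas_shiftr (c i) (ranged_bdmeas rf)).
Qed.

(** [Q (Some i) f] is replaced by [Q None] of the translate by [c i], the divergence being Lipschitz
    in its second argument. Jensen for [Q None] then yields [Q None (shifted_bregman i)], and
    [iter_small_jump] turns this operator into the missing step. *)
Lemma iter_jump_energy n x :
  iter n (mix p Q) (jump_energy (phi := phi) (dphi := dphi) None p Q f) x <=
  \sum_i p (Some i) * jump_bound n x i.
Proof.
have mn := markov_iter n mixM; have ul0 : 0 <= u - l by rewrite subr_ge0.
have rQ o := markov_ranged (weight_op_markov o) rf.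
have bA o : bdmeas (fun z => A (Q None f z) (Q o f z)) by exact: (bregman_bdmeas ek).
have /= -> := markov_sum (P := xpredT) x mn (fun o _ => bdmeasZ (p o) (bA o)).
rewrite sum_option /=.
have -> : iter n (mix p Q) (fun z => p None * A (Q None f z) (Q None f z)) x = 0.
  rewrite -[RHS](markov_cst 0 x mn); congr (iter n (mix p Q) _ x).
  by apply/funext => z; rewrite bregmanxx mulr0.
rewrite add0r; apply: ler_sum => i _; rewrite (markovZ mn)//.
have [->|pi] := eqVneq (p (Some i)) 0; first by rewrite !mul0r.
rewrite ler_wpM2l ?weight_mass_ge0//.
have bsh : bdmeas (shifted_bregman i) by exact: (bregman_bdmeas ek).
have bE : bdmeas (fun z : V => 2 * eta + (u - l) * (large_jump_mass + (1 - cutoff rho1 z))).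
  exact: (bdmeasD (bdmeas_cst _) (bdmeasZ (u - l) (bdmeasD (bdmeas_cst _) (btail rho1)))).
have bQs : bdmeas (Q None (shifted_bregman i)).
  exact: (markov_bdmeas (weight_op_markov None)).
apply: (@le_trans _ _ (iter n (mix p Q) (fun z => Q None (shifted_bregman i) z +
    (M + M) * (2 * eta + (u - l) * (large_jump_mass + (1 - cutoff rho1 z)))) x)).
  apply: (markov_le mn) => //; first by apply: bdmeasD => //; exact: bdmeasZ.
  move=> z.
  have j := jensen_bregman ek z (weight_op_markov None) rf (rfc i).
  have rc := (markov_ranged (weight_op_markov None) (rfc i)).2 z.
  have li := bregman_lip2 ek ((rQ None).2 z) ((rQ (Some i)).2 z) rc.
  have wd := ler_wpM2l (addr_ge0 M0 M0) (weight_op_dist z pi).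
  rewrite -lerBlDl; apply: le_trans wd; apply: le_trans li.
  by rewrite lerD2l lerN2.
rewrite (markovD mn)//; last exact: bdmeasZ.
rewrite lerD//.
  apply: iter_small_jump => // y; apply: (ek_ge0 ek); exact: rf.2.
rewrite (markovZ mn)// ler_wpM2l ?addr_ge0//.
have b1 := btail rho1.
rewrite (markovD mn)//; [|exact: bdmeas_cst|]; last first.
  by apply: bdmeasZ; apply: bdmeasD => //; exact: bdmeas_cst.
rewrite (markov_cst _ _ mn) lerD2l (markovZ mn); last first.
  by apply: bdmeasD => //; exact: bdmeas_cst.
rewrite ler_wpM2l// (markovD mn)//; last exact: bdmeas_cst.
rewrite (markov_cst _ _ mn); have := iter_tail n x; lra.
Qed.

Lemma discretized_entropy_bound (L : R) g n x : 0 <= L -> lipschitz_bound L g ->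
  ranged (l := l) (u := u) g ->
  iter n.+1 (mix p Q) (fun y => phi (f y)) x - phi (iter n.+1 (mix p Q) f x) <=
  (M + M) * iter n.+1 (mix p Q) (fun z => `|f z - g z|) x +
  n.+1%:R * step_error L + \sum_i n.+1%:R * p (Some i) * jump_bound n x i.
Proof.
move=> L0 Lg rg.
apply: (le_trans (discrete_entropy_bound ek None weight_mass_ge0 weight_mass_sum
  weight_op_markov weight_opC n x M0
  (L := fun g => lipschitz_bound L g /\ ranged (l := l) (u := u) g) (c := step_error L)
  _ _ _ rf (conj Lg rg))).
- by move=> h [].
- move=> h o [Lh rh]; split; last exact: (markov_ranged (weight_op_markov o)).
  rewrite /Q; case: ifPn => // po.
  exact: (wconv_lipschitz (nweight_bdmeas o) (ranged_bdmeas rh) (@nweight_ge0 o)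
    (nweight_mass po) Lh).
- by move=> h z [Lh rh]; exact: step_error_bound.
rewrite lerD2l; under eq_bigr do rewrite -mulrA.
by rewrite -big_distrr/= ler_wpM2l// iter_jump_energy.
Qed.

End one_step_decomposition.

Lemma cvg_sumr {R : realType} {I : finType} (u : nat -> I -> R) (a : I -> R) :
  (forall i, u n i @[n --> \oo] --> a i) ->
  \sum_i u n i @[n --> \oo] --> \sum_i a i.
Proof.
move=> ua; elim: (index_enum I) => [|i s IHs].
  by under eq_fun do rewrite big_nil; rewrite big_nil; exact: cvg_cst.
by under eq_fun do rewrite big_cons; rewrite big_cons; exact: cvgD.
Qed.

(** * Passing to continuous time *)

Section continuous_time_limit.
Context {R : realType} {d : nat} {dO : measure_display}.
Context {Omega : measurableType dO} {P : probability Omega R}.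
Local Notation V := 'rV[R]_d.
Context (X : R -> {RV P >-> 'rV[R]_d}) (lambda : R) (theta : V).
Context (nu : {measure set 'rV[R]_d -> \bar R}) (levy_nu : levy_measure nu).
Context (levyX : levy_process X).
Context (genX : has_generator X (levy_operator lambda theta nu)).
Context (lambda_gt0 : 0 < lambda) (t : R) (t_gt0 : 0 < t) (x : V).
Context {l u M : R} {phi dphi : R -> R} (ek : entropy_kernel l u M phi dphi).
Context (M0 : 0 <= M) (lu : l <= u).
Context (f : V -> R) (cf : continuous f) (flu : forall x, l <= f x <= u).
Local Notation A := (bregman phi dphi).

Let S : (V -> R) -> V -> R := wconv (levy_law X t) (fun=> 1).
Let mun n := levy_law X (t / n.+1%:R).

Let mS : markov S.
Proof. by apply: markov_wconv => //; [exact: bdmeas_cst | exact: prob_Rintegral_cst]. Qed.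

Let rf : ranged (l := l) (u := u) f.
Proof. by split => //; exact: continuous_measurable_rV. Qed.

Let glim F (C : R) : smooth_compactly_supported F -> F 0 = 0 ->
  (forall y, `|F y| <= C * Num.min 1 (sqnorm y)) ->
  n.+1%:R * \int[mun n]_y F y @[n --> \oo] --> t * lambda * \int[nu]_y F y.
Proof.
move=> cF F0 FC.
have h : forall y, `|F y - F 0| <= C * Num.min 1 (sqnorm y) by move=> y; rewrite F0 subr0.
have := @generator_limitn _ _ _ _ _ _ _ _ _ genX F C t t_gt0 cF h.
rewrite F0; under eq_fun do rewrite subr0.
by under [in X in _ -> X]eq_Rintegral do rewrite -[F _]subr0.
Qed.

(** [1 - cutoff r] is not compactly supported; its limit is that of [cutoff r] with the sign
    changed, since every law has mass 1. *)
Let glim_tail r : 0 < r ->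
  n.+1%:R * \int[mun n]_y (1 - cutoff r y) @[n --> \oo] -->
  t * lambda * \int[nu]_y (1 - cutoff r y).
Proof.
move=> r0.
have c0 : cutoff r (0 : V) = 1 by rewrite cutoff1// normr0 ltW.
have dom1 (y : V) : `|cutoff r y - 1| <= (1 + r ^- 2) * Num.min 1 (sqnorm y).
  apply: (@vanishing_near0_dominated _ _ r (fun y => cutoff r y - 1)) => //.
    rewrite distrC ger0_norm ?subr_ge0 ?cutoff_le1//.
    by rewrite gerBl cutoff_ge0.
  by move=> yr; rewrite /= cutoff1// subrr.
have dom (y : V) : `|cutoff r y - cutoff r (0 : V)| <= (1 + r ^- 2) * Num.min 1 (sqnorm y).
  by rewrite c0.
have bc : bdmeas (cutoff r : V -> R) by exact: cutoff_bdmeas.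
have intc : nu.-integrable setT (EFin \o (fun y : V => 1 - cutoff r y)).
  apply: (trunc_dominated_integrable levy_nu (C := 1 + r ^- 2)).
    by apply: measurable_funB => //; exact: cutoff_measurable.
  by move=> y; rewrite distrC.
have := @generator_limitn _ _ _ _ _ _ _ _ _ genX _ _ t t_gt0 (cutoff_compact r0) dom.
move=> /cvgN; rewrite c0.
have -> : - (t * lambda * \int[nu]_y (cutoff r y - 1)) =
    t * lambda * \int[nu]_y (1 - cutoff r y).
  rewrite -mulrN; congr (_ * _); rewrite -mulN1r -RintegralZl//.
    by apply: eq_Rintegral => y _; rewrite mulN1r opprB.
  rewrite (_ : _ \o _ = (fun y => (-1)%:E * (1 - cutoff r y)%:E)%E); first exact: integrableZl.
  by apply/funext => y /=; rewrite -EFinM mulN1r opprB.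
apply: cvg_trans; apply: near_eq_cvg; apply: nearW => n /=.
rewrite -mulrN opprB RintegralB//; last 2 first.
- by apply: bdmeas_integrable; exact: bdmeas_cst.
- exact: bdmeas_integrable.
by rewrite prob_Rintegral_cst.
Qed.

Let glim0 (a : nat -> R) (L : R) :
  n.+1%:R * a n @[n --> \oo] --> L -> a n @[n --> \oo] --> (0 : R).
Proof.
move=> aL; rewrite -[X in _ --> X](mul0r L).
rewrite (_ : a = fun n => n.+1%:R^-1 * (n.+1%:R * a n)).
  by apply: cvgM => //; exact: cvg_harmonic.
by apply/funext => n; rewrite mulKf// pnatr_eq0.
Qed.

(** * The limit for a fixed partition of the jumps *)

Section fixed_partition.
Context {K : finType} (w : K -> V -> R) (c : K -> V) (r r' s : R).
Context (scw : forall i, smooth_compactly_supported (w i)).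
Context (w_ge0 : forall i y, 0 <= w i y).
Context (wE : forall y, \sum_i w i y = cutoff r y - cutoff r' y).
Context (r_ge1 : 1 <= r) (r'_gt0 : 0 < r') (r'_le : 2 * r' <= 1).
Context (s_ge0 : 0 <= s) (w_supp : forall i y, w i y != 0 -> `|y - c i| <= s).
Context (eta q rho B : R).
Context (eta_ge0 : 0 <= eta) (q_gt0 : 0 < q) (q_le1 : q <= 1) (s_le : s <= q).
Context (rho_gt0 : 0 < rho) (c_bound : forall i, 2 * (2 * rho + 1) + `|c i| <= B).
Context (f_unif : forall z v : V, `|z| <= B -> `|v| <= q -> `|f (z + v) - f z| <= eta).

Let bw i : bdmeas (w i). Proof. exact: smooth_compactly_supported_bdmeas. Qed.

Let w_le1 i y : w i y <= 1.
Proof.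
apply: (@le_trans _ _ (\sum_i w i y)).
  by rewrite (bigD1 i)//= lerDl sumr_ge0.
by rewrite wE; have := cutoff_le1 r y; have := cutoff_ge0 r' y; lra.
Qed.

Let chi_near0 (y : V) : `|y| <= r' -> cutoff r y - cutoff r' y = 0.
Proof.
move=> yr'; have r0 := r'_gt0; have h1 := r'_le; have h2 := r_ge1.
by rewrite !cutoff1 ?subrr//; lra.
Qed.

Let w_near0 i y : `|y| <= r' -> w i y = 0.
Proof.
move=> /chi_near0; rewrite -wE => h; apply/eqP; rewrite eq_le w_ge0 andbT -h.
by rewrite (bigD1 i)//= lerDl sumr_ge0.
Qed.

Let w_dom i y : `|w i y| <= (1 + r' ^- 2) * Num.min 1 (sqnorm y).
Proof.
by apply: vanishing_near0_dominated => //; [rewrite ger0_norm | exact: w_near0].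
Qed.

Lemma weight_nu_integrable i : nu.-integrable setT (EFin \o w i).
Proof. by apply: (trunc_dominated_integrable levy_nu) (w_dom i); case: (bw i). Qed.

Let chi_dom (y : V) :
  `|cutoff r y - cutoff r' y| <= (1 + r' ^- 2) * Num.min 1 (sqnorm y).
Proof.
apply: (@vanishing_near0_dominated _ _ r' (fun y => cutoff r y - cutoff r' y)) => //;
  last exact: chi_near0.
have := cutoff_le1 r y; have := cutoff_ge0 r' y.
have := cutoff_ge0 r y; have := cutoff_le1 r' y.
by move=> *; rewrite ler_norml; apply/andP; split; lra.
Qed.

Let r_gt0 : 0 < r. Proof. exact: lt_le_trans r_ge1. Qed.

Let glim_w i : n.+1%:R * \int[mun n]_y w i y @[n --> \oo] -->
  t * lambda * \int[nu]_y w i y.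
Proof. by apply: (glim (scw i)) (w_dom i); apply: w_near0; rewrite normr0 ltW. Qed.

Let glim_chi : n.+1%:R * \int[mun n]_y (cutoff r y - cutoff r' y) @[n --> \oo] -->
  t * lambda * \int[nu]_y (cutoff r y - cutoff r' y).
Proof.
apply: (glim (F := fun y => cutoff r y - cutoff r' y)) chi_dom.
  by apply: smooth_compactly_supportedB; exact: cutoff_compact.
by apply: chi_near0; rewrite normr0 ltW.
Qed.

Let glim_sqr j : n.+1%:R * \int[mun n]_y (y 0 j ^+ 2 * cutoff r' y) @[n --> \oo] -->
  t * lambda * \int[nu]_y (y 0 j ^+ 2 * cutoff r' y).
Proof.
apply: (glim (F := fun y => y 0 j ^+ 2 * cutoff r' y) (C := 1)).
- exact: sqr_cutoff_compact.
- by rewrite mxE expr0n mul0r.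
- by move=> y; rewrite mul1r; exact: sqr_cutoff_le_trunc.
Qed.

Let pN n := weight_mass (mun n) w r r' None.

Let cvg_pN : pN n @[n --> \oo] --> (1 : R).
Proof.
have h := glim0 glim_chi.
rewrite -[X in _ --> X](subr0 1).
rewrite (_ : pN = fun n => 1 - \int[mun n]_y (cutoff r y - cutoff r' y)).
  by apply: cvgB => //; exact: cvg_cst.
apply/funext => n; rewrite -[X in _ = X - _](prob_Rintegral_cst (mun n)) -RintegralB//.
- by apply: bdmeas_integrable; exact: bdmeas_cst.
- by apply: bdmeas_integrable; apply: bdmeasB; exact: cutoff_bdmeas.
Qed.

Let iterS n h : bdmeas h ->
  iter n.+1 (mix (weight_mass (mun n) w r r') (weight_op (mun n) w r r')) h x = S h x.
Proof.
move=> bh; rewrite (iter_mix_weight_op _ bw w_ge0 wE)//.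
rewrite /mun levy_iter_wconv//; last by rewrite divr_ge0// ltW.
by rewrite [n.+1%:R * _]mulrC divfK// pnatr_eq0.
Qed.

(** The left side of the discrete bound is independent of [n], because [n.+1] steps of duration
    [t / n.+1] make up [P_t]. On the right the scaled integrals converge by the generator at the
    origin, while the mass of [None] tends to 1 and [large_jump_mass] to 0. *)
Lemma entropy_bound_of_partition L g : 0 <= L -> lipschitz_bound L g ->
  ranged (l := l) (u := u) g ->
  S (fun y => phi (f y)) x - phi (S f x) <=
  (M + M) * S (fun z => `|f z - g z|) x +
  (M * (u - l) ^+ 2 * (t * lambda * \int[nu]_y (1 - cutoff r y)) +
   M * L ^+ 2 * \sum_(j < d) (t * lambda * \int[nu]_y (y 0 j ^+ 2 * cutoff r' y)) +
   M * L ^+ 2 * s ^+ 2 * (t * lambda * \int[nu]_y (cutoff r y - cutoff r' y))) +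
  \sum_i (t * lambda * \int[nu]_y w i y) *
    (S (fun z => A (f z) (f (z + c i))) x +
     (M + M) * (2 * eta + (u - l) * S (fun y => 1 - cutoff rho y) x)).
Proof.
move=> L0 Lg rg.
have rfc i : ranged (l := l) (u := u) (fun y : V => f (y + c i)).
  split => //; by case: (bdmeas_shiftr (c i) (ranged_bdmeas rf)).
have bphi := ek_bdmeas ek rf; have bf := ranged_bdmeas rf.
have bfg := bdmeas_norm (bdmeasB bf (ranged_bdmeas rg)).
have bA i := bregman_bdmeas ek rf (rfc i).
have btail : bdmeas (fun y : V => 1 - cutoff rho y : R).
  by apply: bdmeasB; [exact: bdmeas_cst | exact: cutoff_bdmeas].
pose sig n := (pN n)^-1 * \int[mun n]_y (1 - cutoff (q / 2) y).
pose rhs n := (M + M) * S (fun z => `|f z - g z|) x +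
  (M * (u - l) ^+ 2 * (n.+1%:R * \int[mun n]_y (1 - cutoff r y)) +
   M * L ^+ 2 * \sum_(j < d) (n.+1%:R * \int[mun n]_y (y 0 j ^+ 2 * cutoff r' y)) +
   M * L ^+ 2 * s ^+ 2 * (n.+1%:R * \int[mun n]_y (cutoff r y - cutoff r' y))) +
  \sum_i (n.+1%:R * \int[mun n]_y w i y) *
    ((pN n)^-1 * S (fun z => A (f z) (f (z + c i))) x +
     (M + M) * (2 * eta + (u - l) * (2 * sig n + (pN n)^-1 * S (fun y => 1 - cutoff rho y) x))).
set rhs_lim := leRHS.
have lim_rhs : rhs n @[n --> \oo] --> rhs_lim.
  rewrite /rhs; apply: cvgD; [apply: cvgD; first exact: cvg_cst|].
    apply: cvgD; [apply: cvgD|].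
    - by apply: cvgM; [exact: cvg_cst | exact: glim_tail].
    - apply: cvgM; first exact: cvg_cst.
      by apply: cvg_sumr => j; exact: glim_sqr.
    - by apply: cvgM; [exact: cvg_cst | exact: glim_chi].
  have pV : (pN n)^-1 @[n --> \oo] --> (1 : R).
    by rewrite -[X in _ --> X]invr1; apply: cvgV.
  have sig0 : sig n @[n --> \oo] --> (0 : R).
    rewrite -[X in _ --> X](mulr0 1); apply: cvgM => //.
    by apply: glim0; apply: glim_tail; exact: divr_gt0.
  apply: cvg_sumr => i; apply: cvgM; first exact: glim_w.
  apply: cvgD.
    by rewrite -[X in _ --> X]mul1r; apply: cvgM => //; exact: cvg_cst.
  apply: cvgM; first exact: cvg_cst.
  apply: cvgD; first exact: cvg_cst.
  apply: cvgM; first exact: cvg_cst.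
  rewrite -[X in _ --> X]add0r -[X in _ --> X + _](mulr0 2); apply: cvgD.
    by apply: cvgM => //; exact: cvg_cst.
  by rewrite -[X in _ --> X]mul1r; apply: cvgM => //; exact: cvg_cst.
apply: (cvgr_to_ge lim_rhs).
near=> n.
have p0 : 0 < pN n.
  by near: n; apply: (cvgr_gt _ cvg_pN); rewrite ltr01.
have := discretized_entropy_bound ek M0 lu bw w_ge0 wE r'_gt0 s_ge0 w_supp rf eta_ge0
  q_gt0 q_le1 s_le rho_gt0 c_bound f_unif p0 n x L0 Lg rg.
rewrite !iterS// => /le_trans; apply; rewrite /rhs lerD// ?lerD2l.
  rewrite /step_error le_eqVlt; apply/orP; left; apply/eqP.
  by rewrite -big_distrr/= 2!mulrDr; congr (_ + _ + _); exact: mulrCA.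
apply: ler_sum => i _; rewrite /jump_bound !iterS//; exact: bA.
Unshelve. all: by end_near. Qed.

End fixed_partition.

End continuous_time_limit.

Lemma small_factor {R : realType} (a e : R) : 0 <= a -> 0 < e ->
  exists b, [/\ 0 < b, b <= 1 & a * b <= e].
Proof.
move=> a0 e0; have a1 : 0 < a + 1 by rewrite ltr_wpDl.
exists (Num.min 1 (e / (a + 1))); split.
- by rewrite lt_min ltr01 divr_gt0.
- by rewrite ge_min lexx.
- apply: (@le_trans _ _ (a * (e / (a + 1)))).
    by rewrite ler_wpM2l// ge_min lexx orbT.
  by rewrite mulrCA (ler_piMr (ltW e0))// ler_pdivrMr// mul1r lerDl.
Qed.

Lemma between_dist {R : realType} (l u a b : R) :
  l <= a <= u -> l <= b <= u -> `|a - b| <= u - l.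
Proof.
by move=> /andP[? ?] /andP[? ?]; rewrite ler_norml; apply/andP; split; lra.
Qed.

Lemma norm_max_le {R : realType} (a N e : R) : 0 <= e -> `|a| <= N ->
  `|Num.max 0 (a - e)| <= N + e.
Proof.
move=> e0 aN; rewrite ger0_norm ?le_max ?lexx// ge_max.
have := le_trans (ler_norm a) aN; have := le_trans (normr_ge0 a) aN.
by move=> ? ?; apply/andP; split; lra.
Qed.

Lemma interpolation_le {R : realType} (k a b e D : R) : 0 <= k -> k <= 1 -> 0 <= e ->
  a <= b + e -> a <= D -> a <= k * b + e + D * (1 - k).
Proof.
move=> k0 k1 e0 abe aD.
have p1 : k * a <= k * (b + e) by rewrite ler_wpM2l.
have p2 : (1 - k) * a <= (1 - k) * D by rewrite ler_wpM2l// subr_ge0.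
have p3 : k * e <= e by rewrite ler_piMl.
lra.
Qed.

Lemma jump_term_le {R : realType} (a b M eta D E z : R) :
  a <= b + (M + M) * eta + D * z ->
  a + (M + M) * (2 * eta + E * z) <= b + (6 * M * eta + (D + (M + M) * E) * z).
Proof. lra. Qed.

Lemma six_sixths {R : realType} (e a b c g h i j k : R) : a <= e / 6 -> b <= e / 6 ->
  c <= e / 6 -> g <= e / 6 -> i <= h + (j + k) -> j <= e / 6 -> k <= e / 6 ->
  a + (b + c + g) + i <= h + e.
Proof. lra. Qed.

(** The integral of a nonnegative function is a supremum over the simple functions below it, hence
    monotone without measurability. This serves for the inner integral over [nu] as a function of
    the base point. *)
Lemma ge0_le_integral_nonmeasurable {d} {T : measurableType d} {R : realType}
    (mu : {measure set T -> \bar R}) (f g : T -> \bar R) :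
  (forall x, 0 <= f x)%E -> (forall x, f x <= g x)%E ->
  (\int[mu]_x f x <= \int[mu]_x g x)%E.
Proof.
move=> f0 fg; have g0 x : (0 <= g x)%E := le_trans (f0 x) (fg x).
rewrite !ge0_integralTE//; apply: ereal_sup_le => _ /= [h hf <-].
by exists h => // x; exact: le_trans (hf x) (fg x).
Qed.

(** * Choice of the parameters for continuous functions with values in a segment *)

Section continuous_functions.
Context {R : realType} {d : nat} {dO : measure_display}.
Context {Omega : measurableType dO} {P : probability Omega R}.
Local Notation V := 'rV[R]_d.
Context (X : R -> {RV P >-> 'rV[R]_d}) (lambda : R) (theta : V).
Context (nu : {measure set 'rV[R]_d -> \bar R}) (levy_nu : levy_measure nu).
Context (levyX : levy_process X).
Context (genX : has_generator X (levy_operator lambda theta nu)).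
Context (lambda_gt0 : 0 < lambda) (t : R) (t_gt0 : 0 < t) (x : V).
Context {l u M : R} {phi dphi : R -> R} (ek : entropy_kernel l u M phi dphi).
Context (M0 : 0 <= M) (lu : l <= u).
Context (f : V -> R) (cf : continuous f) (flu : forall x, l <= f x <= u).
Local Notation A := (bregman phi dphi).

Let S : (V -> R) -> V -> R := wconv (levy_law X t) (fun=> 1).

Let mS : markov S.
Proof. by apply: markov_wconv => //; [exact: bdmeas_cst | exact: prob_Rintegral_cst]. Qed.

Let rf : ranged (l := l) (u := u) f.
Proof. by split => //; exact: continuous_measurable_rV. Qed.

Let SE h : S h x = \int[levy_law X t]_y h (x + y).
Proof. by apply: eq_Rintegral => y _; rewrite mul1r. Qed.

(** [H] is a finite sum of Riemann type below the integral over [nu]. Being bounded and measurable,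
    it is within reach of the Markov calculus; the integral replaces it only after [P_t] has been
    applied. *)
Lemma approximate_entropy_bound (e : R) : 0 < e ->
  exists H : V -> R, [/\ bdmeas H, forall z, 0 <= H z,
    forall z, ((H z)%:E <= \int[nu]_y (A (f z) (f (z + y)))%:E)%E &
    S (fun y => phi (f y)) x - phi (S f x) <= lambda * t * S H x + e].
Proof.
move=> e0; have M0' := M0; have lu' := lu.
(* There are six errors: the approximation [g], the large jumps, the small jumps, the cell size, the
   modulus [eta], the tail beyond [rho]. The order of the choices matters: [L] comes with [g], then
   [r], [r'] and [C] are fixed, and only then [eta], [rho], [q] and [s]. *)
have e6 : 0 < e / 6 by rewrite divr_gt0.
have D0 : 0 <= u - l by rewrite subr_ge0.
have tl0 : 0 <= t * lambda by rewrite mulr_ge0// ltW.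
have MM0 : 0 <= M + M by rewrite addr_ge0.
have [e1 [e1_gt0 _ He1]] := small_factor MM0 e6.
have [L [g [L0 Lg lgu gfe1]]] := lipschitz_approximation (levy_law X t) x cf flu e1_gt0.
have sD0 : 0 <= M * (u - l) ^+ 2 := mulr_ge0 M0 (sqr_ge0 _).
have sL0 : 0 <= M * L ^+ 2 := mulr_ge0 M0 (sqr_ge0 _).
have c2 := mulr_ge0 sD0 tl0.
have [e2 [e2_gt0 _ He2]] := small_factor c2 e6.
have [r r1 Hr] := cutoff_tail levy_nu e2_gt0.
have c3 := mulr_ge0 (mulr_ge0 sL0 tl0) (ler0n R d).
have [e3 [e3_gt0 _ He3]] := small_factor c3 e6.
have [r' [r'0 r'1 Hr']] := sqr_cutoff_small levy_nu e3_gt0.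
have r'r : 2 * r' <= r := le_trans r'1 r1.
pose C := \int[nu]_y (cutoff r y - cutoff r' y : R).
have C0 : 0 <= C by apply: Rintegral_ge0 => y _; rewrite subr_ge0 cutoff_mono.
have c4 := mulr_ge0 sL0 (mulr_ge0 tl0 C0).
have [e4 [e4_gt0 e4_le1 He4]] := small_factor c4 e6.
(* The 6 is 4 + 2: [(M + M) * (2 * eta)] from the bound for a fixed partition and [(M + M) * eta]
   from the minorant [m] below. *)
have c5 := mulr_ge0 (mulr_ge0 tl0 C0) (mulr_ge0 (ler0n R 6) M0).
have [eta [eta_gt0 _ Heta]] := small_factor c5 e6.
have c7 := mulr_ge0 (mulr_ge0 tl0 C0) (addr_ge0 sD0 (mulr_ge0 MM0 D0)).
have [e7 [e7_gt0 _ He7]] := small_factor c7 e6.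
have [rho rho0 Hrho] := cutoff_tight (levy_law X t) x e7_gt0.
(* A ball containing all [z + c i] with [|z| <= 2 * (2 * rho + 1)], since [|c i| <= 2 * r + s] and
   [s <= 1]. *)
pose B := 2 * (2 * rho + 1) + (2 * r + 1).
have [q' q'0 f_unif'] := uniform_continuity_on_ball B cf eta_gt0.
pose q := Num.min 1 q'.
have q0 : 0 < q by rewrite lt_min ltr01.
have q1 : q <= 1 by rewrite ge_min lexx.
have f_unif (z v : V) : `|z| <= B -> `|v| <= q -> `|f (z + v) - f z| <= eta.
  by move=> zB vq; apply: f_unif' => //; rewrite (le_trans vq)// ge_min lexx orbT.
pose s := Num.min e4 q.
have s0 : 0 < s by rewrite lt_min e4_gt0.
have sq : s <= q by rewrite ge_min lexx orbT.
have se4 : s <= e4 by rewrite ge_min lexx.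
have [K [w [c [scw w0 wE w_supp cb]]]] := @partition_of_unity R d r r' s r'0 r'r s0.
have c_bound i : 2 * (2 * rho + 1) + `|c i| <= B.
  by rewrite lerD2l (le_trans (cb i))// lerD2l (le_trans sq).
have rg : ranged (l := l) (u := u) g.
  by split => //; apply: continuous_measurable_rV; exact: lipschitz_bound_continuous Lg.
have main := entropy_bound_of_partition levy_nu levyX genX t_gt0 x ek M0 lu cf flu
  scw w0 wE r1 r'0 r'1 (ltW s0) w_supp (ltW eta_gt0) q0 q1 sq rho0 c_bound f_unif L0 Lg rg.
have rfc i : ranged (l := l) (u := u) (fun y : V => f (y + c i)).
  by split => //; case: (bdmeas_shiftr (c i) (ranged_bdmeas rf)).
pose Ai i z := A (f z) (f (z + c i)).
have bA i : bdmeas (Ai i) := bregman_bdmeas ek rf (rfc i).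
(* For [|z| <= 2 * rho] and [y] in the cell [i], this is a nonnegative minorant of
   [A (f z) (f (z + y))]; the factor [cutoff rho] in [H] confines the comparison to such [z]. *)
pose m i z := Num.max 0 (Ai i z - (M + M) * eta).
have bm i : bdmeas (m i).
  split.
    apply: measurable_maxr => //; apply: measurable_funB => //; by case: (bA i).
  case: (bA i) => _ [N AN]; exists (N + (M + M) * eta) => z; rewrite /m.
  by apply: norm_max_le => //; rewrite mulr_ge0// ltW.
have m0 i z : 0 <= m i z by rewrite le_max lexx.
pose nuw i := \int[nu]_y w i y.
have nuw0 i : 0 <= nuw i by apply: Rintegral_ge0.
have wint i := weight_nu_integrable levy_nu scw w0 wE r1 r'0 r'1 i.
pose H z := cutoff rho z * \sum_i nuw i * m i z.
have bcm i : bdmeas (fun z => cutoff rho z * m i z).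
  by apply: bdmeasM => //; exact: cutoff_bdmeas.
have HE z : H z = \sum_i nuw i * (cutoff rho z * m i z).
  by rewrite /H big_distrr; apply: eq_bigr => i _; rewrite mulrCA.
have bH : bdmeas H.
  rewrite (_ : H = fun z => \sum_i nuw i * (cutoff rho z * m i z)); last exact/funext.
  by apply: bdmeas_sum => i _; exact: bdmeasZ.
exists H; split => //.
- move=> z; rewrite mulr_ge0 ?cutoff_ge0// sumr_ge0// => i _; exact: mulr_ge0.
- move=> z.
  have A0 y : (0 <= (A (f z) (f (z + y)))%:E)%E by rewrite lee_fin; exact: (ek_ge0 ek).
  have [zr|zr] := leP `|z| (2 * rho); last first.
    by rewrite /H cutoff0// mul0r; exact: integral_ge0.
  apply: (@le_trans _ _ (\int[nu]_y (\sum_i w i y * m i z)%:E)%E); last first.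
    apply: ge0_le_integral => //.
    + by move=> y _; rewrite lee_fin sumr_ge0// => i _; rewrite mulr_ge0.
    + apply/measurable_EFinP; apply: measurable_sum => i; apply: measurable_funM => //.
      by case: (smooth_compactly_supported_bdmeas (scw i)).
    + apply/measurable_EFinP.
      have rc : ranged (l := l) (u := u) (fun _ : V => f z) by split.
      have rs : ranged (l := l) (u := u) (fun y : V => f (z + y)).
        by split => //; case: (bdmeas_shift z (ranged_bdmeas rf)).
      by case: (bregman_bdmeas ek rc rs).
    + move=> y _; rewrite lee_fin.
      apply: (@le_trans _ _ (\sum_i w i y * A (f z) (f (z + y)))).
        apply: ler_sum => i _; have [->|wy] := eqVneq (w i y) 0; first by rewrite !mul0r.
        rewrite ler_wpM2l// /m ge_max -lee_fin A0/= lerBlDr -lerBlDl.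
        apply: (le_trans (bregman_lip2 ek (flu z) (flu (z + c i)) (flu (z + y)))).
        rewrite ler_wpM2l// distrC.
        have := f_unif (z + c i) (y - c i); rewrite addrA [z + c i + y]addrAC addrK.
        apply; last exact: le_trans (w_supp i y wy) sq.
        rewrite (le_trans (ler_normD _ _))// (le_trans _ (c_bound i))// lerD2r.
        rewrite (le_trans zr)// ler_pM2l// mulr_natl mulr2n -addrA lerDl.
        by rewrite addr_ge0// ltW.
      rewrite -big_distrl/= wE ler_piMl -?lee_fin//.
      by rewrite lee_fin lerBlDr (le_trans (cutoff_le1 r y))// lerDl cutoff_ge0.
  have -> : (\int[nu]_y (\sum_i w i y * m i z)%:E = (\sum_i nuw i * m i z)%:E)%E.
    under eq_integral do rewrite -sumEFin.
    rewrite integral_sum//; last first.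
      move=> i; rewrite (_ : (fun y => _) = (fun y => (m i z)%:E * (w i y)%:E)%E).
        by apply: integrableZl => //; exact: wint.
      by apply/funext => y; rewrite -EFinM mulrC.
    rewrite -sumEFin; apply: eq_bigr => i _.
    under eq_integral do rewrite mulrC EFinM.
    rewrite integralZl//; last exact: wint.
    rewrite EFinM muleC /nuw /Rintegral fineK//.
    by apply: integral_fune_fin_num => //; exact: wint.
  rewrite lee_fin ler_piMl ?cutoff_le1// sumr_ge0// => i _; exact: mulr_ge0.
- apply: (le_trans main).
  rewrite -/S in main *.
  set b := S (fun y => 1 - cutoff rho y) x.
  have b_lt : b < e7 by rewrite /b SE.
  have b_ge0 : 0 <= b.
    by rewrite /b SE; apply: Rintegral_ge0 => y _; rewrite subr_ge0 cutoff_le1.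
  have btail : bdmeas (fun y : V => 1 - cutoff rho y : R).
    by apply: bdmeasB; [exact: bdmeas_cst | exact: cutoff_bdmeas].
  (* Where the cutoff is below 1 the divergence is merely bounded by [M * (u - l)^2], which costs a
     multiple of the tail [b]. *)
  have SA i : S (Ai i) x <= S (fun z => cutoff rho z * m i z) x + (M + M) * eta +
      M * (u - l) ^+ 2 * b.
    rewrite -(markov_cst ((M + M) * eta) x mS) -(markovD mS)//; last exact: bdmeas_cst.
    rewrite /b -(markovZ mS)// -(markovD mS)//; last 2 first.
    - by apply: bdmeasD => //; exact: bdmeas_cst.
    - exact: bdmeasZ.
    apply: (markov_le mS) => //.
      by apply: bdmeasD; [apply: bdmeasD => //; exact: bdmeas_cst | exact: bdmeasZ].
    move=> z.
    have k1 := cutoff_le1 rho z; have k0 := cutoff_ge0 rho z.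
    have q2 : Ai i z <= M * (u - l) ^+ 2.
      apply: (le_trans (ek_quad ek (flu z) (flu (z + c i)))); rewrite ler_wpM2l//.
      rewrite -[leLHS]real_normK ?num_real// lerXn2r ?nnegrE//.
      exact: between_dist.
    have q3 : Ai i z <= m i z + (M + M) * eta by rewrite -lerBlDr /m le_max lexx orbT.
    have q4 : 0 <= (M + M) * eta by rewrite mulr_ge0// ltW.
    exact: interpolation_le.
  have SH : S H x = \sum_i nuw i * S (fun z => cutoff rho z * m i z) x.
    rewrite (_ : H = fun z => \sum_i nuw i * (cutoff rho z * m i z)); last exact/funext.
    have /= -> := markov_sum (P := xpredT) x mS (fun i _ => bdmeasZ (nuw i) (bcm i)).
    by apply: eq_bigr => i _; rewrite (markovZ mS).
  have Cn : \sum_i nuw i = C.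
    rewrite /C; under [RHS]eq_Rintegral do rewrite -wE.
    rewrite /Rintegral; under [in RHS]eq_integral do rewrite -sumEFin.
    rewrite integral_sum// /nuw /Rintegral sum_fine//.
    by move=> i _; apply: integral_fune_fin_num => //; exact: wint.
  have t1 : (M + M) * S (fun z => `|f z - g z|) x <= e / 6.
    apply: le_trans He1; rewrite ler_wpM2l// ltW//.
    by rewrite SE.
  have t2 : M * (u - l) ^+ 2 * (t * lambda * \int[nu]_y (1 - cutoff r y)) <= e / 6.
    apply: le_trans He2; rewrite mulrA ler_wpM2l// ltW//.
  have t3 : M * L ^+ 2 * \sum_(j < d) (t * lambda * \int[nu]_y (y 0 j ^+ 2 * cutoff r' y)) <= e / 6.
    apply: le_trans He3; rewrite -big_distrr/= mulrA -[leRHS]mulrA.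
    rewrite (ler_wpM2l (mulr_ge0 sL0 tl0))//.
    apply: (@le_trans _ _ (\sum_(j < d) e3)); first by apply: ler_sum => j _; exact: ltW.
    by rewrite sumr_const card_ord mulr_natl.
  have t4 : M * L ^+ 2 * s ^+ 2 * (t * lambda * C) <= e / 6.
    apply: le_trans He4; rewrite mulrAC ler_wpM2l//.
    by rewrite expr2 (le_trans _ se4)// (ler_piMl (ltW s0) (le_trans sq q1)).
  have t5 : \sum_i (t * lambda * nuw i) * (S (Ai i) x +
      (M + M) * (2 * eta + (u - l) * b)) <= lambda * t * S H x +
      (t * lambda * C * (6 * M) * eta +
       t * lambda * C * (M * (u - l) ^+ 2 + (M + M) * (u - l)) * b).
    apply: (@le_trans _ _ (\sum_i t * lambda * (nuw i * S (fun z => cutoff rho z * m i z) x +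
        nuw i * (6 * M * eta + (M * (u - l) ^+ 2 + (M + M) * (u - l)) * b)))).
      apply: ler_sum => i _; rewrite -mulrA ler_wpM2l// -mulrDr ler_wpM2l//.
      exact: jump_term_le.
    rewrite -big_distrr/= big_split/= -big_distrl/= Cn -SH.
    rewrite le_eqVlt; apply/orP; left; apply/eqP.
    by rewrite mulrDr [lambda * t]mulrC !(mulrDr (t * lambda), mulrDr C) !mulrA.
  have t7 : t * lambda * C * (M * (u - l) ^+ 2 + (M + M) * (u - l)) * b <= e / 6.
    by apply: le_trans He7; rewrite ler_wpM2l// ltW.
  exact: six_sixths t1 t2 t3 t4 t5 Heta t7.
Qed.

Lemma continuous_entropy_bound :
  ((\int[P]_w phi (f (x + X t w)) - phi (\int[P]_w f (x + X t w)))%:E <=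
  (lambda * t)%:E *
    \int[P]_w \int[nu]_y (A (f (x + X t w)) (f (x + X t w + y)))%:E)%E.
Proof.
have lt0 : 0 <= lambda * t by rewrite mulr_ge0// ltW.
have SP h : bdmeas h -> S h x = \int[P]_w h (x + X t w).
  move=> bh; rewrite SE; exact: (Rintegral_distribution (X t) (bdmeas_shift x bh)).
rewrite -(SP _ (ranged_bdmeas rf)) -(SP _ (ek_bdmeas ek rf)).
apply/lee_addgt0Pr => e e0.
have [H [bH H0 HA]] := approximate_entropy_bound e0.
rewrite -lee_fin => /le_trans; apply; rewrite EFinD EFinM leeD2r//.
apply: lee_wpmul2l; first by rewrite lee_fin.
rewrite SP// bdmeas_Rintegral_EFin; last first.
  by apply: bdmeas_comp bH; apply: measurable_rVD.
by apply: ge0_le_integral_nonmeasurable => w; rewrite ?lee_fin.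
Qed.

End continuous_functions.

(** * Calculus on an interval *)

Section calculus_on_an_interval.
Context {R : realType} (I : set R) (I_itv : is_interval I) (I_closed : closed I).
Implicit Types (g : R -> R) (u v : R).

Lemma deriv_inP g u (e : R) : derivable_in I g u -> 0 < e ->
  exists2 r, 0 < r & forall v, I v -> `|v - u| < r ->
    `|g v - g u - deriv_in I g u * (v - u)| <= e * `|v - u|.
Proof.
move=> dg e0; have /cvgrPdist_le/(_ e e0) H : diff_quot_in I g u --> deriv_in I g u.
  exact: dg.
have /nbhs_ballP[r /= r0 hr] : nbhs 0 (fun h : R => h != 0 -> I (u + h) ->
    `|deriv_in I g u - h^-1 * (g (u + h) - g u)| <= e) by exact: H.
exists r => // v Iv vr; have [->|vu] := eqVneq v u.
  by rewrite !subrr mulr0 subr0 normr0 mulr0.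
have vu0 : v - u != 0 by rewrite subr_eq0.
have := hr (v - u); rewrite /ball/= sub0r normrN => /(_ vr vu0).
rewrite /= subrKC => /(_ Iv) h.
rewrite -ler_pdivrMr ?normr_gt0// -normfV -normrM mulrBl mulfK//.
by rewrite distrC mulrC.
Qed.

Lemma derivable_in_continuous g u (e : R) : derivable_in I g u -> 0 < e ->
  exists2 r, 0 < r & forall v, I v -> `|v - u| < r -> `|g v - g u| <= e.
Proof.
move=> dg e0; have [r r0 hr] := deriv_inP dg ltr01.
pose k := `|deriv_in I g u| + 1; have k0 : 0 < k by rewrite ltr_wpDl.
exists (Num.min r (e / k)); first by rewrite lt_min r0 divr_gt0.
move=> v Iv; rewrite lt_min => /andP[vr ve].
apply: (@le_trans _ _ (k * `|v - u|)); last by rewrite mulrC -ler_pdivlMr// ltW.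
have := hr v Iv vr; rewrite mul1r => h.
have -> : g v - g u = (g v - g u - deriv_in I g u * (v - u)) + deriv_in I g u * (v - u).
  by rewrite subrK.
rewrite (le_trans (ler_normD _ _))// /k mulrDl mul1r addrC lerD// normrM//.
Qed.

(** Besides truncating [f], composition with [clip] extends functions that are regular inside [I] to
    continuous functions on the line, to which the mean value and extreme value theorems apply. *)
Definition clip (l u r : R) : R := Num.max l (Num.min u r).

Lemma clip_between l u r : l <= u -> l <= clip l u r <= u.
Proof. by move=> lu; rewrite /clip le_max lexx/= ge_max lu ge_min lexx. Qed.

Lemma clip_id l u r : l <= r <= u -> clip l u r = r.
Proof. by move=> /andP[lr ru]; rewrite /clip (min_idPr ru) (max_idPr lr). Qed.

Lemma clip_cases l u r : l <= u ->
  [\/ r <= l /\ clip l u r = l, l <= r <= u /\ clip l u r = r | u <= r /\ clip l u r = u].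
Proof.
move=> lu; have [rl|/ltW lr] := leP r l.
  by constructor 1; rewrite /clip (min_idPr (le_trans rl lu)) (max_idPl rl).
have [ru|/ltW ur] := leP r u; first by constructor 2; rewrite clip_id lr.
by constructor 3; rewrite /clip (min_idPl ur) (max_idPr lu).
Qed.

Lemma clip_lipschitz l u r s : `|clip l u r - clip l u s| <= `|r - s|.
Proof.
have maxL (c a b : R) : `|Num.max c a - Num.max c b| <= `|a - b|.
  wlog ab : a b / b <= a => [hw|].
    by have [/hw//|/ltW/hw] := leP b a; rewrite distrC [leRHS]distrC.
  have [ca|ac] := leP c a; have [cb|bc] := leP c b => //.
  - by rewrite !ger0_norm ?subr_ge0// lerD2l lerN2 ltW.
  - by have := le_lt_trans (le_trans cb ab) ac; rewrite ltxx.
  - by rewrite subrr normr0.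
apply: le_trans (maxL _ _ _) _; rewrite -normrN opprD !oppr_min.
by rewrite (le_trans (maxL _ _ _))// -opprD normrN.
Qed.

Lemma clip_comp_continuous g l u : l <= u -> I l -> I u ->
  (forall v, I v -> derivable_in I g v) -> continuous (fun r => g (clip l u r)).
Proof.
move=> lu Il Iu dg r.
have Ic s : I (clip l u s).
  by have /andP[? ?] := clip_between s lu; apply: (I_itv Il Iu); apply/andP.
apply/cvgrPdist_le => e e0.
have [q q0 hq] := derivable_in_continuous (dg _ (Ic r)) e0.
apply/nbhs_ballP; exists q => //= s; rewrite /ball/= => rs.
rewrite distrC; apply: hq => //; apply: le_lt_trans rs.
by rewrite distrC clip_lipschitz.
Qed.

Lemma clip_comp_is_derive g l u r : l < r < u -> I l -> I u -> derivable_in I g r ->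
  is_derive r 1 (fun s => g (clip l u s)) (deriv_in I g r).
Proof.
move=> /andP[lr ru] Il Iu dg.
have cr : clip l u r = r by rewrite clip_id// !ltW.
have cv : h^-1 *: (((fun s => g (clip l u s)) \o shift r) (h *: 1) - g (clip l u r))
    @[h --> 0^'] --> deriv_in I g r.
  apply/cvgrPdist_le => e e0.
  have [q q0 hq] := deriv_inP dg e0.
  pose m := Num.min (r - l) (u - r).
  have m0 : 0 < m by rewrite /m lt_min !subr_gt0 lr.
  near=> h.
  have h0 : h != 0 by near: h; exact: nbhs_dnbhs_neq.
  have h1 : `|h| < q by near: h; exact: dnbhs0_lt.
  have h2 : l <= h + r <= u.
    have : `|h| < m by near: h; exact: dnbhs0_lt.
    rewrite /m lt_min !ltr_norml => /andP[/andP[? ?] /andP[? ?]].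
    by apply/andP; split; lra.
  rewrite /= cr [h *: 1]mulr1 clip_id// /GRing.scale/=.
  have := hq (h + r) (I_itv Il Iu h2); rewrite addrK => /(_ h1) k.
  rewrite distrC -(@ler_pM2r _ `|h|) ?normr_gt0// -normrM mulrBl.
  by rewrite mulrC mulrA mulfV// mul1r.
by apply: DeriveDef; [apply/cvg_ex; eexists; exact: cv | exact: cvg_lim cv].
Unshelve. all: by end_near. Qed.

Lemma lipschitz_on_segment g l u : l <= u -> I l -> I u ->
  (forall v, I v -> derivable_in I g v) ->
  (forall v, I v -> derivable_in I (deriv_in I g) v) ->
  exists2 M, 0 <= M & forall a b, l <= a <= u -> l <= b <= u ->
    `|g a - g b| <= M * `|a - b|.
Proof.
move=> lu Il Iu dg ddg.
have cc : {within `[l, u], continuous (fun r => `|deriv_in I g (clip l u r)|)}.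
  apply: continuous_subspaceT => r; apply: (@cvg_norm _ R).
  exact: clip_comp_continuous ddg r.
have [c _ cmax] := EVT_max lu cc.
exists `|deriv_in I g (clip l u c)| => // a b.
wlog ab : a b / a <= b => [hw|].
  by have [/hw//|/ltW/hw] := leP a b; rewrite distrC [`|a - b|]distrC => h ? ?; exact: h.
move=> /andP[la au] /andP[lb bu].
have dclip r : r \in `]a, b[ -> is_derive r 1 (fun s => g (clip l u s)) (deriv_in I g r).
  rewrite in_itv/= => /andP[ar rb].
  have lr : l < r := le_lt_trans la ar; have ru : r < u := lt_le_trans rb bu.
  apply: clip_comp_is_derive => //; first by rewrite lr.
  by apply/dg/(I_itv Il Iu); rewrite !ltW.
have cclip : {within `[a, b], continuous (fun s => g (clip l u s))}.
  by apply: continuous_subspaceT => r; exact: clip_comp_continuous dg r.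
have [r] := MVT_segment ab dclip cclip.
rewrite in_itv/= (@clip_id l u a) ?la// (@clip_id l u b) ?lb// => /andP[ar rb] E.
rewrite distrC E normrM [`|a - b|]distrC ler_wpM2r//.
have lr : l <= r <= u by rewrite (le_trans la) ?(le_trans rb).
by have := cmax r; rewrite in_itv/= clip_id//; exact.
Qed.

(** Either [c - k] belongs to [I], or it bounds [I] from below and [I], being closed, has a least
    element. These ends are the truncation levels of [f]. *)
Lemma interval_lower_end (c k : R) : I c -> 0 <= k ->
  exists l, [/\ I l, l <= c & forall r, I r -> c - k <= r -> l <= r].
Proof.
move=> Ic k0; have [Ick|nI] := pselect (I (c - k)).
  by exists (c - k); split => //; rewrite gerBl.
pose J := [set - r | r in I].
have Jub : ubound J (k - c).
  move=> _ [r Ir <-]; rewrite lerNl opprB leNgt; apply/negP => rck.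
  by apply: nI; apply: (I_itv Ir Ic); rewrite ltW//= gerBl.
have supJ : has_sup J by split; [exists (- c), c | exists (k - c)].
have Jc : closed J.
  rewrite (_ : J = -%R @^-1` I); last first.
    apply/seteqP; split => [_ [r Ir <-]|r /= Ir]; first by rewrite /= opprK.
    by exists (- r) => //; rewrite opprK.
  by apply: (closed_comp _ I_closed) => r _; exact: opp_continuous.
have : J (sup J).
  by have := closure_sup supJ.1 supJ.2; rewrite -(closure_id _).1.
case=> l Il lE; exists l; split => //.
  rewrite -lerN2 lE; apply: ub_le_sup; first by case: supJ.
  by exists c.
move=> r Ir _; rewrite -lerN2 lE; apply: ub_le_sup; first by case: supJ.
by exists r.
Qed.

Lemma interval_upper_end (c k : R) : I c -> 0 <= k ->
  exists u, [/\ I u, c <= u & forall r, I r -> r <= c + k -> r <= u].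
Proof.
move=> Ic k0; have [Ick|nI] := pselect (I (c + k)).
  by exists (c + k); split => //; rewrite lerDl.
have Iub : ubound I (c + k).
  move=> r Ir; rewrite leNgt; apply/negP => rck.
  by apply: nI; apply: (I_itv Ic Ir); rewrite lerDl k0 ltW.
have supI : has_sup I by split; [exists c | exists (c + k)].
have Isup : I (sup I).
  by have := closure_sup supI.1 supI.2; rewrite -(closure_id _).1.
exists (sup I); split => //; first by apply: ub_le_sup => //; case: supI.
by move=> r Ir _; apply: ub_le_sup => //; case: supI.
Qed.

End calculus_on_an_interval.

(** * Consequences of the convexity of Psi for the Bregman divergence *)

Section admissible_functions.
Context {R : realType} (I : set R) (I_itv : is_interval I) (I_closed : closed I).
Context (Phi : R -> R) (smoothPhi : smooth_in I Phi).
Context (Psi_ge0 : forall u v : R, I u -> I (u + v) -> 0 <= Psi I Phi u v).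
Context (Psi_cvx : convex_function (Psi_domain I) (fun p => Psi I Phi p.1 p.2)).

Local Notation dPhi := (deriv_in I Phi).
Local Notation ddPhi := (deriv_in I dPhi).
Local Notation A := (bregman Phi dPhi).

Let dP u : I u -> derivable_in I Phi u := @smoothPhi 0%N u.
Let ddP u : I u -> derivable_in I dPhi u := @smoothPhi 1%N u.
Let dddP u : I u -> derivable_in I ddPhi u := @smoothPhi 2%N u.

Lemma bregmanE a b : A a b = Psi I Phi a (b - a).
Proof. by rewrite /bregman /Psi subrKC. Qed.

Lemma bregman_ge0 a b : I a -> I b -> 0 <= A a b.
Proof. by move=> Ia Ib; rewrite bregmanE; apply: Psi_ge0 => //; rewrite subrKC. Qed.

(** The sum [A a b + A b a] equals [(dPhi b - dPhi a) * (b - a)], and both terms are nonnegative. *)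
Lemma deriv_in_nondecreasing a b : I a -> I b -> a <= b -> dPhi a <= dPhi b.
Proof.
move=> Ia Ib; rewrite le_eqVlt => /predU1P[->//|ab].
have := bregman_ge0 Ia Ib; have := bregman_ge0 Ib Ia; rewrite /bregman => h1 h2.
have : 0 <= (dPhi b - dPhi a) * (b - a) by lra.
by rewrite pmulr_lge0 ?subr_gt0// subr_ge0.
Qed.

(* By the three-point identity A(a, b) = A(a, c) + A(c, b) + (Phi'(c) - Phi'(a)) (b - c). *)
Lemma bregman_mono a a' b' b : I a -> I a' -> I b' -> I b ->
  (a <= a' /\ a' <= b' /\ b' <= b) \/ (b <= b' /\ b' <= a' /\ a' <= a) ->
  A a' b' <= A a b.
Proof.
move=> Ia Ia' Ib' Ib h.
have s1 : 0 <= (dPhi a' - dPhi a) * (b - a').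
  case: h => -[h1 [h2 h3]].
    by rewrite mulr_ge0 ?subr_ge0 ?deriv_in_nondecreasing// (le_trans h2).
  rewrite -mulrNN !opprB mulr_ge0 ?subr_ge0 ?deriv_in_nondecreasing//.
  exact: le_trans h1 h2.
have s2 : 0 <= (dPhi b' - dPhi a') * (b - b').
  case: h => -[h1 [h2 h3]].
    by rewrite mulr_ge0 ?subr_ge0 ?deriv_in_nondecreasing.
  by rewrite -mulrNN !opprB mulr_ge0 ?subr_ge0 ?deriv_in_nondecreasing.
have := bregman_ge0 Ia Ia'; have := bregman_ge0 Ib' Ib; rewrite /bregman; lra.
Qed.

Lemma clip_in l u r : I l -> I u -> l <= u -> I (clip l u r).
Proof. by move=> Il Iu lu; apply: (I_itv Il Iu); exact: clip_between. Qed.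

(** The clipped points either coincide or lie between [a] and [b] in the same order, where
    [bregman_mono] applies. *)
Lemma bregman_clip l u a b : I l -> I u -> l <= u -> I a -> I b ->
  A (clip l u a) (clip l u b) <= A a b.
Proof.
move=> Il Iu lu Ia Ib.
have Ica := clip_in a Il Iu lu; have Icb := clip_in b Il Iu lu.
have [ab|ab|ab] : [\/ clip l u a = clip l u b,
    (a <= clip l u a /\ clip l u a <= clip l u b /\ clip l u b <= b) |
    (b <= clip l u b /\ clip l u b <= clip l u a /\ clip l u a <= a)].
  move: (clip_cases a lu) (clip_cases b lu); case=> -[+ ->] => a1; case=> -[+ ->] => b1;
    first [by constructor 1 | by constructor 2; rewrite ?lexx; lra |
           by constructor 3; rewrite ?lexx; lra | idtac].
  by case/orP: (le_total a b) => ab; [constructor 2|constructor 3].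
- by rewrite ab bregmanxx bregman_ge0.
- by apply: bregman_mono => //; left.
- by apply: bregman_mono => //; right.
Qed.

Lemma bregman_convex a b a0 b0 (s : R) : 0 <= s <= 1 ->
  I a -> I b -> I a0 -> I b0 ->
  A (s * a + (1 - s) * a0) (s * b + (1 - s) * b0) <= s * A a b + (1 - s) * A a0 b0.
Proof.
move=> /andP[s0 s1] Ia Ib Ia0 Ib0.
have D (c e : R) : I c -> I e -> (c, e - c) \in (Psi_domain I : set (R^o * R^o)%type).
  by move=> Ic Ie; rewrite inE; split => //=; rewrite subrKC.
have := Psi_cvx (Itv01 s0 s1) (D _ _ Ia Ib) (D _ _ Ia0 Ib0).
rewrite !bregmanE.
have -> : s * b + (1 - s) * b0 - (s * a + (1 - s) * a0) = s * (b - a) + (1 - s) * (b0 - a0).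
  by ring.
exact.
Qed.

Let subgradient_arith (s e1 y w e k p d r a b a0 b0 B0 B1 B : R) :
  d * (s * (b - b0)) <= s * (e1 * y) -> r * (b0 - a0) <= s * (e1 * w) ->
  s * (e1 * (y + w)) <= s * e ->
  (p - d) * (s * (b - b0)) - (r + k * (s * (a - a0))) * (b0 - a0) <= B1 - B0 ->
  B1 <= s * B + (1 - s) * B0 ->
  s * (B0 + k * (a0 - b0) * (a - a0) + p * (b - b0)) <= s * (B + e).
Proof. lra. Qed.

(** The coefficients are the partial derivatives of [A] at [(a0, b0)]. Convexity is applied at a
    small fraction [s] of the way to [(a, b)], so derivatives along [I] suffice and the endpoints of
    [I] are covered. *)
Lemma bregman_subgradient a0 b0 a b : I a0 -> I b0 -> I a -> I b ->
  A a0 b0 + ddPhi a0 * (a0 - b0) * (a - a0) + (dPhi b0 - dPhi a0) * (b - b0) <= A a b.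
Proof.
move=> Ia0 Ib0 Ia Ib; apply/ler_addgt0Pr => e e0.
pose K := `|b - b0| + `|a - a0| * `|b0 - a0|.
have K0 : 0 <= K by rewrite addr_ge0// mulr_ge0.
have [e1 [e1_gt0 _ Ke]] := small_factor K0 e0.
have [r1 r1_gt0 h1] := deriv_inP (ddP Ia0) e1_gt0.
have [r2 r2_gt0 h2] := derivable_in_continuous (ddP Ia0) e1_gt0.
have r12 : 0 < Num.min r1 r2 / 2 by rewrite divr_gt0// lt_min r1_gt0.
have [s [s0 s1 hs]] := small_factor (normr_ge0 (a - a0)) r12.
have s01 : 0 <= s <= 1 by rewrite ltW.
have s1' : 0 <= 1 - s by rewrite subr_ge0.
have Is c c0 : I c -> I c0 -> I (s * c + (1 - s) * c0).
  move=> Ic Ic0; have [cc|/ltW cc] := leP c c0.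
    have p1 : 0 <= (1 - s) * (c0 - c) by rewrite mulr_ge0 ?subr_ge0.
    have p2 : 0 <= s * (c0 - c) by rewrite mulr_ge0 ?subr_ge0// ltW.
    by apply: (I_itv Ic Ic0); apply/andP; split; lra.
  have p1 : 0 <= (1 - s) * (c - c0) by rewrite mulr_ge0 ?subr_ge0.
  have p2 : 0 <= s * (c - c0) by rewrite mulr_ge0 ?subr_ge0// ltW.
  by apply: (I_itv Ic0 Ic); apply/andP; split; lra.
have Ias := Is _ _ Ia Ia0; have Ibs := Is _ _ Ib Ib0.
have cvx := bregman_convex s01 Ia Ib Ia0 Ib0.
move: Ias Ibs cvx; set as_ := s * a + _; set bs := s * b + _ => Ias Ibs cvx.
have asE : as_ - a0 = s * (a - a0) by rewrite /as_; ring.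
have bsE : bs - b0 = s * (b - b0) by rewrite /bs; ring.
have lt12 : `|as_ - a0| < Num.min r1 r2.
  rewrite asE normrM (gtr0_norm s0) mulrC (le_lt_trans hs)// ltr_pdivrMr// ltr_pMr ?ltr1n//.
  by rewrite lt_min r1_gt0.
move: lt12; rewrite lt_min => /andP[lt1 lt2].
have {h1} := h1 _ Ias lt1; have {h2} := h2 _ Ias lt2.
have := bregman_ge0 Ib0 Ibs; have := bregman_ge0 Ias Ia0.
rewrite {1 2}/bregman asE bsE normrM (gtr0_norm s0).
set d := dPhi as_ - dPhi a0; set rest := _ - ddPhi a0 * _ => g1 g2 d_le rest_le.
have dE : d = rest + ddPhi a0 * (s * (a - a0)) by rewrite /rest subrK.
(* This follows from [A b0 bs >= 0] and [A as_ a0 >= 0] without expanding [Phi]; only the increment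
   [d] of [dPhi] will need its first-order expansion. *)
have low : (dPhi b0 - dPhi as_) * (s * (b - b0)) - d * (b0 - a0) <=
    A as_ bs - A a0 b0.
  rewrite /d /bregman; have -> : bs - as_ = (bs - b0) + (b0 - a0) + (a0 - as_) by ring.
  rewrite bsE !mulrDr !mulrBl; lra.
have d1 : d * (s * (b - b0)) <= s * (e1 * `|b - b0|).
  rewrite mulrCA ler_pM2l// (le_trans (ler_norm _))// normrM ler_wpM2r//.
have d2 : rest * (b0 - a0) <= s * (e1 * (`|a - a0| * `|b0 - a0|)).
  rewrite (le_trans (ler_norm _))// normrM (le_trans (ler_wpM2r _ rest_le))//.
  by rewrite le_eqVlt; apply/orP; left; apply/eqP; ring.
have Ks : s * (e1 * K) <= s * e by rewrite ler_pM2l// mulrC.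
rewrite -(ler_pM2l s0); apply: subgradient_arith d1 d2 Ks _ cvx.
rewrite -dE; have -> : dPhi b0 - dPhi a0 - d = dPhi b0 - dPhi as_ by rewrite /d; ring.
exact: low.
Qed.

Lemma admissible_entropy_kernel l u : l <= u -> I l -> I u ->
  exists2 M, 0 <= M & entropy_kernel l u M (fun r => Phi (clip l u r))
    (fun r => dPhi (clip l u r)).
Proof.
move=> lu Il Iu; have Ilu a : l <= a <= u -> I a := I_itv Il Iu (z := a).
have [M1 M1_ge0 HM1] := lipschitz_on_segment I_itv lu Il Iu dP ddP.
have [M2 M2_ge0 HM2] := lipschitz_on_segment I_itv lu Il Iu ddP dddP.
have nM : 0 <= `|dPhi l| + `|dPhi u| by rewrite addr_ge0.
(* The Lipschitz constants of [Phi] and of [dPhi], and a bound of the nondecreasing [dPhi] by its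
   values at the two ends. *)
pose M := M1 + M2 + (`|dPhi l| + `|dPhi u|).
have M1M : M1 <= M by rewrite /M; lra.
have M2M : M2 <= M by rewrite /M; lra.
have Ae a b : l <= a <= u -> l <= b <= u ->
    bregman (fun r => Phi (clip l u r)) (fun r => dPhi (clip l u r)) a b = A a b.
  by move=> la lb; rewrite /bregman !clip_id.
exists M; first by rewrite !addr_ge0.
split.
- apply: continuous_measurable_fun; exact: clip_comp_continuous dP.
- apply: continuous_measurable_fun; exact: clip_comp_continuous ddP.
- by move=> a b la lb; rewrite Ae// bregman_ge0//; exact: Ilu.
- move=> a b la lb; rewrite !clip_id// (le_trans (HM1 _ _ la lb))//.
  by rewrite ler_wpM2r.
- move=> a la; rewrite clip_id//; have Ia := Ilu _ la.
  move: la => /andP[la au].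
  have := deriv_in_nondecreasing Il Ia la; have := deriv_in_nondecreasing Ia Iu au.
  have := ler_norm (- dPhi l); have := ler_norm (dPhi u); rewrite normrN.
  have := normr_ge0 (dPhi l); have := normr_ge0 (dPhi u).
  by move=> ? ? ? ? ? ?; rewrite ler_norml /M; apply/andP; split; lra.
(* Adding [A b a >= 0] gives [A a b <= (dPhi b - dPhi a) * (b - a)], and [dPhi] is Lipschitz on the
   segment. *)
- move=> a b la lb; rewrite Ae//.
  have h := bregman_ge0 (Ilu _ lb) (Ilu _ la).
  apply: (@le_trans _ _ (`|dPhi b - dPhi a| * `|b - a|)).
    by rewrite -normrM (le_trans _ (ler_norm _))//; move: h; rewrite /bregman; lra.
  rewrite -[(b - a) ^+ 2]real_normK ?num_real// expr2 mulrA ler_wpM2r//.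
  by rewrite (le_trans (HM2 _ _ lb la))// ler_wpM2r.
- move=> a0 b0 la0 lb0.
  exists (ddPhi a0 * (a0 - b0)), (dPhi b0 - dPhi a0) => a b la lb.
  by rewrite !Ae//; apply: bregman_subgradient; exact: Ilu.
Qed.

End admissible_functions.

(** * Removing the boundedness assumption *)

Lemma limn_einf_le_near {R : realType} (u : (\bar R)^nat) (b : \bar R) :
  (\forall n \near \oo, (u n <= b)%E) -> (limn_einf u <= b)%E.
Proof.
move=> [N _ ub]; rewrite limn_einf_lim; apply: lime_le; first exact: is_cvg_einfs.
apply: nearW => n; apply: (@le_trans _ _ (u (maxn n N))); last by apply: ub; exact: leq_maxr.
by apply: ereal_inf_lbound; exists (maxn n N) => //=; exact: leq_maxl.
Qed.

(** Fatou's lemma, with pointwise convergence in the form that truncation provides: a given value is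
    eventually left unclipped. *)
Lemma integral_le_near_cst {d} {T : measurableType d} {R : realType}
    (mu : {measure set T -> \bar R}) (g_ : nat -> T -> R) (g : T -> R) (b : R) :
  (forall n, measurable_fun setT (g_ n)) -> (forall n x, 0 <= g_ n x) ->
  (forall x, \forall n \near \oo, g_ n x = g x) ->
  (forall e, 0 < e -> \forall n \near \oo, (\int[mu]_x (g_ n x)%:E <= (b + e)%:E)%E) ->
  (\int[mu]_x (g x)%:E <= b%:E)%E.
Proof.
move=> mg g0 gg_ gb.
have gE x : limn_einf (fun n => (g_ n x)%:E) = (g x)%:E.
  suff /cvg_limn_einf_sup[] : (g_ n x)%:E @[n --> \oo] --> (g x)%:E by [].
  by apply: cvg_near_cst; apply: filterS (gg_ x) => n ->.
apply/lee_addgt0Pr => e e0; rewrite -EFinD.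
under eq_integral do rewrite -gE.
apply: le_trans (limn_einf_le_near (gb e e0)).
by apply: fatou => // n; [exact/measurable_EFinP | move=> *; rewrite lee_fin].
Qed.

Section entropy_of_smooth_functions.
Context {R : realType} {d : nat} {dO : measure_display}.
Context {Omega : measurableType dO} {P : probability Omega R}.
Local Notation V := 'rV[R]_d.
Context (I : set R) (I_itv : is_interval I) (I_closed : closed I).
Context (Phi : R -> R) (smoothPhi : smooth_in I Phi).
Context (Psi_ge0 : forall u v : R, I u -> I (u + v) -> 0 <= Psi I Phi u v).
Context (Psi_cvx : convex_function (Psi_domain I) (fun p => Psi I Phi p.1 p.2)).
Context (X : R -> {RV P >-> 'rV[R]_d}) (lambda : R) (theta : V).
Context (nu : {measure set 'rV[R]_d -> \bar R}) (levy_nu : levy_measure nu).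
Context (levyX : levy_process X).
Context (genX : has_generator X (levy_operator lambda theta nu)).
Context (lambda_gt0 : 0 < lambda) (t : R) (t_gt0 : 0 < t).
Context (f : V -> R) (cf : continuous f) (If : forall z, I (f z)) (x : V).
Context (int_f : semigroup_integrable X t f x).

Local Notation dPhi := (deriv_in I Phi).
Local Notation A := (bregman Phi dPhi).
Local Notation bound := ((lambda * t)%:E *
   semigroup X t (fun z => \int[nu]_y (Psi I Phi (f z) (D_ y f z))%:E) x)%E.

Let dP u : I u -> derivable_in I Phi u := @smoothPhi 0%N u.

Let Z w : V := x + X t w.

Let mZ : measurable_fun setT Z.
Proof. exact: measurable_rVD. Qed.

Let mcomp (h : V -> R) : continuous h -> measurable_fun setT (fun w => h (Z w)).
Proof. by move=> ch; apply: measurableT_comp => //; exact: continuous_measurable_rV. Qed.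

Let F l u z := clip l u (f z).

Let cF l u : continuous (F l u).
Proof.
move=> z; apply/continuous_rVP => e e0.
have [r r0 hr] := (continuous_rVP f z).1 (@cf z) e e0.
by exists r => // y zy; exact: le_trans (clip_lipschitz _ _ _ _) (hr y zy).
Qed.

Let bF l u : l <= u -> bdmeas (fun w => F l u (Z w)).
Proof.
move=> lu; apply: (@bdmeas_between _ _ _ l u); first by apply: mcomp; exact: cF.
by move=> w; exact: clip_between.
Qed.

Let mean l u := \int[P]_w F l u (Z w).

Let mean_between l u : l <= u -> l <= mean l u <= u.
Proof.
move=> lu; have lFu w := clip_between (f (Z w)) lu; apply/andP; split.
  rewrite -[leLHS](prob_Rintegral_cst P); apply: prob_Rintegral_le (bF lu) _.
    exact: bdmeas_cst.
  by move=> w; case/andP: (lFu w).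
rewrite -[leRHS](prob_Rintegral_cst P); apply: prob_Rintegral_le (bF lu) _ _.
  exact: bdmeas_cst.
by move=> w; case/andP: (lFu w).
Qed.

(** [A c] is [Phi] minus its tangent at [c], so it has the same entropy but is nonnegative. Clipping
    decreases the divergence under the integral over [nu], which makes [bound] independent of [l]
    and [u]. *)
Let truncated_entropy_bound l u c : l <= c <= u -> I l -> I u ->
  (\int[P]_w (A c (F l u (Z w)))%:E <= bound + (A c (mean l u))%:E)%E.
Proof.
move=> /andP[lc cu] Il Iu; have lu := le_trans lc cu.
have [M M0 ek] := admissible_entropy_kernel I_itv smoothPhi Psi_ge0 Psi_cvx lu Il Iu.
have Flu z : l <= F l u z <= u by exact: clip_between.
have Fid z : clip l u (F l u z) = F l u z by exact: clip_id.
have := continuous_entropy_bound levy_nu levyX genX lambda_gt0 t_gt0 x ek M0 lu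
  (@cF l u) Flu.
rewrite clip_id ?mean_between// => h.
have bPhi : bdmeas (fun w => Phi (F l u (Z w))).
  under eq_fun do rewrite -Fid.
  exact: (bdmeas_comp mZ (ek_bdmeas ek (conj (continuous_measurable_rV (@cF l u)) Flu))).
have bA : bdmeas (fun w => A c (F l u (Z w))).
  apply: bdmeasB; first by apply: bdmeasB => //; exact: bdmeas_cst.
  by apply: bdmeasZ; apply: bdmeasB; [exact: bF | exact: bdmeas_cst].
have AE : \int[P]_w A c (F l u (Z w)) =
    \int[P]_w Phi (F l u (Z w)) - Phi (mean l u) + A c (mean l u).
  have bc (k : R) : bdmeas (fun _ : Omega => k) := bdmeas_cst k.
  have bi (g : Omega -> R) : bdmeas g -> P.-integrable setT (EFin \o g).
    by move=> bg; exact: bdmeas_integrable.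
  rewrite /bregman RintegralB//; [|exact/bi/bdmeasB|exact/bi/bdmeasZ/bdmeasB/bc/bF].
  rewrite RintegralB//; [|exact: bi..].
  rewrite RintegralZl//; last exact/bi/bdmeasB/bc/bF.
  rewrite RintegralB//; [|exact/bi/bF|exact: bi].
  by rewrite !prob_Rintegral_cst -/(mean l u); ring.
rewrite -bdmeas_Rintegral_EFin// AE EFinD leeD2r//.
have -> : \int[P]_w Phi (F l u (Z w)) = \int[P]_w Phi (clip l u (F l u (Z w))).
  by apply: eq_Rintegral => w _; rewrite Fid.
apply: le_trans h _; apply: lee_wpmul2l; first by rewrite lee_fin mulr_ge0// ltW.
have bregman_Fge0 (a b : V) : 0 <= A (F l u a) (F l u b).
  by apply: (bregman_ge0 Psi_ge0); apply: clip_in.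
apply: ge0_le_integral_nonmeasurable => w.
  by apply: integral_ge0 => y _; rewrite lee_fin (ek_ge0 ek).
apply: ge0_le_integral_nonmeasurable => y; first by rewrite lee_fin (ek_ge0 ek).
rewrite lee_fin /bregman !Fid /D_ -bregmanE.
exact: bregman_clip.
Qed.

Lemma Phi_entropy_le_Psi : (Phi_entropy X t Phi f x <= bound)%E.
Proof.
pose c := f 0; have Ic : I c := If 0.
have /choice[l lP] (k : nat) : exists l, [/\ I l, l <= c &
    forall r, I r -> c - k%:R <= r -> l <= r].
  exact: (interval_lower_end I_itv I_closed Ic (ler0n R k)).
have /choice[u uP] (k : nat) : exists u, [/\ I u, c <= u &
    forall r, I r -> r <= c + k%:R -> r <= u].
  exact: (interval_upper_end I_itv I_closed Ic (ler0n R k)).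
have Il k : I (l k) by case: (lP k).
have Iu k : I (u k) by case: (uP k).
have lcu k : l k <= c <= u k by case: (lP k) => _ -> _; case: (uP k).
have lu k : l k <= u k by have /andP[] := lcu k; exact: le_trans.
have Fnear z : \forall k \near \oo, F (l k) (u k) z = f z.
  near=> k; have fk : `|f z - c| <= k%:R by near: k; exact: nbhs_infty_ger.
  move: fk; rewrite ler_norml => /andP[h1 h2]; rewrite /F clip_id//.
  case: (lP k) => _ _ -> //; last lra.
  by case: (uP k) => _ _ -> //; lra.
have icst (k : R) : P.-integrable setT (fun _ : Omega => k%:E).
  exact: (bdmeas_integrable P (bdmeas_cst k)).
pose m := rsemigroup X t f x.
have mE : (\int[P]_w (f (Z w))%:E = m%:E)%E.
  by rewrite /m /rsemigroup fineK//; exact: integral_fune_fin_num.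
(* Clipping is 1-Lipschitz and fixes [c], so all the truncations are dominated by [|c| + |f - c|],
   integrable because [f] is. *)
have mean_cvg : mean (l k) (u k) @[k --> \oo] --> m.
  rewrite (_ : (fun k => _) = fine \o (fun k => \int[P]_w (F (l k) (u k) (Z w))%:E)%E).
    apply: fine_cvg; rewrite -mE.
    apply: (@dominated_cvg _ _ _ _ _ measurableT _ _
      (fun w => (`|c| + `|f (Z w) - c|)%:E)) => //.
    - by move=> k; apply/measurable_EFinP/mcomp; exact: cF.
    - move=> w _; apply: cvg_near_cst; apply: filterS (Fnear (Z w)) => k; by move=> ->.
    - rewrite (_ : (fun w => _) = ((fun=> (`|c|%R)%:E) \+ (fun w => `|(f (Z w))%:E - c%:E|))%E); last first.
        by apply/funext => w; rewrite EFinD -EFinB.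
      apply: integrableD => //; apply: integrable_abse; exact: integrableB.
    - move=> k w _; rewrite lee_fin.
      have -> : F (l k) (u k) (Z w) = c + (F (l k) (u k) (Z w) - clip (l k) (u k) c).
        by rewrite [clip _ _ c]clip_id//; ring.
      by rewrite (le_trans (ler_normD _ _))// lerD2l clip_lipschitz.
  by apply/funext => k /=.
have Im : I m.
  apply: (@closed_cvg _ _ \oo _ (fun k => mean (l k) (u k)) I I_closed _ m mean_cvg); apply: nearW => k.
  exact: (I_itv (Il k) (Iu k) (mean_between (lu k))).
have mA (h : V -> R) : continuous h -> (forall z, I (h z)) ->
    measurable_fun setT (fun w => A c (h (Z w))).
  move=> ch Ih; apply: measurable_funB; last first.
    by apply: measurable_funM => //; apply: measurable_funB => //; exact: mcomp.
  apply: measurable_funB => //; apply: (@mcomp (fun z => Phi (h z))) => z.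
  apply/continuous_rVP => e e0.
  have [r r0 hr] := derivable_in_continuous (dP (Ih z)) e0.
  have r20 : 0 < r / 2 by rewrite divr_gt0.
  have [q q0 hq] := (continuous_rVP h z).1 (@ch z) _ r20.
  exists q => // y zy; rewrite distrC; apply: hr => //; rewrite distrC.
  by rewrite (le_lt_trans (hq y zy))// ltr_pdivrMr// ltr_pMr// ltr1n.
have bound0 : (0 <= bound)%E.
  apply: mule_ge0; first by rewrite lee_fin mulr_ge0// ltW.
  apply: integral_ge0 => w _; apply: integral_ge0 => y _; rewrite lee_fin.
  by apply: Psi_ge0 => //; rewrite /D_ subrKC.
(* An infinite bound leaves nothing to prove. A finite one will make [A c (f (Z w))] integrable, so
   that the integral of [Phi (f)] can be split. *)
case RE : bound => [r||]; [|by rewrite leey|by move: bound0; rewrite RE].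
have Ale : (\int[P]_w (A c (f (Z w)))%:E <= (r + A c m)%:E)%E.
  apply: (@integral_le_near_cst _ _ _ P (fun k w => A c (F (l k) (u k) (Z w)))).
  - move=> k; apply: mA; first exact: cF.
    by move=> z; exact: clip_in.
  - move=> k w; apply: (bregman_ge0 Psi_ge0) => //; exact: clip_in.
  - by move=> w; apply: filterS (Fnear (Z w)) => k ->.
  (* One half of [e] is for the continuity of [Phi] at [m], the other for the linear term of
     [A c]. *)
  - move=> e e0; have e2 : 0 < e / 2 by rewrite divr_gt0.
    have [r1 r1_gt0 h1] := derivable_in_continuous (dP Im) e2.
    have [r2 [r2_gt0 _ h2]] := small_factor (normr_ge0 (dPhi c)) e2.
    have r12 : 0 < Num.min r1 r2 by rewrite lt_min r1_gt0.
    near=> k; apply: (le_trans (truncated_entropy_bound (lcu k) (Il k) (Iu k))).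
    rewrite RE -EFinD lee_fin -addrA lerD2l.
    have Imk : I (mean (l k) (u k)) := I_itv (Il k) (Iu k) (mean_between (lu k)).
    have : `|m - mean (l k) (u k)| < Num.min r1 r2.
      by near: k; move/cvgrPdist_lt : mean_cvg => /(_ _ r12).
    rewrite distrC lt_min => /andP[/(h1 _ Imk) k1 /ltW k2].
    have k3 : `|dPhi c * (mean (l k) (u k) - m)| <= e / 2.
      by rewrite normrM (le_trans _ h2)// ler_wpM2l.
    move: k1 k3; rewrite /bregman !ler_norml => /andP[_ ?] /andP[? _]; lra.
have A0 w : 0 <= A c (f (Z w)) := bregman_ge0 Psi_ge0 Ic (If (Z w)).
have iA : P.-integrable setT (fun w => (A c (f (Z w)))%:E).
  apply/integrableP; split; first by apply/measurable_EFinP; exact: mA.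
  under eq_integral do rewrite gee0_abs ?lee_fin//.
  exact: le_lt_trans Ale (ltry _).
rewrite /Phi_entropy /semigroup.
(* The tangent at [c] is added back; its expectation is [Phi c + dPhi c * (m - c)]. *)
have -> : (\int[P]_w (Phi (f (x + X t w)))%:E = \int[P]_w (A c (f (Z w)))%:E +
    (Phi c - dPhi c * c + dPhi c * m)%:E)%E.
  have iZ : P.-integrable setT (fun w => (dPhi c)%:E * (f (Z w))%:E)%E by exact: integrableZl.
  have cE : ((Phi c - dPhi c * c)%:E = \int[P]_w (Phi c - dPhi c * c)%:E)%E.
    by rewrite -bdmeas_Rintegral_EFin ?prob_Rintegral_cst//; exact: bdmeas_cst.
  rewrite EFinD EFinM -mE -integralZl// cE -integralD// -integralD//; last exact: integrableD.
  by apply: eq_integral => w _; rewrite -!EFinM -!EFinD /bregman; congr EFin; ring.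
rewrite leeBlDr// -EFinD; apply: le_trans (leeD2r _ Ale) _.
by rewrite -!EFinD lee_fin /bregman -/m; lra.
Unshelve. all: by end_near. Qed.

End entropy_of_smooth_functions.

Theorem theorem23 (R : realType) (d : nat) (dO : measure_display)
    (Omega : measurableType dO) (P : probability Omega R)
    (I : set R) (Phi : R -> R)
    (lambda : R) (theta : 'rV[R]_d) (nu : {measure set 'rV[R]_d -> \bar R})
    (X : R -> {RV P >-> 'rV[R]_d}) :
  is_interval I -> closed I ->
  smooth_in I Phi -> convex_function (I : set R^o) Phi ->
  (forall u v : R, I u -> I (u + v) -> 0 <= Psi I Phi u v) ->
  convex_function (Psi_domain I) (fun p => Psi I Phi p.1 p.2) ->
  0 < lambda -> levy_measure nu -> levy_integrable theta nu ->
  levy_process X -> has_generator X (levy_operator lambda theta nu) ->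
  forall t : R, 0 < t ->
  forall f : 'rV[R]_d -> R, smooth f -> (forall x, I (f x)) ->
  forall x : 'rV[R]_d, semigroup_integrable X t f x ->
  (Phi_entropy X t Phi f x <=
   (lambda * t)%:E *
   semigroup X t (fun z => \int[nu]_y (Psi I Phi (f z) (D_ y f z))%:E) x)%E.
Proof.
move=> I_itv I_closed sPhi _ Psi_ge0 Psi_cvx lambda0 levy_nu _ levyX genX t t0 f sf If x xf.
exact: (Phi_entropy_le_Psi I_itv I_closed sPhi Psi_ge0 Psi_cvx levy_nu levyX genX
  lambda0 t0 (sf [::]).1 If xf).
Qed.
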